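(* Let $N\ge2$ and let $\Omega\subset\mathbb{R}^N$ be a bounded and smooth domain with distance function to the boundary $\rho(x)=\inf_{y\in\partial\Omega}|y-x|$. For each $p>N$ let $u_p$ denote a positive extremal function of $\Lambda_p(\Omega)$ and $x_p$ its unique maximum point. Then there exist $p_n\to\infty$, $x_*\in\Omega$ and $u_\infty\in W_0^{1,\infty}(\Omega)$ such that: (i) $u_{p_n}$ converges to $u_\infty$ weakly in $W_0^{1,r}(\Omega)$, for any $r>N$, and uniformly in $\overline\Omega$; (ii) $\|\nabla u_\infty\|_\infty=\dfrac1{\|\rho\|_\infty}$; (iii) $0\le u_\infty\le\dfrac{\rho}{\|\rho\|_\infty}$ a.e. in $\Omega$; (iv) $x_{p_n}\to x_*$; (v) $u_\infty(x_* )=1=\|u_\infty\|_\infty$ and $\rho(x_* )=\|\rho\|_\infty$.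
   Context: $\|\cdot\|_s$ denotes the norm of $L^s(\Omega)$. For $p>N$, $\Lambda_p(\Omega)=\min\{\|\nabla u\|_p^p:u\in W_0^{1,p}(\Omega),\ \|u\|_\infty=1\}$. A positive extremal function of $\Lambda_p(\Omega)$ is a function $u_p\in W_0^{1,p}(\Omega)$ with $u_p>0$ in $\Omega$, $\|u_p\|_\infty=1$ and $\|\nabla u_p\|_p^p=\Lambda_p(\Omega)$; such functions exist, are continuous on $\overline\Omega$, and have a unique maximum point $x_p\in\Omega$, so that $u_p(x_p)=1$. *)

(* Defs.v *)
From HB Require Import structures.
From mathcomp Require Import all_boot all_order all_algebra.
From mathcomp Require Import all_classical all_reals all_analysis.

Set Implicit Arguments.
Unset Strict Implicit.
Unset Printing Implicit Defensive.
Import Order.TTheory GRing.Theory Num.Theory.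
Import numFieldNormedType.Exports.

Local Open Scope classical_set_scope.
Local Open Scope ring_scope.

(* Borel sigma-algebra of R^n, generated by the coordinate maps as the library
   does for n-tuples. *)
Definition measure_rV_display : measure_display -> measure_display.
Proof. exact. Qed.

Section measurable_rV.
Context d (T : measurableType d) (n : nat).

Let coord : 'I_n -> 'rV[T]_n -> T := fun i x => x 0 i.

Let rV_set0 : g_sigma_preimage coord set0.
Proof. exact: sigma_algebra0. Qed.

Let rV_setC A : g_sigma_preimage coord A -> g_sigma_preimage coord (~` A).
Proof. exact: sigma_algebraC. Qed.

Let rV_bigcup (F : _^nat) : (forall i, g_sigma_preimage coord (F i)) ->
  g_sigma_preimage coord (\bigcup_i (F i)).
Proof. exact: sigma_algebra_bigcup. Qed.

HB.instance Definition _ := @isMeasurable.Build (measure_rV_display d)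
  'rV[T]_n (g_sigma_preimage coord) rV_set0 rV_setC rV_bigcup.

Lemma measurable_coord (i : 'I_n) :
  measurable_fun [set: 'rV[T]_n] (fun x : 'rV[T]_n => x 0 i).
Proof.
move=> _ Y mY; rewrite setTI; apply: sub_sigma_algebra => /=.
rewrite -bigcup_seq/=; exists i => /=; first by rewrite mem_index_enum.
by exists Y => //; rewrite setTI.
Qed.

Lemma measurable_fun_rV d1 (T1 : measurableType d1) (f : T1 -> 'rV[T]_n) :
  (forall i, measurable_fun [set: T1] (fun x => f x 0 i)) ->
  measurable_fun [set: T1] f.
Proof.
move=> mf _ Y mY; rewrite setTI.
suff : g_sigma_preimage coord `<=` [set A | measurable (f @^-1` A)] by exact.
apply: smallest_sub.
  split => [|A mA|F mF] /=.
  - by rewrite preimage_set0.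
  - by rewrite setTD; exact: measurableC mA.
  - apply: (@bigcup_measurable _ _ (fun k => f @^-1` F k) setT) => k _; exact: mF.
rewrite -bigcup_seq; apply: bigcup_sub => i _ _ [B mB <-].
by rewrite /= setTI -[X in measurable X]setTI; exact: mf.
Qed.

End measurable_rV.

Section lebesgue_measure_rV.
Context (R : realType).

Definition cons_rV n (z : measurableTypeR R * 'rV[R]_n) : 'rV[R]_n.+1 :=
  row_mx (const_mx z.1 : 'rV[R]_1) z.2.

Lemma cons_rV0 n z : @cons_rV n z 0 ord0 = z.1.
Proof. by rewrite mxE; case: splitP => // j _; rewrite mxE. Qed.

Lemma cons_rVS n z (i : 'I_n) : @cons_rV n z 0 (lift ord0 i) = z.2 0 i.
Proof.
rewrite mxE; case: splitP => [j|j /= ij]; first by case: j => -[].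
by congr (z.2 0 _); apply/val_inj; case: ij.
Qed.

Lemma measurable_cons_rV n : measurable_fun [set: _] (@cons_rV n).
Proof.
apply: measurable_fun_rV => i; case: (unliftP ord0 i) => [j ->|->].
- rewrite (_ : (fun x => _) = (fun x : 'rV[R]_n => x 0 j) \o snd).
    by apply: measurableT_comp => //; exact: measurable_coord.
  by apply/funext => z /=; rewrite cons_rVS.
- rewrite (_ : (fun x => _) = fst); first exact: measurable_fst.
  by apply/funext => z /=; rewrite cons_rV0.
Qed.

Section step.
Variables (n : nat) (m : {sigma_finite_measure set 'rV[R]_n -> \bar R}).

Definition lebesgue_rV_step : set 'rV[R]_n.+1 -> \bar R :=
  pushforward (lebesgue_measure \x m)%E (@cons_rV n).

Let mcons := @measurable_cons_rV n.

Let step0 : lebesgue_rV_step set0 = 0%E.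
Proof. exact: measure0. Qed.

Let step_ge0 A : (0 <= lebesgue_rV_step A)%E.
Proof. exact: measure_ge0. Qed.

Let step_sigma_additive : semi_sigma_additive lebesgue_rV_step.
Proof. exact: measure_semi_sigma_additive. Qed.

HB.instance Definition _ := isMeasure.Build _ _ _ lebesgue_rV_step
  step0 step_ge0 step_sigma_additive.

Let step_sigma_finite : sigma_finite setT lebesgue_rV_step.
Proof.
have /sigma_finiteP[F [TF ndF Foo]] := sigma_finiteT (@lebesgue_measure R).
have /sigma_finiteP[G [TG ndG Goo]] := sigma_finiteT m.
pose h (x : 'rV[R]_n.+1) : measurableTypeR R * 'rV[R]_n :=
  (x 0 ord0, \row_i x 0 (lift ord0 i)).
have hK z : h (cons_rV z) = z.
  rewrite /h cons_rV0 (_ : \row_i _ = z.2); first by case: z.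
  by apply/rowP => i; rewrite mxE cons_rVS.
have mh : measurable_fun [set: 'rV[R]_n.+1] h.
  apply: measurable_fun_pair; first exact: measurable_coord.
  apply: measurable_fun_rV => i /=.
  by under eq_fun do rewrite mxE; exact: measurable_coord.
exists (fun k => h @^-1` (F k `*` G k)).
  apply/esym; rewrite -subTset => x _.
  have : setT (h x).1 by []. rewrite TF => -[i _ Fi].
  have : setT (h x).2 by []. rewrite TG => -[j _ Gj].
  exists (maxn i j) => //; split.
    by move: Fi; exact/subsetPset/ndF/leq_maxl.
  by move: Gj; exact/subsetPset/ndG/leq_maxr.
move=> k; have [mF Fk] := Foo k; have [mG Gk] := Goo k; split.
  by rewrite -[X in measurable X]setTI; apply: mh => //; exact: measurableX.
rewrite /lebesgue_rV_step /pushforward (_ : _ @^-1` _ = F k `*` G k); last first.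
  by rewrite -comp_preimage (_ : h \o _ = id)//; exact/funext.
by rewrite product_measure1E// lte_mul_pinfty// ge0_fin_numE.
Qed.

HB.instance Definition _ := Measure_isSigmaFinite.Build _ _ _ lebesgue_rV_step
  step_sigma_finite.

End step.

(* Lebesgue measure on R^n, as the n-fold product of Lebesgue measure on R. *)
Fixpoint lebesgue_measure_rV (n : nat) :
    {sigma_finite_measure set 'rV[R]_n -> \bar R} :=
  if n is n'.+1 then lebesgue_rV_step (lebesgue_measure_rV n')
  else \d_(0 : 'rV[R]_0).

End lebesgue_measure_rV.

Lemma measurable_box (R : realType) n (a b : 'I_n -> R) :
 measurable [set x : 'rV[R]_n | forall i, a i <= x 0 i <= b i].
Proof.
rewrite (_ : mkset _ = \bigcap_(i in [set: 'I_n])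
   ((fun x : 'rV[R]_n => x 0 i) @^-1` `[a i, b i])); last first.
  apply/seteqP; split => x /= h i; first by move=> _; rewrite /= in_itv/=; exact: h.
  by have := h i I; rewrite /= in_itv.
apply: fin_bigcap_measurable => //= i _.
by rewrite -[X in measurable X]setTI; apply: measurable_coord => //; exact: measurable_itv.
Qed.

Lemma lebesgue_measure_rV_box (R : realType) n (a b : 'I_n -> R) :
  (forall i, a i <= b i) ->
  lebesgue_measure_rV R n [set x : 'rV[R]_n | forall i, a i <= x 0 i <= b i] =
  (\prod_(i < n) (b i - a i))%:E.
Proof.
elim: n a b => [|n IH] a b ab.
  by rewrite /= diracE big_ord0 mem_set// => -[].
rewrite -[LHS]/((lebesgue_measure \x lebesgue_measure_rV R n)%E (@cons_rV R n @^-1` [set x | forall i, a i <= x 0 i <= b i])).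
rewrite (_ : @cons_rV R n @^-1` _ = `[a ord0, b ord0] `*`
  [set x : 'rV[R]_n | forall i, a (lift ord0 i) <= x 0 i <= b (lift ord0 i)]); last first.
  apply/seteqP; split => -[z1 z2] /=.
    move=> h; split; first by have := h ord0; rewrite cons_rV0 in_itv.
    by move=> i; have := h (lift ord0 i); rewrite cons_rVS.
  move=> [h0 h] i; case: (unliftP ord0 i) => [j ->|->].
    by rewrite cons_rVS; exact: h.
  by rewrite cons_rV0; move: h0; rewrite in_itv.
rewrite product_measure1E//; last exact: measurable_box.
rewrite IH; last by move=> i; exact: ab.
rewrite [X in (X * _)%E](lebesgue_measure_itv `[a ord0, b ord0]) /= lte_fin big_ord_recl EFinM.
case: ltP => // ba.
have -> : b ord0 = a ord0 by apply/eqP; rewrite eq_le ba ab.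
by rewrite subrr !mul0e.
Qed.

Section sobolev.
Context (R : realType).
Implicit Types (n : nat) (s : \bar R) (p r : R).

(* The normed structure of 'rV[R]_n carries the sup norm; distances and norms
   of gradients below are Euclidean. *)
Definition enorm n (x : 'rV[R]_n) : R := Num.sqrt (\sum_i x 0 i ^+ 2).

Definition boundary n (A : set 'rV[R]_n) : set 'rV[R]_n :=
  closure A `\` interior A.

Definition dist_boundary n (Om : set 'rV[R]_n) (x : 'rV[R]_n) : R :=
  inf [set enorm (y - x) | y in boundary Om].

Definition partial n (i : 'I_n) (f : 'rV[R]_n -> R) : 'rV[R]_n -> R :=
  fun x => 'D_(delta_mx 0 i) f x.

(* f is C^oo: all iterated partial derivatives are (Frechet) differentiable. *)
Definition smooth n (f : 'rV[R]_n -> R) : Prop :=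
  forall (l : seq 'I_n) x, differentiable (foldr (@partial n) f l) x.

(* Near each boundary point, up to the choice and the orientation of one
   coordinate, Om is the strict epigraph of a C^oo function of the others. *)
Definition smooth_boundary n (Om : set 'rV[R]_n) : Prop :=
  forall x0, boundary Om x0 ->
  exists (e : R) (i : 'I_n) (b : bool) (g : 'rV[R]_n.-1 -> R),
    [/\ 0 < e, smooth g &
        forall y, enorm (y - x0) < e ->
          Om y <-> g (col' i y) < (-1) ^+ b * y 0 i].

Definition smooth_bounded_domain n (Om : set 'rV[R]_n) : Prop :=
  [/\ Om !=set0, open Om, connected Om, bounded_set Om & smooth_boundary Om].

Section on_domain.
Variables (n : nat) (Om : set 'rV[R]_n).
Implicit Types u v phi : 'rV[R]_n -> R.

Local Notation mu := (lebesgue_measure_rV R n).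

Definition normL s u : \bar R := 'N[mu]_s[patch (fun=> 0%E) Om (EFin \o u)]%E.

Definition memL s u : Prop := measurable_fun Om u /\ (normL s u < +oo)%E.

Definition loc_integrable u : Prop :=
  measurable_fun Om u /\
  forall K, K `<=` Om -> compact K -> mu.-integrable K (EFin \o u).

Definition test_function phi : Prop :=
  smooth phi /\
  exists K, [/\ compact K, K `<=` Om & forall x, ~ K x -> phi x = 0].

Definition weak_gradient u (G : 'rV[R]_n -> 'rV[R]_n) : Prop :=
  [/\ loc_integrable u,
      (forall i, loc_integrable (fun x => G x 0 i)) &
      forall phi i, test_function phi ->
        \int[mu]_(x in Om) (u x * partial i phi x) =
        - \int[mu]_(x in Om) (G x 0 i * phi x)].

(* The weak gradient of u, determined almost everywhere in Om. *)
Definition grad u : 'rV[R]_n -> 'rV[R]_n :=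
  xget (fun=> 0) [set G | weak_gradient u G].

Definition sobolev s u : Prop :=
  memL s u /\
  exists2 G, weak_gradient u G & forall i, memL s (fun x => G x 0 i).

Definition grad_norm s u : \bar R := normL s (enorm (n := n) \o grad u).

Definition sobolev_norm s u : \bar R := (normL s u + grad_norm s u)%E.

(* W_0^{1,p}(Om), p < +oo: the closure of C_c^oo(Om) in W^{1,p}(Om). *)
Definition sobolev0 p u : Prop :=
  sobolev p%:E u /\
  forall e : R, 0 < e ->
    exists2 phi, test_function phi & (sobolev_norm p%:E (u \- phi)%R < e%:E)%E.

(* W_0^{1,oo}(Om); the closure of C_c^oo(Om) in W^{1,oo}(Om) would contain
   only C^1 functions. *)
Definition sobolev0_oo u : Prop :=
  sobolev +oo u /\ forall p, 1 <= p -> sobolev0 p u.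

(* Functions are not identified almost everywhere; the bound makes l constant
   on the classes of W_0^{1,r}(Om). *)
Definition sobolev0_dual r (l : ('rV[R]_n -> R) -> R) : Prop :=
  (forall (a : R) v w, sobolev0 r v -> sobolev0 r w ->
     l (fun x => a * v x + w x) = a * l v + l w) /\
  exists C : R, forall v, sobolev0 r v ->
    (`|l v|%:E <= C%:E * sobolev_norm r%:E v)%E.

(* The sequence need only lie in W_0^{1,r}(Om) from some rank on. *)
Definition weak_cvg_sobolev0 r (v : nat -> 'rV[R]_n -> R) w : Prop :=
  [/\ (\forall k \near \oo, sobolev0 r (v k)), sobolev0 r w &
      forall l, sobolev0_dual r l -> l (v k) @[k --> \oo] --> l w].

Definition Lambda p : \bar R :=
  ereal_inf [set (grad_norm p%:E v `^ p)%E | v in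
    [set v | sobolev0 p v /\ normL +oo v = 1%E]].

(* u is the representative that is continuous up to the boundary. *)
Definition positive_extremal p u : Prop :=
  [/\ sobolev0 p u, {within closure Om, continuous u},
      (forall x, Om x -> 0 < u x),
      normL +oo u = 1%E & (grad_norm p%:E u `^ p)%E = Lambda p].

Definition unique_max_point u (x : 'rV[R]_n) : Prop :=
  Om x /\ forall y, Om y -> y != x -> u y < u x.

End on_domain.
End sobolev.

(* Main.v *)
(** Let [r0 = ||rho||_oo]. A smoothed cone of height close to [r0] over an almost
    inscribed ball gives [Lambda_p <= |Om| / r0^p], so [||grad u_p||_p <= |Om|^(1/p) / r0].
    Morrey's inequality on cubes of side [s] has a constant tending to
    [|x - y| + N s] as [p -> oo]; hence the [u_p], extended by zero, are asymptotically
    equicontinuous and every limit [uoo] is [1/r0]-Lipschitz and vanishes off [Om].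
    Then [uoo <= rho / r0], and [1 = uoo xstar <= rho xstar / r0] forces
    [rho xstar = r0]. The gradient bound passes to every exponent [r], whence
    [||grad uoo||_oo <= 1 / r0]; conversely Morrey's inequality for [uoo] shows that
    [||grad uoo||_oo] is a Lipschitz constant, so it is at least [1 / r0].
    For the weak convergence, convex sets of competitors uniformly close to [uoo] are
    treated as in Mazur's lemma: Clarkson's inequality makes minimizing sequences
    of the gradient norm Cauchy, so they converge strongly, necessarily to [uoo]. *)

Require Import Defs.
From HB Require Import structures.
From mathcomp Require Import all_boot all_order all_algebra.
From mathcomp Require Import all_classical all_reals all_analysis.
From mathcomp Require Import measurable_realfun ess_sup_inf ring lra.

Set Implicit Arguments.
Unset Strict Implicit.
Unset Printing Implicit Defensive.
Import Order.TTheory GRing.Theory Num.Theory.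
Import numFieldNormedType.Exports.

Local Open Scope classical_set_scope.
Local Open Scope ring_scope.

(** * Euclidean norm, boxes and Lebesgue measure *)

(** The limit must have Lipschitz constant exactly [1 / r0], so a Morrey inequality whose constant
    merely stays bounded does not suffice. The side [s] of the averaging cube is therefore kept
    independent of [|x - y|]: for fixed [s] the exponent tends to infinity, and only then does [s]
    tend to [0]. All estimates concern functions extended by zero and approximated by test functions
    vanishing off [Om]. Segments and cubes may thus leave [Om], and the limit is Lipschitz on the
    whole space; comparing a point of [Om] with boundary points, where the limit is [0], yields the
    bound by [rho]. Compactness enters once: along an ultrafilter all pointwise limits and the limit
    of the maximum points exist together, and asymptotic equicontinuity makes the convergence
    uniform. Weak convergence is then derived for each [r] from uniform convergence and a gradient
    bound alone, so that one sequence of exponents serves every [r]. *)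

Section euclidean_norm.
Context {R : realType} {n : nat}.
Implicit Types x y z : 'rV[R]_n.

Lemma enorm_ge0 x : 0 <= enorm x. Proof. exact: sqrtr_ge0. Qed.

Lemma sqr_enorm x : enorm x ^+ 2 = \sum_i x 0 i ^+ 2.
Proof. by rewrite sqr_sqrtr// sumr_ge0// => i _; exact: sqr_ge0. Qed.

Lemma enorm_eq0 x : enorm x = 0 -> x = 0.
Proof.
move=> x0; apply/rowP => i; rewrite mxE; apply/eqP; rewrite -sqrf_eq0.
have /eqP := sqr_enorm x; rewrite x0 expr0n/= eq_sym psumr_eq0.
  by move=> /allP/(_ i); rewrite mem_index_enum => /(_ isT).
by move=> j _; exact: sqr_ge0.
Qed.

Lemma enorm0 : enorm (0 : 'rV[R]_n) = 0.
Proof. by rewrite /enorm big1 ?sqrtr0// => i _; rewrite mxE expr0n. Qed.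

Lemma enormZ (a : R) x : enorm (a *: x) = `|a| * enorm x.
Proof.
rewrite /enorm -sqrtr_sqr -sqrtrM ?sqr_ge0// mulr_sumr.
by congr Num.sqrt; apply: eq_bigr => i _; rewrite mxE exprMn.
Qed.

Lemma enormN x : enorm (- x) = enorm x.
Proof. by rewrite -scaleN1r enormZ normrN1 mul1r. Qed.

Lemma enorm_sub x y : enorm (x - y) = enorm (y - x).
Proof. by rewrite -enormN opprB. Qed.

Lemma cauchy_schwarz_enorm x y : `|\sum_i x 0 i * y 0 i| <= enorm x * enorm y.
Proof.
wlog : x / 0 <= \sum_i x 0 i * y 0 i.
  move=> H; have [|h] := leP 0 (\sum_i x 0 i * y 0 i); first exact: H.
  have := H (- x); rewrite enormN.
  rewrite (_ : \sum_i _ = - \sum_i x 0 i * y 0 i).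
    by rewrite normrN; apply; rewrite oppr_ge0 ltW.
  by rewrite -sumrN; apply: eq_bigr => i _; rewrite mxE mulNr.
move=> s0; rewrite ger0_norm//.
have [x0|x0] := eqVneq (enorm x) 0.
  rewrite x0 mul0r big1// => i _.
  by rewrite (enorm_eq0 x0) mxE mul0r.
have [y0|y0] := eqVneq (enorm y) 0.
  rewrite y0 mulr0 big1// => i _.
  by rewrite (enorm_eq0 y0) mxE mulr0.
have xy0 : 0 < enorm x * enorm y.
  by rewrite mulr_gt0// lt0r ?x0 ?y0 enorm_ge0.
(* The sum expands to [2 |x| |y| (|x| |y| - x.y)]; the degenerate cases were removed above so that
   [|x| |y|] can be cancelled. *)
have : 0 <= \sum_i (enorm y * x 0 i - enorm x * y 0 i) ^+ 2.
  by apply: sumr_ge0 => i _; exact: sqr_ge0.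
under eq_bigr do rewrite sqrrB !exprMn.
rewrite big_split sumrB/= -!mulr_sumr -!sqr_enorm.
rewrite (_ : \sum_i _ = (enorm x * enorm y * \sum_i x 0 i * y 0 i) *+ 2); last first.
  by rewrite mulr_sumr -sumrMnl; apply: eq_bigr => i _; congr (_ *+ 2); ring.
move=> h; rewrite -(ler_pM2l xy0); lra.
Qed.

Lemma ler_enormD x y : enorm (x + y) <= enorm x + enorm y.
Proof.
rewrite -(@ler_pXn2r _ 2)// ?nnegrE ?addr_ge0 ?enorm_ge0//.
rewrite sqr_enorm sqrrD !sqr_enorm.
under eq_bigr do rewrite mxE sqrrD.
rewrite !big_split/= lerD2r lerD2l.
rewrite -mulr2n lerMn2r/=.
by apply: le_trans (cauchy_schwarz_enorm _ _); exact: ler_norm.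
Qed.

Lemma ler_enorm_trans z x y : enorm (x - y) <= enorm (x - z) + enorm (z - y).
Proof. by apply: le_trans (ler_enormD _ _); rewrite addrA subrK. Qed.

Lemma ler_coord_enorm x i : `|x 0 i| <= enorm x.
Proof.
rewrite -sqrtr_sqr ler_sqrt; last by rewrite sumr_ge0// => j _; exact: sqr_ge0.
by rewrite (bigD1 i)//= lerDl sumr_ge0// => j _; exact: sqr_ge0.
Qed.

Lemma ler_coord_norm x i : `|x 0 i| <= `|x|.
Proof.
rewrite [leRHS]mx_normrE.
by apply: (le_bigmax _ (fun k : 'I_1 * 'I_n => `|x k.1 k.2|) (0, i)).
Qed.

Lemma norm_leP x (e : R) : 0 <= e -> (forall i, `|x 0 i| <= e) -> `|x| <= e.
Proof.
move=> e0 xe; rewrite [leLHS]mx_normrE.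
by apply/bigmax_leP; split => // -[i j] _ /=; rewrite ord1.
Qed.

Lemma ler_norm_enorm x : `|x| <= enorm x.
Proof. by apply: norm_leP => [|i]; [exact: enorm_ge0|exact: ler_coord_enorm]. Qed.

Lemma ler_enorm_norm x : enorm x <= n%:R * `|x|.
Proof.
rewrite -(@ler_pXn2r _ 2)// ?nnegrE ?enorm_ge0 ?mulr_ge0// sqr_enorm.
apply: (@le_trans _ _ (\sum_(i < n) `|x| ^+ 2)).
  by apply: ler_sum => i _; rewrite -real_normK ?num_real// lerXn2r ?nnegrE// ler_coord_norm.
rewrite sumr_const card_ord exprMn -[leLHS]mulr_natl ler_wpM2r ?sqr_ge0//.
by rewrite -natrX ler_nat; case: (n) => // k; rewrite expnS expn1 leq_pmulr.
Qed.

Lemma ler_enorm_coord x (d : R) : (forall i, `|x 0 i| <= d) -> 0 <= d ->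
  enorm x <= n%:R * d.
Proof.
move=> xd d0; apply: le_trans (ler_enorm_norm x) _.
by rewrite ler_wpM2l// norm_leP.
Qed.

Lemma continuous_enorm : continuous (@enorm R n).
Proof.
move=> x; apply/(@cvgrPdist_le _ _ _ (nbhs x)) => e e0.
have n0 : 0 < n%:R + 1 :> R by rewrite ltr_wpDl.
near=> y.
have h : enorm (x - y) <= e.
  apply: le_trans (ler_enorm_norm _) _.
  apply: (@le_trans _ _ ((n%:R + 1) * `|x - y|)); first by rewrite ler_wpM2r// lerDl.
  rewrite -ler_pdivlMl// mulrC; near: y.
  by apply: cvgr_dist_le => //; exact: divr_gt0.
have := ler_enorm_trans y x 0; have := ler_enorm_trans x y 0; rewrite !subr0.
rewrite (enorm_sub y x) => h1 h2.
by rewrite ler_norml; apply/andP; split; lra.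
Unshelve. all: by end_near. Qed.

End euclidean_norm.

Section boxes.
Context {R : realType} {n : nat}.
Implicit Types (a b c x : 'rV[R]_n).

Definition cbox a b : set 'rV[R]_n := [set x | forall i, a 0 i <= x 0 i <= b 0 i].
Definition obox a b : set 'rV[R]_n := [set x | forall i, a 0 i < x 0 i < b 0 i].

Lemma obox_cbox a b : obox a b `<=` cbox a b.
Proof. by move=> x h i; have /andP[/ltW-> /ltW->] := h i. Qed.

Lemma measurable_cbox a b : measurable (cbox a b).
Proof. exact: measurable_box. Qed.

Lemma ball_rVE x (e : R) y : ball x e y <-> `|x - y| < e.
Proof. by rewrite -ball_normE. Qed.

Lemma bounded_cbox a b : bounded_set (cbox a b).
Proof.
exists (`|a| + `|b|); split; first exact: num_real.
move=> M hM y yab; apply: norm_leP.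
  by apply: ltW; apply: le_lt_trans hM; rewrite addr_ge0.
move=> i; have /andP[h1 h2] := yab i.
have := ler_coord_norm a i; have := ler_coord_norm b i; rewrite !ler_norml.
move=> /andP[_ h3] /andP[h4 _].
apply/andP; split; have := normr_ge0 a; have := normr_ge0 b; lra.
Qed.

Lemma closed_cbox a b : closed (cbox a b).
Proof.
rewrite (_ : cbox a b = \bigcap_(i in setT)
   ((fun y : 'rV[R]_n => y 0 i) @^-1` `[a 0 i, b 0 i])).
  apply: closed_bigI => i _; apply: closed_comp; last exact: interval_closed.
  by move=> y _; exact: coord_continuous.
apply/seteqP; split => y /=.
  by move=> h i _; rewrite /= in_itv/=; exact: h.
by move=> h i; have := h i I; rewrite /= in_itv.
Qed.

Lemma compact_cbox a b : compact (cbox a b).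
Proof. by apply: bounded_closed_compact; [exact: bounded_cbox|exact: closed_cbox]. Qed.

Lemma open_obox a b : open (obox a b).
Proof.
rewrite openE => y yab; apply/nbhs_ballP.
have /choice[e eP] : forall i, exists e : R, 0 < e /\ a 0 i < y 0 i - e /\ y 0 i + e < b 0 i.
  move=> i; have /andP[h1 h2] := yab i.
  exists (Num.min ((y 0 i - a 0 i) / 2) ((b 0 i - y 0 i) / 2)).
  split; first by rewrite lt_min !divr_gt0 ?subr_gt0.
  split.
    have : Num.min ((y 0 i - a 0 i) / 2) ((b 0 i - y 0 i) / 2) <= (y 0 i - a 0 i) / 2 by rewrite ge_min lexx.
    by lra.
  have : Num.min ((y 0 i - a 0 i) / 2) ((b 0 i - y 0 i) / 2) <= (b 0 i - y 0 i) / 2 by rewrite ge_min lexx orbT.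
  by lra.
exists (\big[Num.min/1]_i e i) => /=.
  apply: lt_bigmin => // i _; by have [] := eP i.
move=> z /ball_rVE yz i.
have h : `|y 0 i - z 0 i| < e i.
  rewrite (_ : y 0 i - z 0 i = (y - z) 0 i); last by rewrite !mxE.
  apply: le_lt_trans (ler_coord_norm _ _) _; apply: lt_le_trans yz _.
  exact: bigmin_le.
have [e0 [h1 h2]] := eP i.
by move: h; rewrite ltr_norml => /andP[h3 h4]; apply/andP; split; lra.
Qed.

(** Rational corners make the family countable, so that an open set is a countable union of such
    boxes. The parameter [F] serves open and closed boxes alike. *)
Definition ratbox (F : 'rV[R]_n -> 'rV[R]_n -> set 'rV[R]_n)
    (q : {ffun 'I_n -> rat} * {ffun 'I_n -> rat}) :=
  F (\row_i ratr (q.1 i)) (\row_i ratr (q.2 i)).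

Lemma open_ratbox (U : set 'rV[R]_n) x : open U -> U x ->
  exists2 q, ratbox obox q x & ratbox cbox q `<=` U.
Proof.
move=> oU Ux; have /nbhs_ballP[e /= e0 eU] : nbhs x U by exact: open_nbhs_nbhs.
have /choice[q qP] : forall i, exists q : rat, x 0 i - e < ratr q < x 0 i.
  by move=> i; have [q] := @rat_in_itvoo R _ _ (ltac:(lra) : x 0 i - e < x 0 i); rewrite in_itv/=; exists q.
have /choice[q' q'P] : forall i, exists q : rat, x 0 i < ratr q < x 0 i + e.
  by move=> i; have [q'] := @rat_in_itvoo R _ _ (ltac:(lra) : x 0 i < x 0 i + e); rewrite in_itv/=; exists q'.
exists ([ffun i => q i], [ffun i => q' i]).
  move=> i; rewrite !mxE !ffunE /=.
  by have /andP[h3 h4] := qP i; have /andP[h5 h6] := q'P i; rewrite h4 h5.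
move=> y yq; apply: eU; apply/ball_rVE.
rewrite -normrN opprB; apply: (@le_lt_trans _ _ (\big[Num.max/0]_i `|(y - x) 0 i|)).
  by apply: norm_leP => [|i]; [exact: bigmax_ge_id|exact: le_bigmax].
apply/bigmax_ltP; split => // i _; rewrite !mxE.
have := yq i; rewrite !mxE !ffunE /= => /andP[h1 h2].
have /andP[h3 h4] := qP i; have /andP[h5 h6] := q'P i.
by rewrite ltr_norml; apply/andP; split; lra.
Qed.

Lemma open_bigcup_box (F : 'rV[R]_n -> 'rV[R]_n -> set 'rV[R]_n) (U : set 'rV[R]_n) :
  (forall a b, obox a b `<=` F a b) -> (forall a b, F a b `<=` cbox a b) ->
  open U -> U = \bigcup_(q in [set q | ratbox F q `<=` U]) ratbox F q.
Proof.
move=> F1 F2 oU; apply/seteqP; split; last by apply: bigcup_sub.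
move=> x Ux; have [q qx qU] := open_ratbox oU Ux.
by exists q; [move=> y /F2 /qU|exact: F1].
Qed.

Lemma measurable_ratbox_bigcup d (T : measurableType d)
    (F : {ffun 'I_n -> rat} * {ffun 'I_n -> rat} -> set T) D :
  (forall q, measurable (F q)) -> measurable (\bigcup_(q in D) F q).
Proof.
move=> mF; rewrite bigcup_mkcond; apply: countable_bigcupT_measurable.
  exact: countableP.
by move=> q; case: ifP.
Qed.

Lemma measurable_open_rV (U : set 'rV[R]_n) : open U -> measurable U.
Proof.
move=> oU; rewrite (open_bigcup_box obox_cbox _ oU)//; last by move=> a b.
by apply: measurable_ratbox_bigcup => q; exact: measurable_cbox.
Qed.

Lemma measurable_closed_rV (U : set 'rV[R]_n) : closed U -> measurable U.
Proof.
by move=> cU; have /measurable_open_rV/measurableC := closed_openC cU; rewrite setCK.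
Qed.

(** Used with closed boxes to identify measures by their values, and with open boxes in the Dynkin
    argument of the fundamental lemma. Coordinates are measurable for the generated sigma-algebra
    because preimages of open intervals are open, hence countable unions of rational boxes. *)
Lemma measurable_rV_generated (F : 'rV[R]_n -> 'rV[R]_n -> set 'rV[R]_n) :
  (forall a b, obox a b `<=` F a b) -> (forall a b, F a b `<=` cbox a b) ->
  (forall a b, measurable (F a b)) ->
  (@measurable _ 'rV[R]_n) = <<s [set A | exists a b, A = F a b] >>.
Proof.
move=> F1 F2 mF; apply/seteqP; split; last first.
  apply: smallest_sub; first exact: sigma_algebra_measurable.
  by move=> _ [a [b ->]].
set G := [set A | _].
have oG (U : set 'rV[R]_n) : open U -> <<s G >> U.
  move=> /(@open_bigcup_box F)-> //.
  apply: (@measurable_ratbox_bigcup _ (g_sigma_algebraType G)) => q.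
  by apply: sub_sigma_algebra; eexists; eexists.
apply: smallest_sub; first exact: smallest_sigma_algebra.
rewrite -bigcup_seq; apply: bigcup_sub => i _ _ [B mB <-].
rewrite setTI.
suff : measurable_fun [set: g_sigma_algebraType G] (fun x : 'rV[R]_n => x 0 i).
  by move=> /(_ measurableT _ mB); rewrite setTI.
apply: (measurability _ (RGenOpens.measurableE R)) => _ [_ [c [d ->] <-]].
rewrite setTI; apply: oG; apply: open_comp; last exact: interval_open.
by move=> y _; exact: coord_continuous.
Qed.

Lemma continuous_measurable_rV (f : 'rV[R]_n -> R) : continuous f -> measurable_fun setT f.
Proof.
move=> cf; apply: (measurability _ (RGenOpens.measurableE R)) => _ [_ [c [d ->] <-]].
rewrite setTI; apply: measurable_open_rV; apply: open_comp; last exact: interval_open.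
by move=> y _; exact: cf.
Qed.

End boxes.

(** * Lebesgue measure under homotheties and translations *)

Section lebesgue_affine.
Context {R : realType} {n : nat}.
Local Notation mu := (lebesgue_measure_rV R n).
Implicit Types (a b c x : 'rV[R]_n).

Lemma lebesgue_measure_cbox a b : (forall i, a 0 i <= b 0 i) ->
  mu (cbox a b) = (\prod_(i < n) (b 0 i - a 0 i))%:E.
Proof. by move=> ab; exact: (@lebesgue_measure_rV_box R n (fun i => a 0 i) (fun i => b 0 i)). Qed.

Lemma lebesgue_measure_cbox_lty a b : (mu (cbox a b) < +oo)%E.
Proof.
have [ab|/existsNP[i /negP]] := pselect (forall i, a 0 i <= b 0 i).
  by rewrite lebesgue_measure_cbox// ltry.
rewrite -ltNge => ba.
rewrite (_ : cbox a b = set0) ?measure0// -subset0 => x /(_ i) /andP[h1 h2].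
by move: (le_trans h1 h2); rewrite leNgt ba.
Qed.

Lemma bounded_cbox_sub (A : set 'rV[R]_n) : bounded_set A ->
  exists2 M : R, 0 < M & A `<=` cbox (const_mx (- M)) (const_mx M).
Proof.
move=> [M [_ AM]]; exists (`|M| + 1); first by rewrite ltr_wpDl.
move=> x Ax i; rewrite !mxE -ler_norml; apply: le_trans (ler_coord_norm _ _) _.
by apply: AM => //; rewrite (le_lt_trans (ler_norm _))// ltrDl.
Qed.

Lemma bounded_measure_lty (A : set 'rV[R]_n) : measurable A -> bounded_set A ->
  (mu A < +oo)%E.
Proof.
move=> mA /bounded_cbox_sub[M M0 AM].
apply: le_lt_trans (lebesgue_measure_cbox_lty (const_mx (- M)) (const_mx M)).
by apply: le_measure => //; rewrite inE//; exact: measurable_cbox.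
Qed.

Lemma open_measure_gt0 (U : set 'rV[R]_n) : open U -> U !=set0 -> (0 < mu U)%E.
Proof.
move=> oU [x Ux].
have /nbhs_ballP[e /= e0 eU] : nbhs x U by exact: open_nbhs_nbhs.
have sU : cbox (x - const_mx (e / 2)) (x + const_mx (e / 2)) `<=` U.
  move=> y xy; apply: eU; apply/ball_rVE; apply: (@le_lt_trans _ _ (e / 2)); last by lra.
  apply: norm_leP => [|i]; first by lra.
  by have := xy i; rewrite !mxE ler_norml => /andP[h1 h2]; apply/andP; split; lra.
apply: (@lt_le_trans _ _ (mu (cbox (x - const_mx (e / 2)) (x + const_mx (e / 2))))).
  rewrite lebesgue_measure_cbox; last by move=> i; rewrite !mxE; lra.
  by rewrite lte_fin prodr_gt0// => i _; rewrite !mxE; lra.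
by apply: le_measure => //; rewrite inE//; [exact: measurable_cbox|exact: measurable_open_rV].
Qed.

Lemma cboxI a b a' b' : cbox a b `&` cbox a' b' =
  cbox (\row_i Num.max (a 0 i) (a' 0 i)) (\row_i Num.min (b 0 i) (b' 0 i)).
Proof.
apply/seteqP; split => x /=.
  move=> [h h'] i; have /andP[h1 h2] := h i; have /andP[h3 h4] := h' i.
  by rewrite !mxE ge_max le_min h1 h2 h3 h4.
move=> h; split => i; have := h i; rewrite !mxE ge_max le_min => /andP[/andP[h1 h2] /andP[h3 h4]].
  by rewrite h1 h3.
by rewrite h2 h4.
Qed.

Lemma oboxI a b a' b' : obox a b `&` obox a' b' =
  obox (\row_i Num.max (a 0 i) (a' 0 i)) (\row_i Num.min (b 0 i) (b' 0 i)).
Proof.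
apply/seteqP; split => x /=.
  move=> [h h'] i; have /andP[h1 h2] := h i; have /andP[h3 h4] := h' i.
  by rewrite !mxE gt_max lt_min h1 h2 h3 h4.
move=> h; split => i; have := h i; rewrite !mxE gt_max lt_min => /andP[/andP[h1 h2] /andP[h3 h4]].
  by rewrite h1 h3.
by rewrite h2 h4.
Qed.

Definition affine c (t : R) x := c + t *: x.

Lemma continuous_affine c t : continuous (affine c t).
Proof. move=> x; apply: (@cvgD _ _ _ (nbhs x)); first exact: cvg_cst.
by apply: (@cvgZr _ _ _ (nbhs x)). Qed.

Lemma measurable_affine c t : measurable_fun setT (affine c t).
Proof.
apply: measurable_fun_rV => i; apply: continuous_measurable_rV => x.
apply: (@continuous_comp 'rV[R]_n 'rV[R]_n R (affine c t) (fun y => y 0 i)).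
  exact: continuous_affine.
exact: coord_continuous.
Qed.

(** Both sides are measures in [A], so closed boxes suffice: they are stable by intersection,
    generate the sigma-algebra, and the cubes [[-k, k]^n] exhaust the space with finite measure. *)
Lemma lebesgue_measure_affine c t (A : set 'rV[R]_n) : 0 < t -> measurable A ->
  (mu A = (t ^+ n)%:E * mu (affine c t @^-1` A))%E.
Proof.
move=> t0 mA.
have tn : 0 <= t ^+ n by rewrite exprn_ge0// ltW.
pose m3' : {measure set 'rV[R]_n -> \bar R} := mscale (NngNum tn) (pushforward mu (affine c t)).
pose m3 := m3' (measurable_affine c t).
have K a b : mu (cbox a b) = m3 (cbox a b).
  rewrite /m3/m3'/= /mscale/= /pushforward.
  rewrite (_ : affine c t @^-1` cbox a b = cbox (t^-1 *: (a - c)) (t^-1 *: (b - c))); last first.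
    apply/seteqP; split => x /= h i; have := h i; rewrite !mxE.
      by rewrite ler_pdivrMl// ler_pdivlMl//; move=> /andP[h1 h2]; apply/andP; split; lra.
    by rewrite ler_pdivrMl// ler_pdivlMl//; move=> /andP[h1 h2]; apply/andP; split; lra.
  have [ab|/existsNP[i /negP]] := pselect (forall i, a 0 i <= b 0 i).
    rewrite !lebesgue_measure_cbox//; last first.
      by move=> i; rewrite !mxE ler_pM2l ?invr_gt0// lerD2r.
    rewrite -EFinM; congr EFin.
    rewrite -[in t ^+ n](card_ord n) -prodr_const -big_split/=.
    by apply: eq_bigr => i _; rewrite !mxE -mulrBr mulrA divff ?gt_eqF// mul1r; ring.
  rewrite -ltNge => ba.
  rewrite (_ : cbox a b = set0); last first.
    rewrite -subset0 => x /(_ i) /andP[h1 h2].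
    by move: (le_trans h1 h2); rewrite leNgt ba.
  rewrite (_ : cbox _ _ = set0) ?measure0 ?mule0// -subset0 => x /(_ i) /andP[h1 h2].
  move: (le_trans h1 h2); rewrite !mxE ler_pM2l ?invr_gt0//; lra.
rewrite -[RHS]/(m3 A).
apply: (@measure_unique _ _ _ [set A | exists a b, A = cbox a b]
   (fun k => cbox (const_mx (- k%:R)) (const_mx k%:R))) => //.
- apply: measurable_rV_generated => [a b|a b|a b]; [exact: obox_cbox|by []|exact: measurable_cbox].
- by move=> _ _ [a [b ->]] [a' [b' ->]]; rewrite cboxI; eexists; eexists.
- by move=> k; eexists; eexists.
- rewrite -subTset => x _.
  exists (Num.truncn `|x|).+1 => // i; rewrite !mxE -ler_norml.
  by apply: le_trans (ler_coord_norm _ _) _; apply/ltW/Num.Theory.truncnS_gt.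
- by move=> _ [a [b ->]]; exact: K.
- by move=> k; exact: lebesgue_measure_cbox_lty.
Qed.

Lemma ge0_integral_affine c t (D : set 'rV[R]_n) (f : 'rV[R]_n -> \bar R) : 0 < t ->
  measurable D -> measurable_fun D f -> (forall x, D x -> 0 <= f x)%E ->
  (\int[mu]_(x in D) f x = (t ^+ n)%:E * \int[mu]_(x in affine c t @^-1` D) f (affine c t x))%E.
Proof.
move=> t0 mD mf f0.
have tn : 0 <= t ^+ n by rewrite exprn_ge0// ltW.
pose m3' : {measure set 'rV[R]_n -> \bar R} := mscale (NngNum tn) (pushforward mu (affine c t)).
pose m3 := m3' (measurable_affine c t).
rewrite (eq_measure_integral m3); last first.
  by move=> A mA AD; exact: (@lebesgue_measure_affine c t).
rewrite /m3/m3' ge0_integral_mscale// ge0_integral_pushforward.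
- by []. 
- exact: measurable_affine.
- by []. 
- by []. 
- by move=> x /set_mem; exact: f0.
Qed.

End lebesgue_affine.

(** * Smooth functions and test functions *)

Section partial_derivatives.
Context {R : realType} {n : nat}.
Implicit Types (f g : 'rV[R]_n -> R) (x v : 'rV[R]_n).

Definition gradient f x : 'rV[R]_n := \row_i partial i f x.

Lemma partialD i f g : (forall x, differentiable f x) -> (forall x, differentiable g x) ->
  partial i (f \+ g) = partial i f \+ partial i g.
Proof. by move=> df dg; apply/funext => x; rewrite /partial deriveD//; exact: diff_derivable. Qed.

Lemma partialM i f g : (forall x, differentiable f x) -> (forall x, differentiable g x) ->
  partial i (f \* g) = (f \* partial i g) \+ (g \* partial i f).
Proof. by move=> df dg; apply/funext => x; rewrite /partial deriveM//; exact: diff_derivable. Qed.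

Lemma partial_cst i (c : R) : partial i (fun _ : 'rV[R]_n => c) = fun=> 0.
Proof. by apply/funext => x; rewrite /partial derive_cst. Qed.

Lemma partial_coord i j : partial i (fun x : 'rV[R]_n => x 0 j) = fun=> (i == j)%:R.
Proof.
apply/funext => x; rewrite /partial deriveE; last exact: differentiable_coord.
have lc : linear (fun y : 'rV[R]_n => y 0 j : R) by move=> a u v; rewrite !mxE.
pose lcM := GRing.isLinear.Build _ _ _ _ _ lc.
pose c : {linear 'rV[R]_n -> R} := HB.pack (fun y : 'rV[R]_n => y 0 j : R) lcM.
rewrite -[fun x => _]/(c : 'rV[R]_n -> R) diff_lin/=; last exact: coord_continuous.
by rewrite /= mxE eqxx/= eq_sym.
Qed.

Lemma derive_gradient f x v : differentiable f x ->
  'D_v f x = \sum_i v 0 i * gradient f x 0 i.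
Proof.
move=> df; rewrite deriveE// [in LHS](row_sum_delta v) linear_sum.
by apply: eq_bigr => i _; rewrite linearZ/= mxE /partial deriveE.
Qed.

Lemma differentiable_comp1 (psi : R -> R) (dpsi : R) f x :
  differentiable f x -> is_derive (f x) 1 psi dpsi ->
  differentiable (psi \o f) x /\ forall i, partial i (psi \o f) x = dpsi * partial i f x.
Proof.
move=> df dp; have dp' : differentiable psi (f x).
  by apply/derivable1_diffP; exact: (@ex_derive _ _ _ _ _ _ _ dp).
have dc : differentiable (psi \o f) x by exact: differentiable_comp.
split => // i; rewrite /partial !deriveE// diff_comp//= diff1E//=.
by rewrite derive1E (@derive_val _ _ _ _ _ _ _ dp) mulrC.
Qed.

Lemma mean_value_rV f x v : (forall y, differentiable f y) ->
  exists2 t, 0 <= t <= 1 & f (x + v) - f x = \sum_i v 0 i * gradient f (x + t *: v) 0 i.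
Proof.
move=> df; pose h (t : R) := f (x + t *: v).
have dh (t : R) : is_derive t 1 h (\sum_i v 0 i * gradient f (x + t *: v) 0 i).
  have dl : is_diff t (fun s : R => x + s *: v) (fun s : R => s *: v).
    have := @is_diffD R R 'rV[R]_n (cst x) (fun s => s *: v) 0 (fun s => s *: v) t.
    by rewrite add0r; apply.
  have dlt : differentiable (fun s : R => x + s *: v) t by [].
  have dht : differentiable h t by exact: differentiable_comp.
  apply: DeriveDef; first exact/derivable1_diffP.
  rewrite deriveE// /h.
  rewrite (_ : (fun t0 : R => f (x + t0 *: v)) = f \o (fun s : R => x + s *: v))//.
  by rewrite diff_comp//= diff_val scale1r -deriveE// derive_gradient.
have [|t t01] := @MVT_segment R h (fun t => \sum_i v 0 i * gradient f (x + t *: v) 0 i) 0 1 ler01 (fun t _ => dh t).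
  apply: continuous_subspaceT => t; apply: differentiable_continuous.
  by apply/derivable1_diffP; exact: (@ex_derive _ _ _ _ _ _ _ (dh t)).
rewrite /h scale1r scale0r addr0 subr0 mulr1 => ->; by exists t.
Qed.

Lemma lipschitz_gradient_bound f (M : R) x y : (forall z, differentiable f z) ->
  (forall z, enorm (gradient f z) <= M) -> `|f y - f x| <= M * enorm (y - x).
Proof.
move=> df fM; have [t _] := mean_value_rV x (y - x) df.
rewrite [x + (y - x)]addrC subrK => ->; apply: le_trans (cauchy_schwarz_enorm _ _) _.
by rewrite mulrC ler_wpM2r ?enorm_ge0.
Qed.

End partial_derivatives.

Section smooth_functions.
Context {R : realType} {n : nat}.
Implicit Types (f g : 'rV[R]_n -> R) (x v : 'rV[R]_n).

(* Closed under partial derivatives, so that all its members are smooth. *)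
Inductive smooth_expr : ('rV[R]_n -> R) -> Prop :=
| SmoothBase f of smooth f : smooth_expr f
| SmoothCst (c : R) : smooth_expr (fun=> c)
| SmoothCoord i : smooth_expr (fun x => x 0 i)
| SmoothAdd f g of smooth_expr f & smooth_expr g : smooth_expr (f \+ g)
| SmoothMul f g of smooth_expr f & smooth_expr g : smooth_expr (f \* g)
| SmoothComp (I : set R) (D : nat -> R -> R) k f of smooth_expr f &
   (forall x, I (f x)) & (forall k t, I t -> is_derive t 1 (D k) (D k.+1 t)) :
   smooth_expr (D k \o f).

Lemma smooth_partial i f : smooth f -> smooth (partial i f).
Proof. by move=> sf l x; rewrite -(foldr_rcons (@partial R n)); exact: sf. Qed.

Lemma smooth_differentiable f x : smooth f -> differentiable f x.
Proof. by move=> /(_ [::]); exact. Qed.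

Lemma smooth_expr_step f : smooth_expr f ->
  (forall x, differentiable f x) /\ (forall i, smooth_expr (partial i f)).
Proof.
elim => {f} [f sf|c|j|f g sf [df pf] sg [dg pg]|f g sf [df pf] sg [dg pg]|I D k f sf [df pf] If dD].
- by split => [x|i]; [exact: smooth_differentiable|apply/SmoothBase/smooth_partial].
- by split => [x|i]; [exact: differentiable_cst|rewrite partial_cst; exact: SmoothCst].
- by split => [x|i]; [exact: differentiable_coord|rewrite partial_coord; exact: SmoothCst].
- split => [x|i]; first exact: differentiableD.
  by rewrite partialD//; apply: SmoothAdd.
- split => [x|i]; first exact: differentiableM.
  by rewrite partialM//; apply: SmoothAdd; apply: SmoothMul.
- split => [x|i]; first by have [] := differentiable_comp1 (df x) (dD k _ (If x)).
  rewrite (_ : partial i _ = (D k.+1 \o f) \* partial i f); last first.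
    by apply/funext => x /=; have [_ ->] := differentiable_comp1 (df x) (dD k _ (If x)).
  by apply: SmoothMul => //; exact: SmoothComp dD.
Qed.

Lemma smooth_exprP f : smooth_expr f -> smooth f.
Proof.
move=> sf l x; suff /smooth_expr_step[] : smooth_expr (foldr (@partial R n) f l) by [].
by elim: l => //= i l /smooth_expr_step[_]; exact.
Qed.

Lemma smooth_cst (c : R) : smooth (fun _ : 'rV[R]_n => c).
Proof. exact/smooth_exprP/SmoothCst. Qed.

Lemma smooth_coord i : smooth (fun x : 'rV[R]_n => x 0 i).
Proof. exact/smooth_exprP/SmoothCoord. Qed.

Lemma smoothD f g : smooth f -> smooth g -> smooth (f \+ g).
Proof. by move=> sf sg; apply/smooth_exprP/SmoothAdd; exact: SmoothBase. Qed.

Lemma smoothM f g : smooth f -> smooth g -> smooth (f \* g).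
Proof. by move=> sf sg; apply/smooth_exprP/SmoothMul; exact: SmoothBase. Qed.

Lemma smoothZ (c : R) f : smooth f -> smooth (fun x => c * f x).
Proof. by move=> sf; apply: (smoothM (smooth_cst c) sf). Qed.

Lemma smooth_sum (s : seq 'I_n) (F : 'I_n -> 'rV[R]_n -> R) :
  (forall i, smooth (F i)) -> smooth (fun x => \sum_(i <- s) F i x).
Proof.
move=> sF; elim: s => [|i s IH].
  by under eq_fun do rewrite big_nil; exact: smooth_cst.
by under eq_fun do rewrite big_cons; exact: smoothD.
Qed.

Lemma smooth_prod (s : seq 'I_n) (F : 'I_n -> 'rV[R]_n -> R) :
  (forall i, smooth (F i)) -> smooth (fun x => \prod_(i <- s) F i x).
Proof.
move=> sF; elim: s => [|i s IH].
  by under eq_fun do rewrite big_nil; exact: smooth_cst.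
by under eq_fun do rewrite big_cons; exact: smoothM.
Qed.

(** [D] lists all the derivatives of the outer function on [I]: the partial derivatives of
    [D k \o f] are those of [f] multiplied by [D k.+1 \o f], which is what closes the induction on
    [smooth_expr]. *)
Lemma smooth_comp (I : set R) (D : nat -> R -> R) f : smooth f ->
  (forall x, I (f x)) -> (forall k t, I t -> is_derive t 1 (D k) (D k.+1 t)) ->
  smooth (D 0%N \o f).
Proof.
by move=> sf If dD; apply: smooth_exprP; apply: (SmoothComp 0 _ If dD); exact: SmoothBase.
Qed.

Lemma smooth_continuous f : smooth f -> continuous f.
Proof. by move=> sf x; exact/differentiable_continuous/smooth_differentiable. Qed.

End smooth_functions.

(** * Smooth functions on the line that are flat at the origin *)

Section flat_functions.
Context {R : realType}.
Implicit Types (P : {poly R}) (d t : R).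

(* The functions [t P(1/t) e^(-d/t)], extended by [0] to [t <= 0], are stable under
   derivation; [flat d 1] is a smooth regularization of the positive part. *)
Definition flat d P t : R := if 0 < t then t * P.[t^-1] * expR (- (d / t)) else 0.

(** With [y = 1/t], the derivative of [t P(y) e^(-d y)] is [(P(y) - y P'(y) + d y P(y)) e^(-d y)].
    The outer factor ['X] restores the form [t Q(y) e^(-d y)]. *)
Definition flat_next d P : {poly R} := 'X * (P - 'X * P^`() + d *: ('X * P)).

Lemma flat_le0 d P t : t <= 0 -> flat d P t = 0.
Proof. by rewrite /flat leNgt => /negbTE->. Qed.

(** The exponential beats every power of [1/t] near [0]; a quadratic bound is what makes the
    derivative at [0] exist and vanish. *)
Lemma flat_quadratic_bound d P : 0 < d ->
  exists2 C : R, 0 <= C & forall t, `|t| <= 1 -> `|flat d P t| <= C * t ^+ 2.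
Proof.
move=> d0; pose S := \sum_(i < size P) `|P`_i|.
have S0 : 0 <= S by exact: sumr_ge0.
(* With [e^(-x) <= k! / x^k], the powers of [t] are [t * t^(- size P) * t^k], so this [k] leaves
   exactly [t^2]. *)
pose k := (size P).+1.
exists (S * (k`!%:R / d ^+ k)).
  by rewrite mulr_ge0// divr_ge0// exprn_ge0// ltW.
move=> t; rewrite ler_norml => /andP[_ t1]; rewrite /flat; case: ifPn => t0; last first.
  by rewrite normr0 mulr_ge0 ?sqr_ge0// mulr_ge0// divr_ge0// exprn_ge0// ltW.
have y1 : 1 <= t^-1 by rewrite invf_ge1.
have y0 : 0 <= t^-1 by rewrite invr_ge0 ltW.
have P1 : `|P.[t^-1]| <= S * t^-1 ^+ size P.
  rewrite horner_coef mulr_suml; apply: le_trans (ler_norm_sum _ _ _) _.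
  apply: ler_sum => i _; rewrite normrM ler_wpM2l// ger0_norm ?exprn_ge0//.
  by rewrite ler_weXn2l// ltnW.
have dt : 0 < d / t by exact: divr_gt0.
have E1 : expR (- (d / t)) <= k`!%:R / (d / t) ^+ k.
  rewrite expRN -[leRHS]invrK lef_pV2 ?posrE ?expR_gt0//; last first.
    by rewrite invr_gt0 divr_gt0// ?exprn_gt0// ltr0n fact_gt0.
  rewrite invf_div; apply: le_trans (expR_ge1Dxn (size P) (ltW dt)).
  by rewrite lerDr.
rewrite !normrM (ger0_norm (ltW t0)) (ger0_norm (expR_ge0 _)).
apply: (@le_trans _ _ (t * (S * t^-1 ^+ size P) * (k`!%:R / (d / t) ^+ k))).
  apply: ler_pM => //; first by rewrite mulr_ge0// ltW.
  by rewrite ler_pM2l.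
rewrite le_eqVlt; apply/orP; left; apply/eqP.
rewrite expr_div_n /k (exprS d) (exprS t (size P)) exprVn expr2.
have dk : d ^+ size P != 0 by rewrite expf_neq0// gt_eqF.
have tk : t ^+ size P != 0 by rewrite expf_neq0// gt_eqF.
by field; rewrite dk tk !gt_eqF ?ltr0n ?fact_gt0.
Qed.

Lemma is_derive_quadratic0 (f : R -> R) (C : R) : f 0 = 0 ->
  (forall t, `|t| <= 1 -> `|f t| <= C * t ^+ 2) -> is_derive (0 : R) 1 f 0.
Proof.
move=> f0 fC; have : h^-1 *: ((f \o shift 0) (h *: (1 : R)) - f 0) @[h --> 0^'] --> (0 : R).
  apply/cvgrPdist_le => e e0; near=> h.
  have h0 : h != 0 by near: h; exact: nbhs_dnbhs_neq.
  rewrite sub0r normrN /= f0 subr0 addr0 [h *: 1]mulr1 normrM normfV.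
  rewrite ler_pdivrMl ?normr_gt0//.
  have h1 : `|h| <= 1 by near: h; apply: dnbhs0_le.
  apply: le_trans (fC _ h1) _; rewrite -real_normK ?num_real// expr2 mulrCA ler_wpM2l//.
  have C1 : 0 < `|C| + 1 by rewrite ltr_wpDl.
  apply: (@le_trans _ _ ((`|C| + 1) * `|h|)).
    by rewrite ler_wpM2r// (le_trans (ler_norm _))// lerDl.
  rewrite -ler_pdivlMl//; near: h; apply: dnbhs0_le; by rewrite mulr_gt0 ?invr_gt0.
move=> H; apply: DeriveDef; first by apply/cvg_ex; exists 0.
exact/cvg_lim.
Unshelve. all: by end_near. Qed.

Lemma is_derive_flat d P t : 0 < d -> is_derive t 1 (flat d P) (flat d (flat_next d P) t).
Proof.
move=> d0; have [t0|t0|->] := ltgtP t 0.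
- rewrite flat_le0 ?ltW//; apply: (@near_eq_is_derive _ _ _ (cst 0)) => //.
    by near=> s; rewrite flat_le0//; apply: ltW; near: s; exact: lt_nbhsl.
- pose f s := s * P.[s^-1] * expR (- (d / s)).
  have dV : is_derive t 1 (fun s : R => s^-1) (- t ^- 2).
    apply: is_derive_eq; first by apply: is_deriveV; rewrite gt_eqF.
    by rewrite -[_ *: 1]/(_ * 1) mulr1.
  have dP : is_derive t 1 (fun s => P.[s^-1]) (- t ^- 2 * P^`().[t^-1]).
    have dp : is_derive (t^-1) 1 (horner P) P^`().[t^-1].
      by apply: DeriveDef; [exact: derivable_horner|rewrite derivE derive1E].
    by have := @is_derive1_comp R (horner P) (fun s => s^-1) t _ _ dp dV; rewrite mulrC.
  have dE : is_derive t 1 (fun s => expR (- (d / s))) (d * t ^- 2 * expR (- (d / t))).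
    have de : is_derive t 1 (fun s => - (d / s)) (d * t ^- 2).
      have := is_deriveN (is_deriveZ d dV); rewrite -[_ *: _]/(d * _).
      by rewrite mulrN opprK.
    have := @is_derive1_comp R expR (fun s => - (d / s)) t _ _ (is_derive_expR _) de.
    by rewrite mulrC.
  have df := is_deriveM (is_deriveM (is_derive_id t 1) dP) dE.
  apply: (@near_eq_is_derive R R R f) => //.
    by near=> s; rewrite /flat ifT//; near: s; exact: lt_nbhsr.
  apply: (@is_derive_eq _ R R f t 1 _ _ df).
  rewrite /flat t0 /flat_next !hornerE/= /GRing.scale/=.
rewrite -[(_ * _) t]/(t * P.[t^-1]).
  have t00 : t != 0 by rewrite gt_eqF.
  by field.
- have [C _ HC] := flat_quadratic_bound P d0.
  rewrite {2}/flat ltxx; apply: (@is_derive_quadratic0 _ C) => //.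
  by rewrite flat_le0.
Unshelve. all: by end_near. Qed.

Lemma flat_gt0 d P t : 0 < t -> flat d P t = t * P.[t^-1] * expR (- (d / t)).
Proof. by rewrite /flat => ->. Qed.

End flat_functions.

Section test_functions.
Context {R : realType} {n : nat} (Om : set 'rV[R]_n).
Implicit Types (f g phi psi : 'rV[R]_n -> R) (x v : 'rV[R]_n).

Lemma test_function_out phi x : test_function Om phi -> ~ Om x -> phi x = 0.
Proof. by move=> [_ [K [_ KO Kphi]]] Ox; apply: Kphi => /KO. Qed.

Lemma near_zero_partial phi (K : set 'rV[R]_n) i x : compact K ->
  (forall x, ~ K x -> phi x = 0) -> ~ K x -> partial i phi x = 0.
Proof.
move=> cK Kphi Kx; rewrite /partial -(derive_cst (0 : R) x (delta_mx 0 i)).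
apply: near_eq_derive.
have oK : open (~` K) by apply: closed_openC; apply: compact_closed => //; exact: norm_hausdorff.
by apply: filterS (open_nbhs_nbhs (conj oK Kx)) => y Ky; exact: Kphi.
Qed.

Lemma test_partial phi i : test_function Om phi -> test_function Om (partial i phi).
Proof.
move=> [sphi [K [cK KO Kphi]]]; split; first exact: smooth_partial.
by exists K; split => // x Kx; exact: (near_zero_partial _ cK).
Qed.

Lemma test_functionM f phi : smooth f -> test_function Om phi -> test_function Om (f \* phi).
Proof.
move=> sf [sphi [K [cK KO Kphi]]]; split; first exact: smoothM.
by exists K; split => // x Kx; rewrite /= Kphi// mulr0.
Qed.

Lemma test_functionZ (c : R) phi : test_function Om phi -> test_function Om (fun x => c * phi x).
Proof. exact: (test_functionM (smooth_cst c)). Qed.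

Lemma test_functionD phi psi : test_function Om phi -> test_function Om psi ->
  test_function Om (phi \+ psi).
Proof.
move=> [sphi [K [cK KO Kphi]]] [spsi [L [cL LO Lpsi]]]; split; first exact: smoothD.
exists (K `|` L); split; [exact: compactU|by rewrite subUset|].
by move=> x /not_orP[Kx Lx] /=; rewrite Kphi// Lpsi// addr0.
Qed.

Lemma test_function0 : test_function Om (fun=> 0).
Proof.
by split; [exact: smooth_cst|exists set0; split => //; exact: compact0].
Qed.

Lemma test_bounded phi : test_function Om phi -> exists M : R, forall x, `|phi x| <= M.
Proof.
move=> [sphi [K [cK KO Kphi]]].
have [M [_ HM]] : bounded_set (phi @` K).
  apply: compact_bounded; apply: continuous_compact => //.
  by apply: continuous_subspaceT; exact: smooth_continuous.
exists (`|M| + 1) => x; have [Kx|/Kphi->] := pselect (K x).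
  apply: HM; last by exists x.
  by rewrite (le_lt_trans (ler_norm _))// ltrDl.
by rewrite normr0 addr_ge0.
Qed.

Lemma test_gradient_bounded phi : test_function Om phi ->
  exists2 M : R, 0 <= M & forall x, enorm (gradient phi x) <= M.
Proof.
move=> tphi; have /choice[M HM] : forall i, exists M : R, forall x, `|partial i phi x| <= M.
  by move=> i; apply: test_bounded; exact: test_partial.
exists (n%:R * \big[Num.max/0]_i M i).
  by rewrite mulr_ge0//; exact: bigmax_ge_id.
move=> x; apply: ler_enorm_coord; last exact: bigmax_ge_id.
by move=> i; rewrite mxE; apply: le_trans (HM i x) _; exact: le_bigmax.
Qed.

Lemma test_differentiable phi x : test_function Om phi -> differentiable phi x.
Proof. by move=> [sphi _]; exact: smooth_differentiable. Qed.

Lemma test_continuous phi : test_function Om phi -> continuous phi.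
Proof. by move=> [sphi _]; exact: smooth_continuous. Qed.

Lemma test_lipschitz phi : test_function Om phi ->
  exists2 M : R, 0 <= M & forall x y, `|phi y - phi x| <= M * enorm (y - x).
Proof.
move=> tphi; have [M M0 HM] := test_gradient_bounded tphi; exists M => // x y.
by apply: lipschitz_gradient_bound => // z; exact: test_differentiable tphi.
Qed.

Lemma test_gradient_lipschitz phi : test_function Om phi ->
  exists2 M : R, 0 <= M &
    forall x y, enorm (gradient phi y - gradient phi x) <= M * enorm (y - x).
Proof.
move=> tphi; have /choice[M HM] : forall i, exists M : R,
    forall x y, `|partial i phi y - partial i phi x| <= M * enorm (y - x).
  by move=> i; have [M _ HM] := test_lipschitz (test_partial i tphi); exists M.
exists (n%:R * \big[Num.max/0]_i M i).
  by rewrite mulr_ge0//; exact: bigmax_ge_id.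
move=> x y; rewrite -mulrA; apply: ler_enorm_coord; last first.
  by rewrite mulr_ge0 ?enorm_ge0//; exact: bigmax_ge_id.
move=> i; rewrite !mxE; apply: le_trans (HM i x y) _.
by rewrite ler_wpM2r ?enorm_ge0//; exact: le_bigmax.
Qed.

End test_functions.

(** * Bump functions on boxes *)

Section bumps.
Context {R : realType} {n : nat}.
Implicit Types (a b x y : 'rV[R]_n) (P : {poly R}).

Lemma smooth_flat (d : R) P (f : 'rV[R]_n -> R) : 0 < d -> smooth f ->
  smooth (fun x => flat d P (f x)).
Proof.
move=> d0 sf; apply: (@smooth_comp _ _ setT (fun k => flat d (iter k (flat_next d) P))) => // k t _.
exact: is_derive_flat.
Qed.

(** The polynomial ['X] cancels the leading factor [t], leaving [e^(-1 / ((k+1) t))] for [t > 0]: a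
    smooth function with values in [[0, 1]] that tends to the indicator of [t > 0]. *)
Definition soft_step (k : nat) (t : R) := flat (k.+1%:R^-1) 'X t.

Lemma soft_step_gt0 k t : 0 < t -> soft_step k t = expR (- (k.+1%:R^-1 / t)).
Proof. by move=> t0; rewrite /soft_step flat_gt0// hornerX divff ?mul1r// gt_eqF. Qed.

Lemma soft_step01 k t : 0 <= soft_step k t <= 1.
Proof.
have [t0|t0] := ltP 0 t; last by rewrite /soft_step flat_le0// lexx ler01.
by rewrite soft_step_gt0// expR_ge0 expR_le1 oppr_le0 divr_ge0// ltW.
Qed.

Lemma soft_step_cvg (t : R) : soft_step k t @[k --> \oo] --> ((0 < t)%R%:R : R).
Proof.
have [t0|t0] := ltP 0 t; last first.
  by rewrite /soft_step; under eq_fun do rewrite flat_le0//; exact: cvg_cst.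
under eq_fun do rewrite soft_step_gt0//.
have -> : true%:R = expR (- (0 / t)) :> R by rewrite mul0r oppr0 expR0.
apply: continuous_cvg; first exact: continuous_expR.
by apply: cvgN; apply: cvgM; [exact: cvg_harmonic|exact: cvg_cst].
Qed.

(** A smooth substitute for the indicator of an open box. Integrals against these test functions
    recover integrals over the box as [k] grows. *)
Definition box_bump a b (k : nat) x : R :=
  \prod_i (soft_step k (x 0 i - a 0 i) * soft_step k (b 0 i - x 0 i)).

Lemma smooth_box_bump a b k : smooth (box_bump a b k).
Proof.
apply: smooth_prod => i.
apply: (@smoothM _ _ (fun x => soft_step k (x 0 i - a 0 i)) (fun x => soft_step k (b 0 i - x 0 i))).
  apply: smooth_flat => //; rewrite ?invr_gt0//.
  exact: (smoothD (smooth_coord i) (smooth_cst (- a 0 i))).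
apply: smooth_flat => //; rewrite ?invr_gt0//.
apply: (smoothD (smooth_cst (b 0 i))).
by under eq_fun do rewrite -mulN1r; exact/smoothZ/smooth_coord.
Qed.

Lemma box_bump01 a b k x : 0 <= box_bump a b k x <= 1.
Proof.
rewrite prodr_ge0/=; last first.
  move=> i _; have /andP[h1 _] := soft_step01 k (x 0 i - a 0 i).
  by have /andP[h2 _] := soft_step01 k (b 0 i - x 0 i); rewrite mulr_ge0.
apply: prodr_ile1 => i _; have /andP[h1 h1'] := soft_step01 k (x 0 i - a 0 i).
by have /andP[h2 h2'] := soft_step01 k (b 0 i - x 0 i); rewrite mulr_ge0//= mulr_ile1.
Qed.

Lemma box_bump_out a b k x : ~ obox a b x -> box_bump a b k x = 0.
Proof.
move=> /existsNP[i /negP]; rewrite negb_and -!leNgt => h.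
rewrite /box_bump (bigD1 i)//= /soft_step; case/orP: h => h.
  by rewrite flat_le0 ?subr_le0// !mul0r.
by rewrite (@flat_le0 _ _ _ (b 0 i - _)) ?subr_le0// mulr0 mul0r.
Qed.

Lemma box_bump_cvg a b x :
  box_bump a b k x @[k --> \oo] --> (\1_(obox a b) x : R).
Proof.
have [xab|xab] := pselect (obox a b x); last first.
  under eq_fun do rewrite box_bump_out//.
  by rewrite indicE memNset//; exact: cvg_cst.
rewrite indicE mem_set// /box_bump.
rewrite (_ : (true%:R : R) = \prod_(i < n) (1 : R)); last by rewrite big1.
apply: cvg_big => [|i _]; first exact: mul_continuous.
have /andP[h1 h2] := xab i.
rewrite -[X in _ --> X]mulr1; apply: cvgM.
  by have := @soft_step_cvg (x 0 i - a 0 i); rewrite subr_gt0 h1.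
by have := @soft_step_cvg (b 0 i - x 0 i); rewrite subr_gt0 h2.
Qed.

Lemma box_bump_test (Om : set 'rV[R]_n) a b k : cbox a b `<=` Om ->
  test_function Om (box_bump a b k).
Proof.
move=> abO; split; first exact: smooth_box_bump.
exists (cbox a b); split => //; first exact: compact_cbox.
by move=> x xab; apply: box_bump_out => /obox_cbox.
Qed.

End bumps.

(** * A smoothed cone over a ball *)

Section cone.
Context {R : realType} {n : nat}.
Implicit Types x : 'rV[R]_n.
Variables (x0 : 'rV[R]_n) (r e d : R).
Hypotheses (e0 : 0 < e) (er : e < r) (d0 : 0 < d).

(** The regularized distance [sqrt (e^2 + |x - x0|^2)], written as a real power because derivatives
    of all orders of a power are again multiples of powers. *)
Definition dist_reg x : R := (e ^+ 2 + \sum_i (x 0 i - x0 0 i) ^+ 2) `^ 2^-1.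

(* Regularizes [(r - |x - x0|)^+], keeping a gradient of norm at most [1] and the
   support in the ball of radius [r]. *)
Definition cone x : R := flat d 1 (r - dist_reg x).

Let sq_gt0 (x : 'rV[R]_n) : 0 < e ^+ 2 + \sum_i (x 0 i - x0 0 i) ^+ 2.
Proof. by rewrite ltr_wpDr// ?exprn_gt0// sumr_ge0// => i _; exact: sqr_ge0. Qed.

Let smooth_sq : smooth (fun x : 'rV[R]_n => e ^+ 2 + \sum_i (x 0 i - x0 0 i) ^+ 2).
Proof.
apply: (smoothD (smooth_cst _)); apply: smooth_sum => i.
have s1 := smoothD (smooth_coord i) (smooth_cst (n := n) (- x0 0 i)).
by under eq_fun do rewrite expr2; exact: (smoothM s1 s1).
Qed.

(** The [k]-th derivative of the square root on [t > 0], in the form expected by [smooth_comp]. *)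
Let D (k : nat) (t : R) : R := (\prod_(j < k) (2^-1 - j%:R)) * t `^ (2^-1 - k%:R).

Let dD k (t : R) : 0 < t -> is_derive t 1 (D k) (D k.+1 t).
Proof.
move=> t0; have H := is_deriveZ (\prod_(j < k) (2^-1 - j%:R)) (is_derive1_powR (2^-1 - k%:R) t0).
apply: (@is_derive_eq _ R R (D k) t 1 _ _ H); rewrite /D big_ord_recr/= -[_ *: _]/(_ * _) mulrA; congr (_ * _ `^ _).
by rewrite -natr1; ring.
Qed.

Lemma smooth_dist_reg : smooth dist_reg.
Proof.
have := @smooth_comp _ _ [set t : R | 0 < t] D _ smooth_sq sq_gt0 dD.
by congr smooth; apply/funext => x; rewrite /D /= big_ord0 mul1r subr0.
Qed.

Lemma dist_regE x : dist_reg x = Num.sqrt (e ^+ 2 + enorm (x - x0) ^+ 2).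
Proof.
rewrite /dist_reg powR12_sqrt ?ltW// sqr_enorm; congr (Num.sqrt (_ + _)).
by apply: eq_bigr => i _; rewrite !mxE.
Qed.

Lemma dist_reg_center : dist_reg x0 = e.
Proof. by rewrite dist_regE subrr enorm0 expr0n addr0 sqrtr_sqr gtr0_norm. Qed.

Lemma dist_reg_gt0 x : 0 < dist_reg x. Proof. by rewrite powR_gt0. Qed.

Lemma dist_reg_ge x : e <= dist_reg x.
Proof.
rewrite -[leLHS]gtr0_norm// -sqrtr_sqr dist_regE ler_sqrt; last first.
  by rewrite addr_ge0 ?sqr_ge0.
by rewrite lerDl sqr_ge0.
Qed.

Lemma dist_reg_ge_enorm x : enorm (x - x0) <= dist_reg x.
Proof.
rewrite -[leLHS]ger0_norm ?enorm_ge0// -sqrtr_sqr dist_regE ler_sqrt; last first.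
  by rewrite addr_ge0 ?sqr_ge0.
by rewrite lerDr sqr_ge0.
Qed.

(** The gradient is [(x - x0) / dist_reg x], and [dist_reg] dominates [|x - x0|]. *)
Lemma enorm_gradient_dist_reg x : enorm (gradient dist_reg x) <= 1.
Proof.
have sq_diff := smooth_differentiable x smooth_sq.
have dp : is_derive (e ^+ 2 + \sum_i (x 0 i - x0 0 i) ^+ 2) 1 (@powR R ^~ 2^-1)
   (2^-1 / dist_reg x).
  apply: is_derive_eq; first exact: is_derive1_powR.
  congr (_ * _); rewrite /dist_reg -powRN; congr (_ `^ _); lra.
have [_ pE] := differentiable_comp1 sq_diff dp.
have -> : gradient dist_reg x = (dist_reg x)^-1 *: (x - x0).
  apply/rowP => i; rewrite !mxE pE.
  have -> : partial i (fun x => e ^+ 2 + \sum_i (x 0 i - x0 0 i) ^+ 2) x = 2 * (x 0 i - x0 0 i).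
    have dc j : is_derive x ('e_i : 'rV[R]_n) (fun y : 'rV[R]_n => y 0 j - x0 0 j) (i == j)%:R.
      have h : differentiable (fun y : 'rV[R]_n => y 0 j) x by exact: differentiable_coord.
      have h1 : is_derive x ('e_i : 'rV[R]_n) (fun y : 'rV[R]_n => y 0 j) (i == j)%:R.
        apply: DeriveDef; first exact: diff_derivable.
        by have := congr1 (fun f => f x) (@partial_coord R n i j).
      have := is_deriveD h1 (is_derive_cst (- x0 0 j) x ('e_i : 'rV[R]_n)).
      by rewrite addr0.
    have ds : is_derive x ('e_i : 'rV[R]_n)
        (\sum_j (fun y : 'rV[R]_n => (y 0 j - x0 0 j) ^+ 2))
        (\sum_j (2 * (x 0 j - x0 0 j) * (i == j)%:R)).
      apply: is_derive_sum => j.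
      apply: (@is_derive_eq _ _ _ (fun y : 'rV[R]_n => (y 0 j - x0 0 j) ^+ 2) x _ _ _
        (is_deriveM (dc j) (dc j))).
      by rewrite -[_ *: _]/(_ * _); ring.
    have := is_deriveD (is_derive_cst (e ^+ 2) x ('e_i : 'rV[R]_n)) ds.
    rewrite add0r => H; rewrite /partial.
    rewrite (_ : (fun y => _) = cst (e ^+ 2) + \sum_j (fun y : 'rV[R]_n => (y 0 j - x0 0 j) ^+ 2)); last first.
      by apply/funext => y; rewrite fctE; congr (_ + _); rewrite fct_sumE.
    rewrite (@derive_val _ _ _ _ _ _ _ H) (bigD1 i)//= eqxx mulr1 big1 ?addr0//.
    by move=> j /negbTE ji; rewrite eq_sym ji mulr0.
  by field; rewrite gt_eqF// dist_reg_gt0.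
rewrite enormZ ger0_norm ?invr_ge0 ?(ltW (dist_reg_gt0 _))//.
by rewrite ler_pdivrMl ?dist_reg_gt0// mulr1 dist_reg_ge_enorm.
Qed.

Lemma flat1_derive t : flat d (flat_next d 1) t =
  if 0 < t then (1 + d / t) * expR (- (d / t)) else 0.
Proof.
rewrite /flat; case: ifPn => // t0; congr (_ * _).
rewrite /flat_next derivC mulr0 subr0 !hornerE/=.
by field; rewrite gt_eqF.
Qed.

(** With [y = d / t] the derivative is [(1 + y) e^(-y)], and [1 + y <= e^y]. Smoothing the positive
    part in this way costs nothing in the gradient bound. *)
Lemma flat1_derive01 t : 0 <= flat d (flat_next d 1) t <= 1.
Proof.
rewrite flat1_derive; case: ifPn => t0; last by rewrite lexx ler01.
have dt : 0 < d / t by exact: divr_gt0.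
rewrite mulr_ge0 ?expR_ge0 ?addr_ge0 ?(ltW dt)//= expRN ler_pdivrMr ?expR_gt0//.
by rewrite mul1r expR_ge1Dx.
Qed.

Lemma flat1_nondecreasing s t : s <= t -> flat d 1 s <= flat d 1 t.
Proof.
move=> st; have [|c _] := @MVT_segment R (flat d 1) (flat d (flat_next d 1)) s t st
   (fun t _ => is_derive_flat _ _ d0).
  apply: continuous_subspaceT => u; apply: differentiable_continuous.
  by apply/derivable1_diffP; exact: (@ex_derive _ _ _ _ _ _ _ (is_derive_flat 1 u d0)).
move=> h; rewrite -subr_ge0 h mulr_ge0 ?subr_ge0//.
by have /andP[] := flat1_derive01 c.
Qed.

Lemma flat1_ge t : 0 < t -> t - d <= flat d 1 t.
Proof.
move=> t0; rewrite flat_gt0// hornerC mulr1.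
apply: (@le_trans _ _ (t * (1 - d / t))).
  by rewrite mulrBr mulr1 mulrCA divff ?gt_eqF// mulr1.
by rewrite ler_pM2l//; exact: expR_ge1Dx.
Qed.

Lemma smooth_cone : smooth cone.
Proof.
apply: smooth_flat => //; apply: (smoothD (smooth_cst r)).
by under eq_fun do rewrite -mulN1r; exact/smoothZ/smooth_dist_reg.
Qed.

Lemma cone_ge0 x : 0 <= cone x.
Proof.
rewrite /cone /flat; case: ifPn => // h.
by rewrite hornerC mulr1 mulr_ge0 ?expR_ge0// ltW.
Qed.

Lemma cone_le x : cone x <= cone x0.
Proof. by apply: flat1_nondecreasing; rewrite lerD2l lerN2 dist_reg_center dist_reg_ge. Qed.

Lemma cone_center_ge : r - e - d <= cone x0.
Proof. by rewrite /cone dist_reg_center flat1_ge// subr_gt0. Qed.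

Lemma enorm_gradient_cone x : enorm (gradient cone x) <= 1.
Proof.
have dr := smooth_differentiable x smooth_dist_reg.
have dm : differentiable (fun x => r - dist_reg x) x by exact: differentiableB.
have [_ pE] := differentiable_comp1 dm (is_derive_flat 1 (r - dist_reg x) d0).
have -> : gradient cone x = - flat d (flat_next d 1) (r - dist_reg x) *: gradient dist_reg x.
  apply/rowP => i; rewrite !mxE pE mulNr -mulrN; congr (_ * _).
  rewrite /partial (_ : (fun x => r - dist_reg x) = cst r - dist_reg)//.
  by rewrite deriveB ?derive_cst ?sub0r//; exact: diff_derivable.
rewrite enormZ normrN ger0_norm; last by have /andP[] := flat1_derive01 (r - dist_reg x).
rewrite mulr_ile1 ?enorm_ge0 ?enorm_gradient_dist_reg//.
all: by have /andP[] := flat1_derive01 (r - dist_reg x).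
Qed.

Lemma cone_test (Om : set 'rV[R]_n) :
  (forall x, enorm (x - x0) < r -> Om x) -> test_function Om cone.
Proof.
move=> BO; split; first exact: smooth_cone.
(* Bounded because [dist_reg] dominates [|x - x0|], and contained in the open ball because, [e]
   being positive, it does so strictly. *)
exists (dist_reg @^-1` [set t | t <= r]); split.
- apply: bounded_closed_compact.
    exists (`|x0| + `|r|); split; first exact: num_real.
    move=> M hM x /= xr; rewrite -(subrK x0 x) (le_trans (ler_normD _ _))//.
    rewrite addrC; apply: ltW; apply: le_lt_trans hM; rewrite lerD2l.
    apply: le_trans (ler_norm_enorm _) _; apply: le_trans (dist_reg_ge_enorm _) _.
    exact: le_trans xr (ler_norm _).
  apply: closed_comp; last exact: closed_le.
  by move=> x _; apply: smooth_continuous; exact: smooth_dist_reg.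
- move=> x /= xr; apply: BO; apply: lt_le_trans xr.
  rewrite -[ltLHS]ger0_norm ?enorm_ge0// -sqrtr_sqr dist_regE ltr_sqrt.
    by rewrite ltrDr exprn_gt0.
  by rewrite ltr_wpDr ?sqr_ge0// exprn_gt0.
- by move=> x /= /negP; rewrite -ltNge => xr; rewrite /cone flat_le0// subr_le0 ltW.
Qed.

End cone.

(** * Lebesgue norms on a domain *)

Section normL_theory.
Context {R : realType} {n : nat} (Om : set 'rV[R]_n).
Local Notation mu := (lebesgue_measure_rV R n).
Hypothesis mO : measurable Om.
Implicit Types (u v : 'rV[R]_n -> R) (p q : R).

Let ext u : 'rV[R]_n -> R := patch (fun=> 0) Om u.

Lemma normLE s u : normL Om s u = 'N[mu]_s[EFin \o (patch (fun=> 0) Om u)%R]%E.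
Proof. by apply: eq_Lnorm => x; rewrite /= /patch; case: ifP. Qed.

Let measurable_ext u : measurable_fun Om u -> measurable_fun setT (ext u).
Proof. by move=> mu_; exact/(measurable_restrictT _ mO). Qed.

Lemma normL_ge0 s u : (0 <= normL Om s u)%E.
Proof. exact: Lnorm_ge0. Qed.

Lemma powR_integral_itv p u :
  (\int[mu]_(x in Om) (`|u x| `^ p)%:E)%E \in `[0%E, +oo%E].
Proof.
by rewrite in_itv/= leey andbT integral_ge0// => x _; rewrite lee_fin powR_ge0.
Qed.

Lemma normL_powR p u : 0 < p ->
  (normL Om p%:E u `^ p = \int[mu]_(x in Om) (`|u x| `^ p)%:E)%E.
Proof.
move=> p0; rewrite integral_mkcond normLE powR_Lnorm; last by rewrite gt_eqF.
apply: eq_integral => x _; rewrite /= /patch; case: ifP => // _.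
by rewrite normr0 powR0// gt_eqF.
Qed.

Lemma normL_int p u : 0 < p ->
  (normL Om p%:E u = (\int[mu]_(x in Om) (`|u x| `^ p)%:E) `^ p^-1)%E.
Proof.
by move=> p0; rewrite -normL_powR// -poweRrM mulfV ?gt_eqF// poweRe1// normL_ge0.
Qed.

Lemma normLD p u v : 1 <= p -> measurable_fun Om u -> measurable_fun Om v ->
  (normL Om p%:E (fun x => u x + v x)%R <= normL Om p%:E u + normL Om p%:E v)%E.
Proof.
move=> p1 mu_ mv; rewrite !normLE.
apply: le_trans (minkowski_EFin _ (measurable_ext mu_) (measurable_ext mv) p1).
rewrite (_ : patch _ _ _ = (ext u \+ ext v)%R)//.
by apply/funext => x; rewrite /= /ext /patch; case: ifP => // _; rewrite addr0.
Qed.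

Lemma measurable_powR_norm p (D : set 'rV[R]_n) u : measurable_fun D u ->
  measurable_fun D (fun x => (`|u x| `^ p)%:E).
Proof.
move=> mu_; apply/measurable_EFinP.
apply: (@measurableT_comp _ _ _ _ _ _ (@powR R ^~ p)) => //.
exact: measurableT_comp.
Qed.

Lemma le_normL s u v : (0 < s)%E -> measurable_fun Om u -> measurable_fun Om v ->
  {ae mu, forall x, Om x -> `|u x| <= `|v x|} ->
  (normL Om s u <= normL Om s v)%E.
Proof.
case: s => [p| |//] s0 mu_ mv uv; last first.
  rewrite !normLE unlock; case: ifPn => // _.
  apply: le_ess_sup; apply: filterS uv => x /= uv.
  rewrite /patch; case: ifPn => [/set_mem/uv|]; by rewrite lee_fin.
have p0 : 0 < p by rewrite -lte_fin.
rewrite (normL_int u p0) (normL_int v p0).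
apply: gt0_ler_poweR; first by rewrite invr_ge0 ltW.
  exact: powR_integral_itv.
  exact: powR_integral_itv.
apply: ae_ge0_le_integral; [exact: mO| |exact: measurable_powR_norm| |exact: measurable_powR_norm|].
- by move=> x _; rewrite lee_fin powR_ge0.
- by move=> x _; rewrite lee_fin powR_ge0.
apply: filterS uv => x uv /uv {}uv; rewrite lee_fin.
by rewrite ge0_ler_powR// ?nnegrE// ltW.
Qed.

Lemma eq_normL s u v : (0 < s)%E -> measurable_fun Om u -> measurable_fun Om v ->
  {ae mu, forall x, Om x -> `|u x| = `|v x|} -> normL Om s u = normL Om s v.
Proof.
move=> s0 mu_ mv uv; apply/eqP; rewrite eq_le; apply/andP; split;
  by apply: le_normL => //; apply: filterS uv => x uv /uv ->.
Qed.

Lemma normLZ p (a : R) u : 0 < p -> measurable_fun Om u ->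
  normL Om p%:E (fun x => a * u x) = (`|a|%:E * normL Om p%:E u)%E.
Proof.
move=> p0 mu_; rewrite !normL_int//.
under eq_integral do rewrite normrM powRM// EFinM.
rewrite ge0_integralZl//; last first.
  exact: measurable_powR_norm.
rewrite poweRM ?lee_fin ?powR_ge0//; last first.
  by rewrite integral_ge0// => x _; rewrite lee_fin powR_ge0.
by rewrite poweR_EFin -powRrM mulfV ?gt_eqF// powRr1.
Qed.

Lemma normLN p u : normL Om p%:E (fun x => - u x) = normL Om p%:E u.
Proof.
rewrite !normLE -[RHS]oppe_Lnorm; apply: eq_Lnorm => x /=.
by rewrite /patch; case: ifP => // _; rewrite oppr0.
Qed.

Lemma normL_normr p u : normL Om p%:E (fun x => `|u x|) = normL Om p%:E u.
Proof.
rewrite !normLE -[RHS]Lnorm_abse; apply: eq_Lnorm => x /=.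
by rewrite /patch; case: ifP => // _; rewrite normr0.
Qed.

Hypothesis fO : (mu Om < +oo)%E.

Lemma normL_cst p (c : R) : 0 < p -> 0 <= c ->
  normL Om p%:E (fun=> c) = (c%:E * mu Om `^ p^-1)%E.
Proof.
move=> p0 c0; rewrite normL_int// ger0_norm//.
have -> := @integral_cst _ _ _ mu Om mO (c `^ p)%:E.
rewrite poweRM ?lee_fin ?powR_ge0// poweR_EFin -powRrM mulfV ?gt_eqF// powRr1//.
Qed.

Lemma normL_bounded p u (M : R) : 0 < p -> 0 <= M -> measurable_fun Om u ->
  {ae mu, forall x, Om x -> `|u x| <= M} ->
  (normL Om p%:E u <= M%:E * mu Om `^ p^-1)%E.
Proof.
move=> p0 M0 mu_ uM; rewrite -normL_cst//; apply: le_normL => //.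
by apply: filterS uM => x uM /uM; rewrite (ger0_norm M0).
Qed.

(** Hoelder's inequality for [|u|^q] and the indicator of [Om], with the conjugate exponents [p / q]
    and [1 / (1 - q / p)], followed by a [q]-th root. *)
Lemma normL_hoelder p q u : 0 < q -> q <= p -> measurable_fun Om u ->
  (normL Om q%:E u <= normL Om p%:E u * mu Om `^ (q^-1 - p^-1))%E.
Proof.
move=> q0; rewrite le_eqVlt => /predU1P[<- _|qp mu_].
  by rewrite subrr poweRe0 mule1.
have p0 : 0 < p by exact: lt_trans qp.
have pq1 : 1 < p / q by rewrite ltr_pdivlMr// mul1r.
have pq0 : 0 < p / q by exact: divr_gt0.
pose r := (1 - q / p)^-1.
have qp1 : 0 < 1 - q / p by rewrite subr_gt0 ltr_pdivrMr// mul1r.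
have r0 : 0 < r by rewrite invr_gt0.
pose f x := `|ext u x| `^ q; pose g : 'rV[R]_n -> R := ext (fun=> 1).
have mf : measurable_fun setT f.
  apply: (@measurableT_comp _ _ _ _ _ _ (@powR R ^~ q)) => //.
  by apply: measurableT_comp => //; exact: measurable_ext.
have mg : measurable_fun setT g by apply: measurable_ext; exact: measurable_cst.
have := @hoelder _ _ _ mu f g (p / q) r mf mg pq0 r0.
rewrite /r invrK invf_div addrCA subrr addr0 => /(_ erefl).
have -> : 'N[mu]_1[EFin \o (f \* g)%R]%E = (normL Om q%:E u `^ q)%E.
  rewrite normL_powR// Lnorm1 [RHS]integral_mkcond.
  apply: eq_integral => x _; rewrite /f /g /ext /= /patch; case: ifP => _ /=.
    by rewrite mulr1 norm_powR ?normr_id.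
  by rewrite mulr0 normr0.
have -> : 'N[mu]_(p / q)%:E[EFin \o f]%E = (normL Om p%:E u `^ q)%E.
  have -> : (normL Om p%:E u `^ q = (\int[mu]_(x in Om) (`|u x| `^ p)%:E) `^ (q / p))%E.
    by rewrite normL_int// -poweRrM mulrC.
  rewrite unlock invf_div; congr (_ `^ _)%E.
  rewrite [RHS]integral_mkcond; apply: eq_integral => x _.
  rewrite /f /ext /= /patch; case: ifP => _ /=; last first.
    by rewrite normr0 !powR0 ?gt_eqF// normr0 powR0 ?gt_eqF.
  by rewrite norm_powR// normr_id -powRrM mulrCA mulfV ?gt_eqF// mulr1.
have -> : 'N[mu]_(1 - q / p)^-1%:E[EFin \o g]%E = (mu Om `^ (1 - q / p))%E.
  rewrite unlock invrK; congr (_ `^ _)%E.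
  rewrite -[RHS]mul1e -integral_cst// [RHS]integral_mkcond.
  apply: eq_integral => x _; rewrite /g /ext /= /patch; case: ifP => _ /=.
    by rewrite normr1 powR1.
  by rewrite normr0 powR0// gt_eqF.
move=> H.
have H' : ((normL Om q%:E u `^ q) `^ q^-1 <=
   (normL Om p%:E u `^ q * mu Om `^ (1 - q / p)) `^ q^-1)%E.
  apply: gt0_ler_poweR => //; first by rewrite invr_ge0 ltW.
    by rewrite in_itv/= leey andbT poweR_ge0.
  by rewrite in_itv/= leey andbT mule_ge0// poweR_ge0.
move: H'; rewrite poweRM ?poweR_ge0// -!poweRrM mulfV ?gt_eqF// !poweRe1 ?normL_ge0//.
congr (_ <= _ * _ `^ _)%E; field; rewrite !gt_eqF//.
Qed.

Lemma memL_integrable p u : 1 <= p -> memL Om p%:E u -> mu.-integrable Om (EFin \o u).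
Proof.
move=> p1 [mu_ up]; apply/integrableP; split; first exact/measurable_EFinP.
have := normL_hoelder ltr01 p1 mu_; rewrite normL_int// invr1 poweRe1; last first.
  by rewrite integral_ge0// => x _; rewrite lee_fin powR_ge0.
under eq_integral do rewrite powRr1//.
move=> /le_lt_trans; apply; rewrite lte_mul_pinfty ?normL_ge0//.
  by rewrite ge0_fin_numE ?normL_ge0.
by rewrite poweR_lty.
Qed.

Lemma memL_sub p q u : 0 < q -> q <= p -> memL Om p%:E u -> memL Om q%:E u.
Proof.
move=> q0 qp [mu_ up]; split => //; apply: le_lt_trans (normL_hoelder q0 qp mu_) _.
rewrite lte_mul_pinfty ?normL_ge0// ?poweR_lty//.
by rewrite ge0_fin_numE ?normL_ge0.
Qed.

Lemma memL_bounded p u (M : R) : 0 < p -> measurable_fun Om u ->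
  (forall x, Om x -> `|u x| <= M) -> memL Om p%:E u.
Proof.
move=> p0 mu_ uM; split => //.
have uM' : {ae mu, forall x, Om x -> `|u x| <= `|M|}.
  by apply/nearW => x /uM h; apply: le_trans h (ler_norm _).
apply: le_lt_trans (normL_bounded p0 (normr_ge0 M) mu_ uM') _.
by rewrite lte_mul_pinfty ?lee_fin// poweR_lty.
Qed.

End normL_theory.

Section vector_normL.
Context {R : realType} {n : nat} (Om : set 'rV[R]_n).
Local Notation mu := (lebesgue_measure_rV R n).
Hypothesis mO : measurable Om.
Implicit Types (G H : 'rV[R]_n -> 'rV[R]_n) (p : R).

Lemma measurable_coords_enorm (D : set 'rV[R]_n) G : measurable D ->
  (forall i, measurable_fun D (fun x => G x 0 i)) -> measurable_fun D (fun x => enorm (G x)).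
Proof.
move=> mD mG; apply: (@measurableT_comp _ _ _ _ _ _ (@Num.sqrt R) _ (fun x => \sum_i G x 0 i ^+ 2)); first exact: (continuous_measurable_fun (@sqrt_continuous R)).
by apply: measurable_sum => i; apply: measurable_funX.
Qed.

Lemma normL_enormD p G H : 1 <= p ->
  (forall i, measurable_fun Om (fun x => G x 0 i)) ->
  (forall i, measurable_fun Om (fun x => H x 0 i)) ->
  (normL Om p%:E (fun x => enorm (G x + H x)%R) <=
   normL Om p%:E (fun x => enorm (G x)) + normL Om p%:E (fun x => enorm (H x)))%E.
Proof.
move=> p1 mG mH.
have mG' := measurable_coords_enorm mO mG; have mH' := measurable_coords_enorm mO mH.
apply: le_trans (normLD mO p1 mG' mH'); apply: le_normL => //.
- by rewrite lte_fin (lt_le_trans _ p1).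
- apply: (measurable_coords_enorm mO (G := fun x => G x + H x)) => i.
  by under eq_fun do rewrite mxE; exact: measurable_funD.
- exact: measurable_funD.
apply/nearW => x _; rewrite !ger0_norm ?enorm_ge0 ?addr_ge0 ?enorm_ge0//.
exact: ler_enormD.
Qed.

Lemma normL_coord_le s G i : (0 < s)%E ->
  (forall i, measurable_fun Om (fun x => G x 0 i)) ->
  (normL Om s (fun x => G x ord0 i) <= normL Om s (fun x => enorm (G x)))%E.
Proof.
move=> s0 mG; apply: le_normL => //; first exact: measurable_coords_enorm.
by apply/nearW => x _ /=; rewrite [leRHS]ger0_norm ?enorm_ge0// ler_coord_enorm.
Qed.

End vector_normL.

Lemma normL_subset {R : realType} {n : nat} (A B : set 'rV[R]_n) (p : R) (f : 'rV[R]_n -> R) :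
  measurable A -> measurable B -> A `<=` B -> 0 < p -> measurable_fun B f ->
  (normL A p%:E f <= normL B p%:E f)%E.
Proof.
move=> mA mB AB p0 mf; rewrite !normL_int//; apply: gt0_ler_poweR.
- by rewrite invr_ge0 ltW.
- exact: powR_integral_itv.
- exact: powR_integral_itv.
apply: ge0_subset_integral; [exact: mA|exact: mB| | |exact: AB].
  exact: measurable_powR_norm.
by move=> x _; rewrite lee_fin powR_ge0.
Qed.

(** * Weak gradients *)

Section translation.
Context {R : realType} {n : nat}.
Local Notation mu := (lebesgue_measure_rV R n).

Lemma integral_translate (f : 'rV[R]_n -> R) v : measurable_fun setT f ->
  (\int[mu]_x (f (v + x)%R)%:E = \int[mu]_x (f x)%:E)%E.
Proof.
move=> mf; have H (g : 'rV[R]_n -> \bar R) : measurable_fun setT g -> (forall x, 0 <= g x)%E ->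
    (\int[mu]_x g (v + x)%R = \int[mu]_x g x)%E.
  move=> mg g0; rewrite [RHS](@ge0_integral_affine _ _ v 1)//.
  rewrite expr1n mul1e; apply: eq_integral => x _.
  by rewrite /affine scale1r.
rewrite integralE [RHS]integralE -(H (EFin \o f)^\+%E) -?(H (EFin \o f)^\-%E) //.

- have E1 : (\int[mu]_x ((fun y => (f (v + y))%:E) ^\+) x = \int[mu]_x ((EFin \o f)^\+) (v + x)%R)%E.
    by apply: eq_integral => y _; rewrite unlock.
  have E2 : (\int[mu]_x ((fun y => (f (v + y))%:E) ^\-) x = \int[mu]_x ((EFin \o f)^\-) (v + x)%R)%E.
    by apply: eq_integral => y _; rewrite unlock.
  by rewrite E1 E2.
- by apply: measurable_funeneg; exact/measurable_EFinP.
- by apply: measurable_funepos; exact/measurable_EFinP.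
Qed.

Lemma Rintegral_support (A B : set 'rV[R]_n) (f : 'rV[R]_n -> R) : A `<=` B ->
  (forall x, ~ A x -> f x = 0) -> \int[mu]_(x in A) f x = \int[mu]_(x in B) f x.
Proof.
move=> AB f0; rewrite Rintegral_mkcond [RHS]Rintegral_mkcond.
congr Rintegral; apply/funext => x; rewrite /patch.
case: ifPn => xA; first by rewrite mem_set//; apply: AB; exact: set_mem.
by case: ifPn => // _; rewrite f0//; move/negP: xA => xA /mem_set.
Qed.

Lemma compact_measurable_rV (K : set 'rV[R]_n) : compact K -> measurable K.
Proof.
by move=> cK; apply: measurable_closed_rV; apply: compact_closed => //; exact: norm_hausdorff.
Qed.

Lemma compact_measure_lty (K : set 'rV[R]_n) : compact K -> (mu K < +oo)%E.
Proof.
move=> cK; apply: bounded_measure_lty; last exact: compact_bounded.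
exact: compact_measurable_rV.
Qed.

Lemma dominated_Rintegral (D : set 'rV[R]_n) (f_ : nat -> 'rV[R]_n -> R) (f g : 'rV[R]_n -> R) :
  measurable D -> (forall k, measurable_fun D (f_ k)) ->
  (forall x, D x -> f_ k x @[k --> \oo] --> f x) -> mu.-integrable D (EFin \o g) ->
  (forall k x, D x -> `|f_ k x| <= g x) ->
  \int[mu]_(x in D) f_ k x @[k --> \oo] --> \int[mu]_(x in D) f x.
Proof.
move=> mD mf_ ff ig fg.
have mf : measurable_fun D f by exact: measurable_fun_cvg mf_ ff.
have [|||||if_ _ h] := @dominated_convergence _ _ _ mu _ mD (fun k => EFin \o f_ k)
  (EFin \o f) (EFin \o g) => //.
- by move=> k; exact/measurable_EFinP.
- exact/measurable_EFinP.
- by apply/nearW => x Dx; apply: cvg_EFin; [exact: nearW|exact: ff].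
- by apply/nearW => x k Dx; rewrite /= lee_fin fg.
have fin : (\int[mu]_(x in D) (EFin \o f) x)%E \is a fin_num by exact: integrable_fin_num.
by move: h; rewrite -[X in _ --> X -> _]fineK// => /fine_cvgP[_].
Qed.

End translation.

Section weak_gradients.
Context {R : realType} {n : nat} (Om : set 'rV[R]_n).
Local Notation mu := (lebesgue_measure_rV R n).
Hypotheses (oO : open Om) (bO : bounded_set Om).
Implicit Types (u v g phi psi : 'rV[R]_n -> R) (G H : 'rV[R]_n -> 'rV[R]_n).

Let mO : measurable Om := measurable_open_rV oO.

Lemma domain_measure_lty : (mu Om < +oo)%E.
Proof. exact: bounded_measure_lty. Qed.

Lemma test_measurable (D : set 'rV[R]_n) phi : test_function Om phi -> measurable_fun D phi.
Proof.
by move=> tphi; apply: measurable_funTS; apply: continuous_measurable_rV; exact: test_continuous tphi.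
Qed.

Lemma bounded_integrable_rV (D : set 'rV[R]_n) g (M : R) : measurable D -> (mu D < +oo)%E ->
  measurable_fun D g -> (forall x, D x -> `|g x| <= M) -> mu.-integrable D (EFin \o g).
Proof.
move=> mD fD mg gM; apply: measurable_bounded_integrable => //.
exists M; split; first exact: num_real.
by move=> y My x Dx; apply: le_trans (gM x Dx) _; exact: ltW.
Qed.

Lemma test_integrable (D : set 'rV[R]_n) phi : measurable D -> (mu D < +oo)%E ->
  test_function Om phi -> mu.-integrable D (EFin \o phi).
Proof.
move=> mD fD tphi; have [M HM] := test_bounded tphi.
by apply: (bounded_integrable_rV mD fD) => //; exact: test_measurable.
Qed.

(** The difference quotients of step [h] have integral [0] by translation invariance, and they
    differ from the partial derivative by at most [L * h]; then [h] tends to [0]. *)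
Lemma Rintegral_partial0 phi i : test_function Om phi ->
  \int[mu]_(x in Om) partial i phi x = 0.
Proof.
move=> tphi; have [M M0 OM] := bounded_cbox_sub bO.
(* The margin [1] keeps the support of the translated function inside [B] for every step
   [h <= 1]. *)
pose B : set 'rV[R]_n := cbox (const_mx (- (M + 1))) (const_mx (M + 1)).
have mB : measurable B by exact: measurable_cbox.
have fB : (mu B < +oo)%E by exact: lebesgue_measure_cbox_lty.
have OB : Om `<=` B by move=> x /OM xM j; have := xM j; rewrite !mxE => /andP[h1 h2]; apply/andP; split; lra.
have tp := test_partial i tphi.
rewrite (Rintegral_support OB); last by move=> x; exact: test_function_out.
have [L L0 HL] := test_lipschitz tp.
have key (h : R) : 0 < h -> h <= 1 ->
    `|\int[mu]_(x in B) partial i phi x| <= L * h * fine (mu B).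
  move=> h0 h1; pose v : 'rV[R]_n := h *: delta_mx 0 i.
  have ev : enorm v = h.
    rewrite /v enormZ gtr0_norm// (_ : enorm _ = 1) ?mulr1//.
    rewrite /enorm (bigD1 i)//= mxE !eqxx expr1n big1 ?addr0 ?sqrtr1//.
    by move=> j ji; rewrite mxE eqxx (negbTE ji) expr0n.
  have mv : measurable_fun setT (fun x => phi (v + x)).
    apply: continuous_measurable_rV => x.
    apply: (@continuous_comp 'rV[R]_n 'rV[R]_n R (fun x => v + x) phi).
      by apply: (@cvgD _ _ _ (nbhs x)); [exact: cvg_cst|exact: cvg_id].
    exact: (test_continuous tphi).
  have iv : mu.-integrable B (EFin \o (fun x => phi (v + x))).
    have [C HC] := test_bounded tphi.
    by apply: (bounded_integrable_rV mB fB (M := C)) => //; exact: measurable_funTS.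
  have iphi := test_integrable mB fB tphi.
  have iB : \int[mu]_(x in B) (phi (v + x) - phi x) = 0.
    rewrite RintegralB//; apply/eqP; rewrite subr_eq0; apply/eqP.
    rewrite (@Rintegral_support _ _ B setT (fun x => phi (v + x)))//; last first.
      move=> x Bx; apply: (test_function_out tphi) => /OM xM; apply: Bx => j.
      have := xM j; rewrite !mxE /= => /andP[h2 h3].
      have : `|h * (j == i)%:R| <= 1.
        by rewrite normrM gtr0_norm//; case: (j == i); rewrite ?normr1 ?normr0 ?mulr1// mulr0.
      by rewrite ler_norml => /andP[h4 h5]; apply/andP; split; lra.
    rewrite (@Rintegral_support _ _ B setT phi)//; last first.
      by move=> x Bx; apply: (test_function_out tphi) => /OB.
    rewrite /Rintegral integral_translate//.
    by apply: continuous_measurable_rV; exact: test_continuous tphi.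
  (* By the mean value theorem the quotient is the value of [partial i phi] at a point within [h] of
     [x]. *)
  have bnd x : `|partial i phi x - h^-1 * (phi (v + x) - phi x)| <= L * h.
    have [t /andP[t0 t1]] := mean_value_rV x v (fun y => test_differentiable y tphi).
    rewrite [x + v]addrC => ->; rewrite (bigD1 i)//= big1 ?addr0; last first.
      by move=> j ji; rewrite !mxE eqxx (negbTE ji) mulr0 mul0r.
    rewrite !mxE !eqxx mulr1 mulrA mulVf ?gt_eqF// mul1r distrC.
    apply: le_trans (HL _ _) _; rewrite addrAC subrr add0r enormZ ev (ger0_norm t0).
    by rewrite ler_wpM2l// ler_piMl// ltW.
  have -> : \int[mu]_(x in B) partial i phi x =
      \int[mu]_(x in B) (partial i phi x - h^-1 * (phi (v + x) - phi x)).
    rewrite RintegralB//.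
    - rewrite [X in _ = _ - X]RintegralZl// ?iB ?mulr0 ?subr0//.
      exact: (integrableB mB iv iphi).
    - exact: test_integrable.
    - exact: (integrableZl mB (h^-1) (integrableB mB iv iphi)).
  have iD : mu.-integrable B (EFin \o (fun x => partial i phi x - h^-1 * (phi (v + x) - phi x))).
    exact: (integrableB mB (test_integrable mB fB tp)
      (integrableZl mB (h^-1) (integrableB mB iv iphi))).
  apply: le_trans (le_normr_Rintegral mB iD) _.
  rewrite -Rintegral_cst//; apply: le_Rintegral => //.
    exact: (integrable_norm iD).
  by apply: (bounded_integrable_rV mB fB (M := `|L * h|)).
apply/eqP; rewrite -normr_le0; apply/ler_addgt0Pr => e e0; rewrite add0r.
have fB0 : 0 <= fine (mu B) by rewrite fine_ge0.
have C0 : 0 < L * fine (mu B) + 1 by rewrite ltr_wpDl// mulr_ge0.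
pose h := Num.min 1 (e / (L * fine (mu B) + 1)).
have h0 : 0 < h by rewrite lt_min ltr01 divr_gt0.
have h1 : h <= 1 by rewrite ge_min lexx.
apply: le_trans (key h h0 h1) _.
have : h <= e / (L * fine (mu B) + 1) by rewrite ge_min lexx orbT.
rewrite ler_pdivlMr// => he; apply: le_trans he.
by rewrite mulrAC mulrC ler_pM2l// lerDl.
Qed.

Lemma loc_integrable_test g phi : loc_integrable Om g -> test_function Om phi ->
  mu.-integrable Om (EFin \o (fun x => g x * phi x)).
Proof.
move=> [mg ig] tphi; have [_ [K [cK KO Kphi]]] := tphi.
have mK := compact_measurable_rV cK.
have [M HM] := test_bounded tphi.
have mgphi : measurable_fun K (fun x => g x * phi x).
  by apply: measurable_funM; [exact: measurable_funS mg|exact: test_measurable].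
have iK : mu.-integrable K (EFin \o (fun x => g x * phi x)).
  apply: (le_integrable mK (g := fun x => (M%:E * (g x)%:E)%E)).
  - exact/measurable_EFinP.
  - move=> x Kx /=; rewrite lee_fin normrM mulrC [leRHS]normrM ler_wpM2r//.
    exact: le_trans (HM x) (ler_norm _).
  - by apply: integrableZl => //; exact: ig.
move/(integrable_mkcond _ mK) : iK => iK; apply/(integrable_mkcond _ mO).
apply: eq_integrable iK => // x _; rewrite /patch.
case: ifPn => xK; first by rewrite mem_set//; apply: KO; exact: set_mem.
case: ifPn => // _ /=; rewrite Kphi ?mulr0//.
by move=> Kx; move/negP: xK; apply; exact: mem_set.
Qed.

Lemma bounded_loc_integrable g (M : R) : measurable_fun Om g ->
  (forall x, Om x -> `|g x| <= M) -> loc_integrable Om g.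
Proof.
move=> mg gM; split => // K KO cK.
apply: (bounded_integrable_rV (M := M)).
- exact: compact_measurable_rV.
- exact: compact_measure_lty.
- exact: measurable_funS mg.
- by move=> x /KO; exact: gM.
Qed.

Lemma memL_loc_integrable (p : R) g : 1 <= p -> memL Om p%:E g -> loc_integrable Om g.
Proof.
move=> p1 mg; split; first by have [] := mg.
move=> K KO cK; apply: (integrableS mO) => //; first exact: compact_measurable_rV.
by apply: (memL_integrable mO domain_measure_lty p1).
Qed.

Lemma loc_integrableD (a : R) g h : loc_integrable Om g -> loc_integrable Om h ->
  loc_integrable Om (fun x => a * g x + h x).
Proof.
move=> [mg ig] [mh ih]; split; first by apply: measurable_funD => //; exact: measurable_funM.
move=> K KO cK; have mK := compact_measurable_rV cK.
have iag : mu.-integrable K (fun x => (a%:E * (EFin \o g) x)%E).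
  by apply: integrableZl => //; exact: ig.
exact: (integrableD mK iag (ih _ KO cK)).
Qed.

Lemma test_loc_integrable phi : test_function Om phi -> loc_integrable Om phi.
Proof.
move=> tphi; have [M HM] := test_bounded tphi.
by apply: (bounded_loc_integrable (M := M)) => //; exact: test_measurable.
Qed.

(** * The fundamental lemma of the calculus of variations *)

Section fundamental_lemma.
Variable g : 'rV[R]_n -> R.
Hypothesis lg : loc_integrable Om g.
Hypothesis g0 : forall phi, test_function Om phi -> \int[mu]_(x in Om) (g x * phi x) = 0.

Let measurable_obox a b : measurable (@obox R n a b).
Proof. by apply: measurable_open_rV; exact: open_obox. Qed.

Let integrable_obox a b : cbox a b `<=` Om -> mu.-integrable (obox a b) (EFin \o g).
Proof.
move=> abO; have [_ ig] := lg.
apply: (integrableS (measurable_cbox a b)) => //; first exact: obox_cbox.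
by apply: ig => //; exact: compact_cbox.
Qed.

(** Dominated convergence, with [|g|] as majorant: the bumps are test functions, vanish off the open
    box and tend to [1] on it. *)
Lemma Rintegral_obox0 a b : cbox a b `<=` Om -> \int[mu]_(x in obox a b) g x = 0.
Proof.
move=> abO; have iab := integrable_obox abO; have mab := measurable_obox a b.
have mg : measurable_fun (obox a b) g.
  by have := measurable_int _ iab; move/measurable_EFinP.
have mgb k : measurable_fun (obox a b) (fun x => g x * box_bump a b k x).
  by apply: measurable_funM => //; apply: (@test_measurable _ (box_bump a b k)); exact: box_bump_test.
have := @dominated_Rintegral _ _ (obox a b) (fun k x => g x * box_bump a b k x) g
   (fun x => `|g x|) mab mgb _ (integrable_norm iab) _.
have -> : (fun k => \int[mu]_(x in obox a b) (g x * box_bump a b k x)) = (fun=> 0).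
  apply/funext => k; rewrite (@Rintegral_support _ _ (obox a b) Om).
  - by apply: g0; exact: box_bump_test.
  - by apply: subset_trans abO; exact: obox_cbox.
  - by move=> x /(@box_bump_out _ _ _ _ k) ->; rewrite mulr0.
move=> H; apply: (@cvg_unique _ _ ((fun=> 0 : R) @ \oo)); last exact: cvg_cst.
  exact: Rhausdorff.
apply: H => [x xab|k x xab].
  rewrite -[X in _ --> X]mulr1; apply: cvgM; first exact: cvg_cst.
  by have := @box_bump_cvg _ _ a b x; rewrite indicE mem_set.
rewrite normrM ler_piMr// ger0_norm; by have /andP[] := box_bump01 a b k x.
Qed.

(** Dynkin's argument: the sets [A] with this property form a lambda-system containing the open
    boxes, which are stable by intersection and generate the sigma-algebra. Cutting by a fixed box
    keeps [g] integrable. *)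
Lemma Rintegral_setI_obox0 a b A : cbox a b `<=` Om -> measurable A ->
  \int[mu]_(x in A `&` obox a b) g x = 0.
Proof.
move=> abO mA; have iab := integrable_obox abO; have mab := measurable_obox a b.
have mg : measurable_fun (obox a b) g.
  by have := measurable_int _ iab; move/measurable_EFinP.
pose H := [set A : set 'rV[R]_n | measurable A /\ \int[mu]_(x in A `&` obox a b) g x = 0].
suff : H A by case.
have genE := measurable_rV_generated (fun a b => @subset_refl _ (obox a b)) (@obox_cbox R n) measurable_obox.
have : <<s [set A | exists a b, A = obox a b] >> A by rewrite -genE.
apply: (@lambda_system_subset _ _ _ setT) => //.
- by move=> _ _ [a1 [b1 ->]] [a2 [b2 ->]]; rewrite oboxI; eexists; eexists.
- split => //.
  + by split; [exact: measurableT|rewrite setTI Rintegral_obox0].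
  + move=> A1 A2 A21 [mA1 A10] [mA2 A20]; split; first exact: measurableD.
    have E : A1 `&` obox a b = (A2 `&` obox a b) `|` ((A1 `\` A2) `&` obox a b).
      by rewrite -setIUl setDUK.
    move: A10; rewrite E Rintegral_setU ?A20 ?add0r//.
    * exact: measurableI.
    * by apply: measurableI => //; exact: measurableD.
    * rewrite -E; apply: integrableS iab => //; first exact: measurableI.
    * apply/disj_setPS => x [[h1 _] [[_ h2] _]]; exact: h2.
  + move=> F ndF HF; have mF k : measurable (F k) by have [] := HF k.
    split; first exact: bigcup_measurable.
    have mU : measurable (\bigcup_k F k) by exact: bigcup_measurable.
    have E A' : \int[mu]_(x in A' `&` obox a b) g x = \int[mu]_(x in obox a b) (g \_ A') x.
      by rewrite setIC Rintegral_mkcondr.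
    have := @dominated_Rintegral _ _ (obox a b) (fun k => g \_ (F k)) (g \_ (\bigcup_k F k))
      (fun x => `|g x|) mab _ _ (integrable_norm iab) _.
    rewrite E; under [X in _ -> _ -> _ -> X @ _ --> _]eq_fun do rewrite -E.
    have -> : (fun k => \int[mu]_(x in F k `&` obox a b) g x) = (fun=> 0).
      by apply/funext => k; have [] := HF k.
    move=> K; apply: (@cvg_unique _ _ ((fun=> 0 : R) @ \oo)); last exact: cvg_cst.
      exact: Rhausdorff.
    apply: K => [k|x _|k x _].
    * by apply/measurable_restrict => //; exact: measurable_funS mg.
    * have [[k _ Fkx]|nF] := pselect ((\bigcup_k F k) x).
        apply: cvg_near_cst; exists k => // j /= kj.
        by rewrite /patch !mem_set//; [exists k|exact: (subsetPset _ _ (ndF _ _ kj))].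
      rewrite {2}/patch memNset//.
      have -> : (fun k => (g \_ (F k)) x) = fun=> point.
        by apply/funext => k; rewrite /patch memNset// => Fkx; apply: nF; exists k.
      exact: cvg_cst.
    * by rewrite /patch; case: ifP => // _; rewrite normr0.
- by move=> _ [a1 [b1 ->]]; split => //; rewrite oboxI Rintegral_obox0// => x xab; apply: abO => i;
    have := xab i; rewrite !mxE ge_max le_min => /andP[/andP[_ ->] /andP[_ ->]].
Qed.

(** On each box [g] has zero integral over every measurable part, hence vanishes almost everywhere
    there; countably many rational boxes cover [Om]. *)
Lemma fundamental_lemma_ae : {ae mu, forall x, Om x -> g x = 0}.
Proof.
have H (q : {ffun 'I_n -> rat} * {ffun 'I_n -> rat}) : ratbox cbox q `<=` Om ->
    {ae mu, forall x, @ratbox R n obox q x -> g x = 0}.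
  move=> qO; have iq := integrable_obox qO.
  have := @integral_ae_eq _ _ _ mu _ (measurable_obox _ _) (cst 0%E) _ iq (measurable_cst _) _.
  have E A : A `<=` ratbox obox q -> measurable A ->
      (\int[mu]_(x in A) (EFin \o g) x = \int[mu]_(x in A) cst 0 x)%E.
    move=> Aq mA; rewrite [RHS]integral_cst// mul0e.
    have := Rintegral_setI_obox0 qO mA; rewrite setIidl// /Rintegral => h.
    rewrite -[LHS]fineK ?h//.
    by apply: integrable_fin_num => //; apply: integrableS iq.
  by move=> /(_ E); apply: filterS => x /= h /h [].
(* [unpickle] enumerates the rational boxes by [nat], the index type of [ae_foralln]. *)
have : {ae mu, forall x, forall k : nat, match unpickle k with
   | Some q => ratbox cbox q `<=` Om -> @ratbox R n obox q x -> g x = 0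
   | None => True end}.
  apply/ae_foralln => k; case: unpickle => [q|]; last exact: nearW.
  have [qO|qO] := pselect (ratbox cbox q `<=` Om); last exact: nearW.
  by apply: filterS (H q qO) => x h _.
apply: filterS => x h Ox; have [q qx qO] := open_ratbox oO Ox.
by have := h (pickle q); rewrite pickleK; apply.
Qed.

End fundamental_lemma.

Lemma weak_gradient_unique u G H : weak_gradient Om u G -> weak_gradient Om u H ->
  {ae mu, forall x, Om x -> G x = H x}.
Proof.
move=> [_ lG uG] [_ lH uH].
have h (i : 'I_n) : {ae mu, forall x, Om x -> G x 0 i - H x 0 i = 0}.
  have lGH : loc_integrable Om (fun x => G x 0 i - H x 0 i).
    have := loc_integrableD (-1) (lH i) (lG i).
    by congr loc_integrable; apply/funext => x; rewrite mulN1r addrC.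
  apply: (fundamental_lemma_ae lGH) => phi tphi.
  under eq_Rintegral do rewrite mulrBl.
  rewrite RintegralB//; [|exact: loc_integrable_test|exact: loc_integrable_test].
  by apply/eqP; rewrite subr_eq0 -eqr_opp -uG// -uH.
(* The same device for the coordinates: [insub k] is [None] from [n] on, where nothing is
   claimed. *)
have : {ae mu, forall x, forall k : nat, match insub k with
   | Some i => Om x -> G x 0 i - H x 0 i = 0
   | None => True end}.
  by apply/ae_foralln => k; case: insub => [i|]; [exact: h|exact: nearW].
apply: filterS => x hx Ox; apply/rowP => i; apply/eqP; rewrite -subr_eq0.
by have := hx i; rewrite valK => /(_ Ox)/eqP.
Qed.

Lemma weak_gradientD (a : R) u v G H : weak_gradient Om u G -> weak_gradient Om v H ->
  weak_gradient Om (fun x => a * u x + v x) (fun x => a *: G x + H x).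
Proof.
move=> [lu lG uG] [lv lH vH]; split; first exact: loc_integrableD.
  move=> i; have := loc_integrableD a (lG i) (lH i).
  by congr loc_integrable; apply/funext => x; rewrite !mxE.
move=> phi i tphi; have tp := test_partial i tphi.
have iZ g psi : mu.-integrable Om (EFin \o (fun x => g x * psi x)) ->
    mu.-integrable Om (EFin \o (fun x => a * (g x * psi x))).
  by move=> h; exact: (integrableZl mO a h).
have iu := loc_integrable_test lu tp; have iv := loc_integrable_test lv tp.
have iG := loc_integrable_test (lG i) tphi; have iH := loc_integrable_test (lH i) tphi.
under eq_Rintegral do rewrite mulrDl -mulrA.
rewrite RintegralD ?RintegralZl//; last exact: iZ.
under [in RHS]eq_Rintegral do rewrite !mxE mulrDl -mulrA.
rewrite RintegralD ?RintegralZl//; last exact: iZ.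
by rewrite uG// vH// opprD mulrN.
Qed.

(** Integration by parts is the product rule for [phi * psi] together with the vanishing integral of
    its partial derivatives. *)
Lemma test_weak_gradient phi : test_function Om phi -> weak_gradient Om phi (gradient phi).
Proof.
move=> tphi; split; first exact: test_loc_integrable.
  move=> i; have := test_loc_integrable (test_partial i tphi).
  by congr loc_integrable; apply/funext => x; rewrite mxE.
move=> psi i tpsi; apply/eqP; rewrite -subr_eq0 opprK; apply/eqP.
have [sphi _] := tphi; have [spsi _] := tpsi.
have tM := test_functionM sphi tpsi.
rewrite -RintegralD//; last 2 first.
- by apply: loc_integrable_test; [exact: test_loc_integrable|exact: test_partial].
- under eq_fun do rewrite mxE.
  by apply: loc_integrable_test => //; apply: test_loc_integrable; exact: test_partial.
have := Rintegral_partial0 i tM; rewrite partialM; last 2 first.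
- by move=> x; exact: test_differentiable tphi.
- by move=> x; exact: test_differentiable tpsi.
move=> <-; apply: eq_Rintegral => x _ /=; by rewrite mxE [partial i phi x * _]mulrC.
Qed.

Lemma grad_weak_gradient u G : weak_gradient Om u G -> weak_gradient Om u (grad Om u).
Proof. by move=> uG; rewrite /grad; case: xgetP => [H -> //|/(_ G)]. Qed.

Lemma weak_gradient_measurable u G : weak_gradient Om u G ->
  measurable_fun Om (fun x => enorm (G x)).
Proof. by move=> [_ lG _]; apply: measurable_coords_enorm => // i; have [] := lG i. Qed.

(** [grad] is an arbitrary choice among weak gradients; almost everywhere uniqueness allows its norm
    to be computed with whichever one is at hand. *)
Lemma grad_normE s u G : (0 < s)%E -> weak_gradient Om u G ->
  grad_norm Om s u = normL Om s (fun x => enorm (G x)).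
Proof.
move=> s0 uG; have ug := grad_weak_gradient uG.
apply: (eq_normL mO s0 (weak_gradient_measurable ug) (weak_gradient_measurable uG)).
by apply: filterS (weak_gradient_unique ug uG) => x h /h /= ->.
Qed.

End weak_gradients.

(** * Morrey's inequality with explicit constant *)

Section riemann_power_sum.
Context {R : realType}.

Lemma powR_antitone (a x y : R) : 0 <= a -> 0 < x -> x <= y -> y `^ (- a) <= x `^ (- a).
Proof.
move=> a0 x0 xy; have y0 : 0 < y by exact: lt_le_trans xy.
rewrite !powRN lef_pV2 ?posrE ?powR_gt0//.
by rewrite ge0_ler_powR// nnegrE ltW.
Qed.

(* Replaces the integral of [t^(-a)] over [[0, 1]]. *)
Lemma sum_powR_le (a : R) (m : nat) : 0 <= a -> a < 1 ->
  \sum_(i < m) (i.+1%:R : R) `^ (- a) <= m%:R `^ (1 - a) / (1 - a).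
Proof.
move=> a0 a1; have b0 : 0 < 1 - a by rewrite subr_gt0.
elim: m => [|m IH]; first by rewrite big_ord0 divr_ge0 ?powR_ge0// ltW.
rewrite big_ord_recr/=; apply: (@le_trans _ _ (m%:R `^ (1 - a) / (1 - a) + m.+1%:R `^ (- a))).
  by rewrite lerD2r.
rewrite -(ler_pM2r b0) mulrDl !divfK ?gt_eqF//.
(* The first term is treated apart, since [t^(1 - a)] need not be differentiable at [0]. *)
case: m {IH} => [|m].
  by rewrite powR0 ?gt_eqF// add0r !powR1 mul1r gerBl.
have m0 : 0 < m.+1%:R :> R by [].
have mm : m.+1%:R < m.+2%:R :> R by rewrite ltr_nat.
have dp (x : R) : x \in `]m.+1%:R, m.+2%:R[ ->
    is_derive x 1 (@powR R ^~ (1 - a)) ((1 - a) * x `^ (1 - a - 1)).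
  by rewrite in_itv/= => /andP[x0 _]; apply: is_derive1_powR; exact: lt_trans x0.
(* The increment of [t^(1 - a)] is [(1 - a) c^(-a)] with [c] below the right end, hence at least
   [1 - a] times the new term of the sum. *)
have [|c] := MVT mm dp.
  apply: derivable_within_continuous => x; rewrite in_itv/= => /andP[x0 _].
  by apply: ex_derive; apply: is_derive1_powR; exact: lt_le_trans x0.
rewrite in_itv/= => /andP[c1 c2]; rewrite -[m.+2%:R - m.+1%:R]natrB// subSnn mulr1 => h.
rewrite addrC -lerBrDr h mulrC ler_pM2l//.
rewrite (_ : 1 - a - 1 = - a); last by lra.
by apply: powR_antitone => //; [exact: lt_trans c1|exact: ltW].
Qed.

Lemma riemann_powR_le (a : R) (m : nat) : 0 <= a -> a < 1 ->
  \sum_(i < m.+1) m.+1%:R^-1 * (i.+1%:R / m.+1%:R : R) `^ (- a) <= (1 - a)^-1.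
Proof.
move=> a0 a1; have m0 : 0 < m.+1%:R :> R by [].
under eq_bigr do rewrite powRM ?invr_ge0// mulrCA.
rewrite -mulr_suml -powR_inv1// -powRrM mulN1r opprK -powRD; last first.
  by rewrite (gt_eqF m0) implybT.
apply: (@le_trans _ _ (m.+1%:R `^ (1 - a) / (1 - a) * m.+1%:R `^ (-1 + a))).
  by rewrite ler_wpM2r ?powR_ge0// sum_powR_le.
rewrite mulrAC -powRD; last by rewrite (gt_eqF m0) implybT.
by rewrite (_ : 1 - a + (-1 + a) = 0) ?powRr0 ?mul1r//; lra.
Qed.

End riemann_power_sum.

Section morrey.
Context {R : realType} {n : nat} (Om : set 'rV[R]_n).
Local Notation mu := (lebesgue_measure_rV R n).
Hypotheses (oO : open Om) (bO : bounded_set Om).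
Variable p : R.
Hypothesis n0 : (0 < n)%N.
Hypothesis np : n%:R < p.

Let mO : measurable Om := measurable_open_rV oO.
Let fO : (mu Om < +oo)%E := domain_measure_lty oO bO.
Let p0 : 0 < p. Proof. exact: le_lt_trans np. Qed.
Let p1 : 1 <= p.
Proof. by apply: le_trans (ltW np); rewrite ler1n. Qed.
Let a01 : 0 <= n%:R / p < 1.
Proof. by rewrite divr_ge0 ?(ltW p0)//= ltr_pdivrMr// mul1r. Qed.

(* Tends to [d + n s] as [p -> oo], hence to [d] as then [s -> 0]. *)
Definition morrey_const (s d : R) : R :=
  (d + n%:R * s) * s `^ (- (n%:R / p)) / (1 - n%:R / p).

Lemma morrey_const_ge0 (s d : R) : 0 <= s -> 0 <= d -> 0 <= morrey_const s d.
Proof.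
move=> s0 d0; rewrite /morrey_const !mulr_ge0 ?powR_ge0 ?addr_ge0 ?mulr_ge0//.
by have /andP[_ /ltW] := a01; rewrite invr_ge0 subr_ge0.
Qed.

Section test.
Variable phi : 'rV[R]_n -> R.
Hypothesis tphi : test_function Om phi.
Let g z := enorm (gradient phi z).

Let cg : continuous g.
Proof.
move=> z; apply: (@continuous_comp 'rV[R]_n 'rV[R]_n R (gradient phi) (@enorm R n)); last exact: continuous_enorm.
have [L L0 HL] := test_gradient_lipschitz tphi.
have C0 : 0 < L * n%:R + 1 by rewrite ltr_wpDl// mulr_ge0.
apply/(@cvgrPdist_le _ _ _ (nbhs z)) => e e0; near=> w.
apply: le_trans (ler_norm_enorm _) _; apply: le_trans (HL _ _) _.
apply: (@le_trans _ _ ((L * n%:R + 1) * `|z - w|)).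
  apply: (@le_trans _ _ (L * (n%:R * `|z - w|))); first by rewrite ler_wpM2l// ler_enorm_norm.
  by rewrite mulrA ler_wpM2r// lerDl.
rewrite -ler_pdivlMl// mulrC; near: w.
by apply: cvgr_dist_le => //; exact: divr_gt0.
Unshelve. all: by end_near. Qed.

Let mg (D : set 'rV[R]_n) : measurable_fun D g.
Proof. by apply: measurable_funTS; exact: (continuous_measurable_rV cg). Qed.

Lemma test_grad_normL_fin : normL Om p%:E g \is a fin_num.
Proof.
have [M _ HM] := test_gradient_bounded tphi.
have [_ h] := memL_bounded mO fO p0 (mg (D := Om)) (fun x _ => (ltac:(rewrite ger0_norm ?enorm_ge0//; exact: HM) : `|g x| <= M)).
by rewrite ge0_fin_numE// normL_ge0.
Qed.

Let gam := fine (normL Om p%:E g).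
Let gamE : normL Om p%:E g = gam%:E. Proof. by rewrite fineK// test_grad_normL_fin. Qed.
Let gam0 : 0 <= gam. Proof. by rewrite fine_ge0// normL_ge0. Qed.

Let g_out z : ~ Om z -> g z = 0.
Proof.
move=> Oz; rewrite /g (_ : gradient phi z = 0) ?enorm0//.
by apply/rowP => i; rewrite !mxE; apply: test_function_out Oz; exact: test_partial.
Qed.

Let int_g : (\int[mu]_z (g z `^ p)%:E = (gam `^ p)%:E)%E.
Proof.
have := normL_powR Om g p0; rewrite gamE poweR_EFin => ->.
rewrite [RHS]integral_mkcond; apply: eq_integral => z _; rewrite /patch.
case: ifPn => [_|/negP Oz]; first by rewrite ger0_norm ?enorm_ge0.
rewrite g_out; first by rewrite powR0// gt_eqF.
by move=> Oz'; apply: Oz; exact: mem_set.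
Qed.

Section cube.
Variables (c x : 'rV[R]_n) (s d : R).
Hypotheses (s0 : 0 < s).
Let Q : set 'rV[R]_n := cbox (c - const_mx (s / 2)) (c + const_mx (s / 2)).
Hypothesis Qd : forall z, Q z -> enorm (z - x) <= d.

Let mQ : measurable Q. Proof. exact: measurable_cbox. Qed.
Let muQ : mu Q = (s ^+ n)%:E.
Proof.
rewrite lebesgue_measure_cbox; last by move=> i; rewrite !mxE; have := s0; lra.
congr EFin; rewrite -[in RHS](card_ord n) -prodr_const; apply: eq_bigr => i _.
by rewrite !mxE; lra.
Qed.
Let fQ : (mu Q < +oo)%E. Proof. by rewrite muQ ltry. Qed.

Let seg (t : R) z := x + t *: (z - x).

Let segE t z : seg t z = affine ((1 - t) *: x) t z.
Proof. by rewrite /seg /affine scalerBr scalerBl scale1r addrCA addrC. Qed.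

Let mgseg t (D : set 'rV[R]_n) : measurable_fun D (fun z => g (seg t z)).
Proof.
under eq_fun do rewrite segE; apply: measurable_funTS; apply: continuous_measurable_rV => z.
apply: (@continuous_comp 'rV[R]_n 'rV[R]_n R (affine _ t) g); last exact: cg.
exact: continuous_affine.
Qed.

Let igseg t : mu.-integrable Q (EFin \o (fun z => g (seg t z))).
Proof.
have [M _ HM] := test_gradient_bounded tphi.
apply: (bounded_integrable_rV mQ fQ (M := M)) => // z _.
by rewrite ger0_norm ?enorm_ge0//; exact: HM.
Qed.

(** Hoelder's inequality on [Q] raises the exponent to [p] and leaves the factor [s^(n (1 - 1/p))];
    the homothety of ratio [t] centred at [x] then contributes [t^(-n/p)]. The homothetic cube may
    leave [Om], but the gradient vanishes there, so its [p]-th power has integral [gam^p] over the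
    whole space. *)
Lemma cube_integral_gradient t : 0 < t ->
  \int[mu]_(z in Q) g (seg t z) <= s ^+ n * (s * t) `^ (- (n%:R / p)) * gam.
Proof.
move=> t0.
have := normL_hoelder mQ ltr01 p1 (mgseg t (D := Q)).
rewrite (normL_int Q _ ltr01) invr1 poweRe1; last first.
  by rewrite integral_ge0// => z _; rewrite lee_fin powR_ge0.
have -> : (\int[mu]_(z in Q) (`|g (seg t z)| `^ 1)%:E = (\int[mu]_(z in Q) g (seg t z))%:E)%E.
  rewrite /Rintegral fineK; last by apply: integrable_fin_num => //; exact: igseg.
  by apply: eq_integral => z _; rewrite powRr1// ger0_norm ?enorm_ge0.
have h2 : (normL Q p%:E (fun z => g (seg t z)) <= (t `^ (- (n%:R / p)) * gam)%:E)%E.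
  rewrite (normL_int Q _ p0).
  have -> : t `^ (- (n%:R / p)) * gam = (t ^- n * gam `^ p) `^ p^-1.
    rewrite powRM ?powR_ge0// ?invr_ge0 ?exprn_ge0 ?ltW// -powRrM mulfV ?gt_eqF// powRr1//.
    by rewrite -powR_invn ?ltW// -powRrM mulNr.
  rewrite -poweR_EFin; apply: gt0_ler_poweR; first by rewrite invr_ge0 ltW.
    exact: powR_integral_itv.
    by rewrite in_itv/= leey andbT lee_fin mulr_ge0 ?powR_ge0// invr_ge0 exprn_ge0// ltW.
  have tn0 : t ^+ n != 0 by rewrite expf_neq0// gt_eqF.
  have mgp (D : set 'rV[R]_n) : measurable_fun D (fun z => (g z `^ p)%:E).
    apply/measurable_EFinP; apply: (@measurableT_comp _ _ _ _ _ _ (@powR R ^~ p)) => //.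
  have E : ((gam `^ p)%:E = (t ^+ n)%:E * \int[mu]_z (g (affine ((1 - t) *: x) t z) `^ p)%:E)%E.
    rewrite -int_g; apply: (@ge0_integral_affine _ _ ((1 - t) *: x) t setT) => // z _.
    by rewrite lee_fin powR_ge0.
  apply: (@le_trans _ _ (\int[mu]_z (g (affine ((1 - t) *: x) t z) `^ p)%:E)%E).
    rewrite [leLHS](_ : _ = \int[mu]_(z in Q) (g (affine ((1 - t) *: x) t z) `^ p)%:E)%E; last first.
      by apply: eq_integral => z _; rewrite segE ger0_norm ?enorm_ge0.
    apply: ge0_subset_integral; [exact: mQ|exact: measurableT| | |by []].
    - apply/measurable_EFinP; apply: (@measurableT_comp _ _ _ _ _ _ (@powR R ^~ p)) => //.
      have := @mgseg t setT; by under eq_fun do rewrite segE.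
    - by move=> z _; rewrite lee_fin powR_ge0.
  by rewrite mulrC EFinM E muleAC -EFinM mulfV// mul1e.
move=> h; rewrite -lee_fin; apply: le_trans h _.
apply: (@le_trans _ _ ((t `^ (- (n%:R / p)) * gam)%:E * (mu Q `^ (1 - p^-1)))%E).
  by rewrite lee_wpmul2r// poweR_ge0.
rewrite muQ poweR_EFin -EFinM lee_fin.
have -> : (s ^+ n) `^ (1 - p^-1) = s ^+ n * s `^ (- (n%:R / p)).
  rewrite -powR_mulrn ?ltW// -powRrM -powRD; last by rewrite (gt_eqF s0) implybT.
  by congr (_ `^ _); ring.
by rewrite (powRM _ (ltW s0) (ltW t0)) le_eqVlt; apply/orP; left; apply/eqP; ring.
Qed.

Let cphiseg t : continuous (fun z => phi (seg t z)).
Proof.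
under eq_fun do rewrite segE; move=> z.
apply: (@continuous_comp 'rV[R]_n 'rV[R]_n R (affine _ t) phi); first exact: continuous_affine.
exact: (test_continuous tphi).
Qed.

Let iosc t : mu.-integrable Q (EFin \o (fun z => `|phi (seg t z) - phi x|)).
Proof.
have [M HM] := test_bounded tphi.
apply: (bounded_integrable_rV mQ fQ (M := M + M)).
  apply: measurable_funTS; apply: measurableT_comp => //.
  by apply: measurable_funB => //; exact: (continuous_measurable_rV (@cphiseg t)).
by move=> z _; rewrite normr_id (le_trans (ler_normB _ _))// lerD.
Qed.

Let d0 : 0 <= d.
Proof.
apply: le_trans (enorm_ge0 (c - x)) (Qd _) => i; rewrite !mxE; have := s0; lra.
Qed.

(* One step along the segments from [x]; telescoping [M.+1] of them avoids a Fubini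
   argument, and the error due to the variation of the gradient is [O(1 / M)]. *)
Lemma cube_oscillation_step (L : R) (k M : nat) : 0 <= L ->
  (forall x y, enorm (gradient phi y - gradient phi x) <= L * enorm (y - x)) ->
  \int[mu]_(z in Q) `|phi (seg (k.+1%:R / M.+1%:R) z) - phi x| <=
  \int[mu]_(z in Q) `|phi (seg (k%:R / M.+1%:R) z) - phi x| +
  d / M.+1%:R * (\int[mu]_(z in Q) g (seg (k.+1%:R / M.+1%:R) z) + L * (d / M.+1%:R) * s ^+ n).
Proof.
move=> L0 HL; set t' := k.+1%:R / _; set t := k%:R / _; set h := M.+1%:R^-1.
have h0 : 0 < h by rewrite invr_gt0.
have tt' : t = t' - h by rewrite /t /t' -(natr1 k) mulrDl mul1r addrK.
have ptw z : Q z -> `|phi (seg t' z) - phi x| <=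
    `|phi (seg t z) - phi x| + d * h * (g (seg t' z) + L * (d * h)).
  move=> Qz; rewrite -[phi (seg t' z) - _](subrKA (phi (seg t z))) [X in `|X|]addrC.
  apply: le_trans (ler_normD _ _) _; rewrite lerD2l distrC.
  pose v := - h *: (z - x).
  have -> : seg t z = seg t' z + v by rewrite /seg /v -addrA -scalerDl -tt'.
  have ev : enorm v <= d * h.
    by rewrite /v enormZ normrN gtr0_norm// mulrC ler_pM2r// Qd.
  have [u /andP[u0 u1]] := mean_value_rV (seg t' z) v (fun y => test_differentiable y tphi).
  move=> ->; apply: le_trans (cauchy_schwarz_enorm _ _) _.
  apply: ler_pM; rewrite ?enorm_ge0//.
  rewrite -[gradient phi _](subrK (gradient phi (seg t' z))) addrC.
  apply: le_trans (ler_enormD _ _) _; rewrite lerD2l.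
  apply: le_trans (HL _ _) _; rewrite ler_wpM2l// addrAC subrr add0r enormZ ger0_norm//.
  by apply: le_trans ev; rewrite ler_piMl ?enorm_ge0.
have icst (C : R) : mu.-integrable Q (EFin \o (fun=> C)).
  by apply: (bounded_integrable_rV mQ fQ (M := `|C|)).
have i1 : mu.-integrable Q (EFin \o (fun z => g (seg t' z) + L * (d * h))).
  exact: (integrableD mQ (igseg t') (icst _)).
have i2 : mu.-integrable Q (EFin \o (fun z => d * h * (g (seg t' z) + L * (d * h)))).
  exact: (integrableZl mQ (d * h) i1).
apply: le_trans (le_Rintegral mQ (iosc t') (integrableD mQ (iosc t) i2) ptw) _.
have -> : s ^+ n = fine (mu Q) by rewrite muQ.
by rewrite RintegralD// lerD2l RintegralZl// RintegralD// Rintegral_cst.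
Qed.

(** The telescoped steps produce a Riemann sum of [t^(-n/p)], bounded by [1 / (1 - n/p)] because
    [n < p]. The accumulated error is [L d^2 s^n / (M + 1)], and [M] is arbitrary. *)
Lemma cube_oscillation :
  \int[mu]_(z in Q) `|phi z - phi x| <=
  s ^+ n * (d * s `^ (- (n%:R / p)) / (1 - n%:R / p)) * gam.
Proof.
have [L L0 HL] := test_gradient_lipschitz tphi.
have /andP[a0 a1] := a01.
have key (M : nat) : \int[mu]_(z in Q) `|phi z - phi x| <=
    s ^+ n * (d * s `^ (- (n%:R / p)) / (1 - n%:R / p)) * gam + L * d ^+ 2 * s ^+ n / M.+1%:R.
  have M0 : 0 < M.+1%:R :> R by [].
  have step (k : nat) : \int[mu]_(z in Q) `|phi (seg (k%:R / M.+1%:R) z) - phi x| <=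
      d * s ^+ n * s `^ (- (n%:R / p)) * gam *
        (\sum_(i < k) M.+1%:R^-1 * (i.+1%:R / M.+1%:R) `^ (- (n%:R / p))) +
      k%:R * (d / M.+1%:R * (L * (d / M.+1%:R) * s ^+ n)).
    elim: k => [|k IH].
      rewrite big_ord0 !mul0r mulr0 addr0.
      under eq_Rintegral do rewrite /seg scale0r addr0 subrr normr0.
      by rewrite Rintegral_cst// mul0r.
    apply: le_trans (cube_oscillation_step k M L0 HL) _.
    have kM : 0 < k.+1%:R / M.+1%:R :> R by rewrite divr_gt0.
    have h := cube_integral_gradient kM.
    have h' : d / M.+1%:R * \int[mu]_(z in Q) g (seg (k.+1%:R / M.+1%:R) z) <=
        d / M.+1%:R * (s ^+ n * (s * (k.+1%:R / M.+1%:R)) `^ (- (n%:R / p)) * gam).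
      by rewrite ler_wpM2l// divr_ge0.
    apply: le_trans (lerD IH (lexx _)) _; rewrite mulrDr.
    apply: le_trans (lerD (lexx _) (lerD h' (lexx _))) _.
    rewrite big_ord_recr/= powRM ?(ltW s0) ?(ltW kM)// -(natr1 k).
    by rewrite le_eqVlt; apply/orP; left; apply/eqP; ring.
  have := step M.+1; rewrite divff ?gt_eqF//.
  under eq_Rintegral do rewrite /seg scale1r [x + _]addrC subrK.
  move=> h; apply: le_trans h _; apply: lerD; last first.
    by rewrite le_eqVlt; apply/orP; left; apply/eqP; field; rewrite gt_eqF.
  have C0 : 0 <= d * s ^+ n * s `^ (- (n%:R / p)) * gam.
    by rewrite !mulr_ge0 ?powR_ge0 ?exprn_ge0// ltW.
  apply: le_trans (ler_wpM2l C0 (riemann_powR_le M a0 a1)) _.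
  by rewrite le_eqVlt; apply/orP; left; apply/eqP; ring.
apply/ler_addgt0Pr => e e0.
have C0 : 0 <= L * d ^+ 2 * s ^+ n by rewrite !mulr_ge0 ?exprn_ge0// ltW.
pose M := Num.truncn (L * d ^+ 2 * s ^+ n / e).
apply: le_trans (key M) _; rewrite lerD2l ler_pdivrMr// [e * _]mulrC -ler_pdivrMr//.
exact/ltW/Num.Theory.truncnS_gt.
Qed.

End cube.

(** Averages over the cube of side [s] centred at the midpoint of [x] and [y]. All its points are
    within [(|x - y| + n s) / 2] of both, so the two oscillations add up to the factor
    [|x - y| + n s]; centring the cube elsewhere would spoil the sharp leading term [|x - y|]. *)
Lemma morrey_test x y (s : R) : 0 < s ->
  `|phi x - phi y| <= morrey_const s (enorm (x - y)) * gam.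
Proof.
move=> s0; have /andP[a0 a1] := a01.
pose c := 2^-1 *: (x + y); pose d := 2^-1 * (enorm (x - y) + n%:R * s).
pose Q : set 'rV[R]_n := cbox (c - const_mx (s / 2)) (c + const_mx (s / 2)).
have mQ : measurable Q by exact: measurable_cbox.
have muQ : mu Q = (s ^+ n)%:E.
  rewrite lebesgue_measure_cbox; last by move=> i; rewrite !mxE; lra.
  congr EFin; rewrite -[in RHS](card_ord n) -prodr_const; apply: eq_bigr => i _.
  by rewrite !mxE; lra.
have Qc z : Q z -> enorm (z - c) <= 2^-1 * (n%:R * s).
  move=> Qz; rewrite mulrCA; apply: ler_enorm_coord; last by lra.
  by move=> i; have := Qz i; rewrite !mxE ler_norml => /andP[h1 h2]; apply/andP; split; lra.
have Qx z : Q z -> enorm (z - x) <= d.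
  move=> /Qc h; apply: le_trans (ler_enorm_trans c _ _) _.
  rewrite (_ : c - x = - 2^-1 *: (x - y)); last by apply/rowP => i; rewrite !mxE; lra.
  by rewrite enormZ normrN gtr0_norm// /d mulrDr addrC lerD2l.
have Qy z : Q z -> enorm (z - y) <= d.
  move=> /Qc h; apply: le_trans (ler_enorm_trans c _ _) _.
  rewrite (_ : c - y = 2^-1 *: (x - y)); last by apply/rowP => i; rewrite !mxE; lra.
  by rewrite enormZ gtr0_norm// /d mulrDr addrC lerD2l.
have hx := cube_oscillation s0 Qx; have hy := cube_oscillation s0 Qy.
have fQ : (mu Q < +oo)%E by rewrite muQ ltry.
have io w : mu.-integrable Q (EFin \o (fun z => `|phi z - phi w|)).
  have [M HM] := test_bounded tphi.
  apply: (bounded_integrable_rV mQ fQ (M := M + M)).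
    apply: measurable_funTS; apply: measurableT_comp => //.
    by apply: measurable_funB => //; exact: (continuous_measurable_rV (test_continuous tphi)).
  by move=> z _; rewrite normr_id (le_trans (ler_normB _ _))// lerD.
have sn : 0 < s ^+ n by rewrite exprn_gt0.
have : `|phi x - phi y| * s ^+ n <= \int[mu]_(z in Q) (`|phi z - phi x| + `|phi z - phi y|).
  rewrite (_ : s ^+ n = fine (mu Q)); last by rewrite muQ.
  rewrite -Rintegral_cst//; apply: le_Rintegral => //.
  - by apply: (bounded_integrable_rV mQ fQ (M := `|phi x - phi y|)) => // z _; rewrite normr_id.
  - exact: (integrableD mQ (io x) (io y)).
  - by move=> z _; rewrite (distrC (phi z)); exact: ler_distD.
rewrite RintegralD// => h; rewrite -(ler_pM2r sn).
apply: le_trans h (le_trans (lerD hx hy) _).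
rewrite /morrey_const /d le_eqVlt; apply/orP; left; apply/eqP.
by set C := (1 - _)^-1; field.
Qed.

End test.
End morrey.

Lemma lt0_le1 {R : realType} (p : R) : 1 <= p -> 0 < p.
Proof. exact: lt_le_trans. Qed.

(** * Sobolev spaces *)

Section sobolev_spaces.
Context {R : realType} {n : nat} (Om : set 'rV[R]_n).
Local Notation mu := (lebesgue_measure_rV R n).
Hypotheses (oO : open Om) (bO : bounded_set Om).
Implicit Types (u v w phi : 'rV[R]_n -> R) (G : 'rV[R]_n -> 'rV[R]_n) (p q : R).

Let mO : measurable Om := measurable_open_rV oO.
Let fO : (mu Om < +oo)%E := domain_measure_lty oO bO.

Lemma enorm_le_sum (x : 'rV[R]_n) : enorm x <= \sum_i `|x 0 i|.
Proof.
rewrite -(@ler_pXn2r _ 2)// ?nnegrE ?enorm_ge0 ?sumr_ge0// sqr_enorm.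
rewrite expr2 mulr_suml; apply: ler_sum => i _.
rewrite -real_normK ?num_real// expr2 ler_wpM2l//.
by rewrite (bigD1 i)//= lerDl sumr_ge0.
Qed.

Lemma normL_enorm_le_sum p G : 1 <= p -> (forall i, measurable_fun Om (fun x => G x 0 i)) ->
  (normL Om p%:E (fun x => enorm (G x)) <= \sum_i normL Om p%:E (fun x => G x ord0 i))%E.
Proof.
move=> p1 mG; have p0 := lt0_le1 p1.
have H (s : seq 'I_n) : (normL Om p%:E (fun x => (\sum_(i <- s) `|G x ord0 i|)%R) <=
    \sum_(i <- s) normL Om p%:E (fun x => G x ord0 i))%E.
  elim: s => [|i s IH].
    under eq_fun do rewrite big_nil.
    by rewrite normL_cst// mul0e big_nil.
  under eq_fun do rewrite big_cons.
  rewrite big_cons; apply: le_trans (normLD mO p1 _ _) _.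
  - exact: measurableT_comp.
  - by apply: measurable_sum => j; exact: measurableT_comp.
  - by rewrite normL_normr leeD2l.
apply: le_trans (H _); apply: le_normL => //; first exact: measurable_coords_enorm.
  by apply: measurable_sum => j; exact: measurableT_comp.
apply/nearW => x _; rewrite !ger0_norm ?enorm_ge0 ?sumr_ge0//; exact: enorm_le_sum.
Qed.

Lemma normL_enorm_lty p G : 1 <= p -> (forall i, memL Om p%:E (fun x => G x 0 i)) ->
  (normL Om p%:E (fun x => enorm (G x)) < +oo)%E.
Proof.
move=> p1 LG; apply: le_lt_trans (normL_enorm_le_sum p1 _) _.
  by move=> i; have [] := LG i.
by apply: lte_sum_pinfty => i _; have [] := LG i.
Qed.

Lemma sobolevE p u : 1 <= p -> sobolev Om p%:E u ->
  [/\ measurable_fun Om u, (normL Om p%:E u < +oo)%E, weak_gradient Om u (grad Om u) &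
      (grad_norm Om p%:E u < +oo)%E].
Proof.
move=> p1 [[mu_ Lu] [G uG LG]]; split => //; first exact: grad_weak_gradient uG.
rewrite (grad_normE oO _ uG) ?lte_fin ?lt0_le1//; exact: normL_enorm_lty.
Qed.

Lemma sobolevI p u G : 1 <= p -> memL Om p%:E u -> weak_gradient Om u G ->
  (normL Om p%:E (fun x => enorm (G x)) < +oo)%E -> sobolev Om p%:E u.
Proof.
move=> p1 Lu uG Goo; split => //; exists G => // i; have [_ lG _] := uG.
split; first by have [] := lG i.
apply: le_lt_trans Goo; apply: normL_coord_le => //; first by rewrite lte_fin lt0_le1.
by move=> j; have [] := lG j.
Qed.

Lemma test_sobolev p phi : 1 <= p -> test_function Om phi -> sobolev Om p%:E phi.
Proof.
move=> p1 tphi; have p0 := lt0_le1 p1; have [M HM] := test_bounded tphi.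
have wg := test_weak_gradient oO bO tphi.
apply: (sobolevI p1 _ wg).
  apply: (memL_bounded mO fO p0 (M := M)) => //.
  by have [[]] := wg.
have [C _ HC] := test_gradient_bounded tphi.
have [] // := @memL_bounded _ _ Om mO fO p (fun x => enorm (gradient phi x)) C p0.
  exact: (weak_gradient_measurable oO wg).
by move=> x _; rewrite ger0_norm ?enorm_ge0.
Qed.

Lemma grad_norm_lin p (a : R) u v : 1 <= p -> sobolev Om p%:E u -> sobolev Om p%:E v ->
  (grad_norm Om p%:E (fun x => a * u x + v x)%R <=
   `|a|%:E * grad_norm Om p%:E u + grad_norm Om p%:E v)%E.
Proof.
move=> p1 su sv; have p0 := lt0_le1 p1.
have [mu_ Lu gu Gu] := sobolevE p1 su; have [mv Lv gv Gv] := sobolevE p1 sv.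
rewrite (grad_normE oO _ (weak_gradientD oO a gu gv)) ?lte_fin//.
have [_ lu _] := gu; have [_ lv _] := gv.
apply: le_trans (@normL_enormD _ _ _ mO p (fun x => a *: grad Om u x) (grad Om v) p1 _ _) _.
- move=> i; under eq_fun do rewrite mxE; apply: measurable_funM => //.
  by have [] := lu i.
- by move=> i; have [] := lv i.
apply: leeD => //; under eq_fun do rewrite enormZ.
rewrite normLZ ?normr_id//; exact: (weak_gradient_measurable oO gu).
Qed.

Lemma normL_lin p (a : R) u v : 1 <= p -> measurable_fun Om u -> measurable_fun Om v ->
  (normL Om p%:E (fun x => a * u x + v x)%R <=
   `|a|%:E * normL Om p%:E u + normL Om p%:E v)%E.
Proof.
move=> p1 mu_ mv; have p0 := lt0_le1 p1.
by rewrite -normLZ//; apply: (normLD mO p1) => //; exact: measurable_funM.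
Qed.

Lemma lin_lty (a : R) (x y : \bar R) : (0 <= x)%E -> (x < +oo)%E -> (y < +oo)%E ->
  (`|a|%:E * x + y < +oo)%E.
Proof.
by move=> x0 xoo yoo; rewrite lte_add_pinfty// lte_mul_pinfty// lee_fin.
Qed.

Lemma sobolev_lin p (a : R) u v : 1 <= p -> sobolev Om p%:E u -> sobolev Om p%:E v ->
  sobolev Om p%:E (fun x => a * u x + v x).
Proof.
move=> p1 su sv; have p0 := lt0_le1 p1.
have [mu_ Lu gu Gu] := sobolevE p1 su; have [mv Lv gv Gv] := sobolevE p1 sv.
apply: (sobolevI p1 _ (weak_gradientD oO a gu gv)).
  split; first by apply: measurable_funD => //; exact: measurable_funM.
  apply: le_lt_trans (normL_lin a p1 mu_ mv) _.
  exact: lin_lty (normL_ge0 _ _ _) Lu Lv.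
have := grad_norm_lin a p1 su sv.
rewrite (grad_normE oO _ (weak_gradientD oO a gu gv)) ?lte_fin//.
move=> /le_lt_trans; apply; exact: lin_lty (normL_ge0 _ _ _) Gu Gv.
Qed.

Lemma sobolev_norm_lin p (a : R) u v : 1 <= p -> sobolev Om p%:E u -> sobolev Om p%:E v ->
  (sobolev_norm Om p%:E (fun x => a * u x + v x)%R <=
   `|a|%:E * sobolev_norm Om p%:E u + sobolev_norm Om p%:E v)%E.
Proof.
move=> p1 su sv; have [mu_ Lu _ _] := sobolevE p1 su; have [mv Lv _ _] := sobolevE p1 sv.
rewrite /sobolev_norm muleDr ?ge0_adde_def ?inE ?normL_ge0//.
rewrite addeACA; apply: leeD; [exact: normL_lin|exact: grad_norm_lin].
Qed.

Lemma sobolev_norm_ge0 p u : (0 <= sobolev_norm Om p%:E u)%E.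
Proof. by rewrite adde_ge0// normL_ge0. Qed.

Lemma sobolevB p u v : 1 <= p -> sobolev Om p%:E u -> sobolev Om p%:E v ->
  sobolev Om p%:E (u \- v).
Proof.
move=> p1 su sv; have := sobolev_lin (-1) p1 sv su.
by congr sobolev; apply/funext => x /=; rewrite mulN1r addrC.
Qed.

Lemma sobolev_norm0 p : 1 <= p -> sobolev_norm Om p%:E (fun _ : 'rV[R]_n => 0) = 0%E.
Proof.
move=> p1; have p0 := lt0_le1 p1; have wg := test_weak_gradient oO bO (test_function0 Om).
rewrite /sobolev_norm (grad_normE oO _ wg) ?lte_fin//.
have -> : (fun x => enorm (gradient (fun _ : 'rV[R]_n => 0 : R) x)) = fun=> 0.
  apply/funext => x; rewrite (_ : gradient _ x = 0) ?enorm0//.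
  by apply/rowP => i; rewrite !mxE partial_cst.
by rewrite normL_cst// mul0e adde0.
Qed.

Lemma sobolev0_test p phi : 1 <= p -> test_function Om phi -> sobolev0 Om p phi.
Proof.
move=> p1 tphi; split; first exact: test_sobolev.
move=> e e0; exists phi => //.
have -> : (phi \- phi)%R = (fun=> 0) by apply/funext => x /=; rewrite subrr.
by rewrite sobolev_norm0.
Qed.

Lemma sobolev0_lin p (a : R) u v : 1 <= p -> sobolev0 Om p u -> sobolev0 Om p v ->
  sobolev0 Om p (fun x => a * u x + v x).
Proof.
move=> p1 [su au] [sv av]; split; first exact: sobolev_lin.
move=> e e0; have a0 : 0 < `|a| + 1 by rewrite ltr_wpDl.
have e20 : 0 < e / 2 by exact: divr_gt0.
have [phi tphi phiu] := au (e / 2 / (`|a| + 1)) (divr_gt0 e20 a0).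
have [psi tpsi psiv] := av (e / 2) e20.
exists (fun x => a * phi x + psi x).
  exact: (test_functionD (test_functionZ a tphi) tpsi).
have -> : ((fun x => a * u x + v x) \- (fun x => a * phi x + psi x))%R =
   (fun x => a * (u \- phi) x + (v \- psi) x)%R by apply/funext => x /=; ring.
have sphi := test_sobolev p1 tphi; have spsi := test_sobolev p1 tpsi.
apply: le_lt_trans (sobolev_norm_lin a p1 (sobolevB p1 su sphi) (sobolevB p1 sv spsi)) _.
rewrite [e in (_ < e%:E)%E]splitr EFinD; apply: lee_ltD => //.
  by rewrite ge0_fin_numE ?mule_ge0 ?sobolev_norm_ge0 // lte_mul_pinfty ?lee_fin ?sobolev_norm_ge0 // (lt_trans phiu)// ltry.
apply: (@le_trans _ _ (`|a|%:E * (e / 2 / (`|a| + 1))%:E)%E).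
  by rewrite lee_wpmul2l// ltW.
rewrite -EFinM lee_fin mulrCA ler_piMr//; first by rewrite divr_ge0// ltW.
by rewrite ler_pdivrMr// mul1r lerDl.
Qed.

Lemma sobolev0_0 p : 1 <= p -> sobolev0 Om p (fun=> 0).
Proof. by move=> p1; apply: sobolev0_test => //; exact: test_function0. Qed.

Lemma sobolev0Z p (a : R) u : 1 <= p -> sobolev0 Om p u -> sobolev0 Om p (fun x => a * u x).
Proof.
move=> p1 su; have := sobolev0_lin a p1 su (sobolev0_0 p1).
by congr sobolev0; apply/funext => x; rewrite addr0.
Qed.

Lemma sobolev0B p u v : 1 <= p -> sobolev0 Om p u -> sobolev0 Om p v -> sobolev0 Om p (u \- v).
Proof.
move=> p1 su sv; have := sobolev0_lin (-1) p1 sv su.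
by congr sobolev0; apply/funext => x /=; rewrite mulN1r addrC.
Qed.

Lemma grad_norm_hoelder p q u G : 0 < q -> q <= p -> weak_gradient Om u G ->
  (grad_norm Om q%:E u <= grad_norm Om p%:E u * mu Om `^ (q^-1 - p^-1))%E.
Proof.
move=> q0 qp uG; apply: normL_hoelder => //.
exact: (weak_gradient_measurable oO (grad_weak_gradient uG)).
Qed.

Lemma sobolev_norm_hoelder p q u : 1 <= q -> q <= p -> sobolev Om p%:E u ->
  (sobolev_norm Om q%:E u <= sobolev_norm Om p%:E u * mu Om `^ (q^-1 - p^-1))%E.
Proof.
move=> q1 qp su; have [mu_ Lu gu Gu] := sobolevE (le_trans q1 qp) su.
rewrite /sobolev_norm ge0_muleDl ?normL_ge0//; apply: leeD.
  by apply: normL_hoelder => //; exact: lt0_le1.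
by apply: grad_norm_hoelder gu => //; exact: lt0_le1.
Qed.

Lemma sobolev_sub p q u : 1 <= q -> q <= p -> sobolev Om p%:E u -> sobolev Om q%:E u.
Proof.
move=> q1 qp su; have [mu_ Lu gu Gu] := sobolevE (le_trans q1 qp) su.
have q0 := lt0_le1 q1.
apply: (sobolevI q1 _ gu); first exact: (memL_sub mO fO q0 qp).
apply: le_lt_trans (grad_norm_hoelder q0 qp gu) _.
by rewrite lte_mul_pinfty ?normL_ge0 ?poweR_lty// ge0_fin_numE ?normL_ge0.
Qed.

Lemma sobolev0_sub p q u : 1 <= q -> q <= p -> sobolev0 Om p u -> sobolev0 Om q u.
Proof.
move=> q1 qp [su au]; have p1 := le_trans q1 qp; split; first exact: (sobolev_sub q1 qp).
move=> e e0; pose C := fine (mu Om `^ (q^-1 - p^-1))%E.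
have CE : (mu Om `^ (q^-1 - p^-1))%E = C%:E.
  by rewrite fineK// ge0_fin_numE ?poweR_ge0// poweR_lty.
have C0 : 0 <= C by rewrite -lee_fin -CE poweR_ge0.
have C1 : 0 < C + 1 by rewrite ltr_wpDl.
have [phi tphi phiu] := au (e / (C + 1)) (divr_gt0 e0 C1).
exists phi => //; have sd := sobolevB p1 su (test_sobolev p1 tphi).
apply: le_lt_trans (sobolev_norm_hoelder q1 qp sd) _; rewrite CE.
apply: (@le_lt_trans _ _ ((e / (C + 1))%:E * C%:E)%E).
  by rewrite lee_wpmul2r// ltW.
by rewrite -EFinM lte_fin mulrAC ltr_pdivrMr// ltr_pM2l// ltrDl.
Qed.

Lemma sobolev_cvg_sobolev0 p u : 1 <= p -> sobolev Om p%:E u ->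
  (forall e : R, 0 < e -> exists2 v, sobolev0 Om p v & (sobolev_norm Om p%:E (u \- v)%R < e%:E)%E) ->
  sobolev0 Om p u.
Proof.
move=> p1 su H; split => // e e0; have e20 : 0 < e / 2 by exact: divr_gt0.
have [v [sv av] uv] := H _ e20; have [phi tphi vphi] := av _ e20.
exists phi => //; have sphi := test_sobolev p1 tphi.
have -> : (u \- phi)%R = (fun x => 1 * (u \- v) x + (v \- phi) x)%R.
  by apply/funext => x /=; ring.
apply: le_lt_trans (sobolev_norm_lin 1 p1 (sobolevB p1 su sv) (sobolevB p1 sv sphi)) _.
rewrite normr1 mul1e [e in (_ < e%:E)%E]splitr EFinD; exact: lteD uv vphi.
Qed.

Lemma test_grad_norm p phi : 1 <= p -> test_function Om phi ->
  grad_norm Om p%:E phi = normL Om p%:E (fun x => enorm (gradient phi x)).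
Proof.
move=> p1 tphi; apply: (grad_normE oO); first by rewrite lte_fin lt0_le1.
exact: test_weak_gradient.
Qed.

End sobolev_spaces.

(** * Morrey's inequality for continuous functions of the closure of the test functions *)

Section morrey_sobolev0.
Context {R : realType} {n : nat} (Om : set 'rV[R]_n).
Local Notation mu := (lebesgue_measure_rV R n).
Hypotheses (oO : open Om) (bO : bounded_set Om) (n0 : (0 < n)%N).
Variable p : R.
Hypothesis np : n%:R < p.
Variable u : 'rV[R]_n -> R.
Hypotheses (su : sobolev0 Om p u) (cu : {in Om, continuous u}).

Let mO : measurable Om := measurable_open_rV oO.
Let fO : (mu Om < +oo)%E := domain_measure_lty oO bO.
Let p1 : 1 <= p. Proof. by apply: le_trans (ltW np); rewrite ler1n. Qed.
Let p0 : 0 < p := lt0_le1 p1.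
Let a01 : 0 <= n%:R / p < 1.
Proof. by rewrite divr_ge0 ?(ltW p0)//= ltr_pdivrMr// mul1r. Qed.

Let gam := fine (grad_norm Om p%:E u).
Let gamE : grad_norm Om p%:E u = gam%:E.
Proof.
by have [_ _ _ Gu] := sobolevE oO p1 su.1; rewrite fineK// ge0_fin_numE ?normL_ge0.
Qed.
Let gam0 : 0 <= gam. Proof. by rewrite fine_ge0 ?normL_ge0. Qed.

Let ubar x := patch (fun=> 0) Om u x.

(** At distance [s] with a cube of side [s], the constant is the classical Hoelder modulus of
    exponent [1 - n/p], which is small with [s]. *)
Lemma morrey_const_diag (s : R) : 0 < s ->
  morrey_const p (n := n) s s = (1 + n%:R) / (1 - n%:R / p) * s `^ (1 - n%:R / p).
Proof.
move=> s0; rewrite /morrey_const powRD; last by rewrite (gt_eqF s0) implybT.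
by rewrite powRr1 ?ltW//; ring.
Qed.

Lemma morrey_const_diag_small (e : R) : 0 < e ->
  exists2 s : R, 0 < s & morrey_const p (n := n) s s <= e.
Proof.
move=> e0; have /andP[a0 a1] := a01.
have b0 : 0 < 1 - n%:R / p by rewrite subr_gt0.
pose C : R := (1 + n%:R) / (1 - n%:R / p).
have C0 : 0 < C by rewrite divr_gt0// ltr_wpDr.
exists ((e / C) `^ (1 - n%:R / p)^-1); first by rewrite powR_gt0// divr_gt0.
rewrite morrey_const_diag ?powR_gt0 ?divr_gt0// -powRrM mulVf ?gt_eqF//.
rewrite powRr1; last exact/ltW/divr_gt0.
by rewrite -/C mulrC divfK// gt_eqF.
Qed.

Lemma morrey_const_le (s d d' : R) : 0 < s -> d <= d' ->
  morrey_const p (n := n) s d <= morrey_const p (n := n) s d'.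
Proof.
move=> s0 dd; have /andP[_ a1] := a01; rewrite /morrey_const.
by rewrite ler_wpM2r ?invr_ge0 ?subr_ge0 ?(ltW a1)// ler_wpM2r ?powR_ge0// lerD2r.
Qed.

Lemma approx_gradient phi (e : R) : test_function Om phi ->
  (sobolev_norm Om p%:E (u \- phi)%R < e%:E)%E ->
  fine (normL Om p%:E (fun x => enorm (gradient phi x))) <= gam + e.
Proof.
move=> tphi; rewrite -test_grad_norm// => h.
have sphi := test_sobolev oO bO p1 tphi; have [_ _ _ Gphi] := sobolevE oO p1 sphi.
have := grad_norm_lin oO (-1) p1 (sobolevB oO p1 su.1 sphi) su.1.
have -> : (fun x => -1 * (u \- phi)%R x + u x) = phi by apply/funext => x /=; ring.
rewrite normrN1 mul1e gamE => h'.
rewrite -lee_fin fineK ?ge0_fin_numE ?normL_ge0// addrC EFinD.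
apply: le_trans h' _; rewrite leeD2r//; apply: ltW; apply: le_lt_trans h.
by rewrite leeDr// normL_ge0.
Qed.

(** Were [phi x] far from [u x], the continuity of [u] and a Morrey modulus common to all admissible
    [phi] would keep [u - phi] away from [0] on a fixed neighbourhood [B] of [x], and its [L^p] norm
    would be bounded below. *)
Lemma approx_pointwise x (e : R) : 0 < e -> exists2 eta : R, 0 < eta &
  forall phi, test_function Om phi -> (sobolev_norm Om p%:E (u \- phi)%R < eta%:E)%E ->
    `|phi x - ubar x| <= e.
Proof.
move=> e0; have [Ox|Ox] := pselect (Om x); last first.
  exists 1 => // phi tphi _; rewrite /ubar /patch memNset// (test_function_out tphi)//.
  by rewrite subrr normr0 ltW.
have g1 : 0 < gam + 1 by rewrite ltr_wpDl.
(* The gradient norm of an admissible [phi] is at most [gam + 1], so for this [s] every such [phi]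
   varies by at most [e / 4] within distance [s] of [x]. *)
have [s s0 hs] := morrey_const_diag_small (divr_gt0 (divr_gt0 e0 (ltr0Sn R 3)) g1).
have : nbhs x [set z | [/\ Om z, `|u x - u z| <= e / 4 & enorm (z - x) <= s]].
  near=> z; split.
  - by near: z; exact: open_nbhs_nbhs.
  - near: z; apply: cvgr_dist_le; first by apply: cu; exact: mem_set.
    by rewrite divr_gt0.
  - apply: le_trans (ler_enorm_norm _) _.
    apply: (@le_trans _ _ ((n%:R + 1) * `|x - z|)).
      by rewrite distrC ler_wpM2r// lerDl.
    rewrite -ler_pdivlMl ?ltr_wpDl//; near: z; apply: cvgr_dist_le => //.
    by rewrite mulrC divr_gt0// ltr_wpDl.
rewrite nbhsE => -[B [oB Bx] BP].
have mB : measurable B by exact: measurable_open_rV.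
have BO : B `<=` Om by move=> z /BP[].
have muB : (0 < mu B)%E by apply: open_measure_gt0 => //; exists x.
have muBoo : (mu B < +oo)%E.
  by apply: le_lt_trans fO; apply: le_measure => //; rewrite inE.
pose b := fine (mu B); have bE : mu B = b%:E by rewrite fineK// ge0_fin_numE.
have b0 : 0 < b by rewrite -lte_fin -bE.
(* The term [1] gives the gradient bound [gam + 1]; the other one is the [L^p] norm of the constant
   [e / 4] on [B], which is to be contradicted. *)
exists (Num.min 1 (e / 4 * b `^ p^-1)); first by rewrite lt_min ltr01 mulr_gt0 ?powR_gt0 ?divr_gt0.
move=> phi tphi h; rewrite /ubar /patch mem_set//; rewrite leNgt; apply/negP => eu.
have h1 : (sobolev_norm Om p%:E (u \- phi)%R < 1%:E)%E.
  by apply: lt_le_trans h _; rewrite lee_fin ge_min lexx.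
have hg := approx_gradient tphi h1.
have low z : B z -> e / 4 <= `|(u \- phi)%R z|.
  move=> /BP[Oz uz zs].
  have m := morrey_test oO bO n0 np tphi z x s0.
  have m' : `|phi z - phi x| <= e / 4.
    apply: le_trans m _; apply: (@le_trans _ _ (e / 4 / (gam + 1) * (gam + 1))).
      apply: ler_pM => //.
      - by apply: morrey_const_ge0; rewrite ?enorm_ge0 ?(ltW s0).
      - by rewrite fine_ge0// normL_ge0.
      - by apply: le_trans hs; exact: morrey_const_le.
    by rewrite divfK// gt_eqF.
  have t1 := ler_normB (phi x - u x) (phi x - phi z).
  have := ler_distD (phi z) (phi x) (u x); have := ler_distD (u z) (phi z) (u x).
  rewrite /= (distrC (phi x) (phi z)) (distrC (u z) (u x)) (distrC (phi z) (u z)).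
  by lra.
have : ((e / 4 * b `^ p^-1)%:E <= normL Om p%:E (u \- phi)%R)%E.
  have [mu_ _ _ _] := sobolevE oO p1 (sobolevB oO p1 su.1 (test_sobolev oO bO p1 tphi)).
  apply: (@le_trans _ _ (normL B p%:E (u \- phi)%R)); last first.
    exact: (normL_subset mB mO BO p0 mu_).
  rewrite EFinM -poweR_EFin -bE -normL_cst ?divr_ge0 ?(ltW e0)//.
  apply: le_normL => //; first exact: measurable_funS mu_.
  by apply/nearW => z /low; rewrite [`|e / 4|]ger0_norm ?divr_ge0 ?(ltW e0).
move=> /le_lt_trans/(_ (le_lt_trans _ h)); rewrite lte_fin lt_min ltxx andbF => F.
by apply: (Bool.diff_false_true); apply: F; rewrite leeDl// normL_ge0.
Unshelve. all: by end_near. Qed.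

(** The inequality for test functions passes to the zero extension of [u] because Sobolev
    approximation is here also pointwise, inside [Om] as well as outside. *)
Lemma morrey_sobolev0 x y (s : R) : 0 < s ->
  `|ubar x - ubar y| <= morrey_const p (n := n) s (enorm (x - y)) * gam.
Proof.
move=> s0; set C := morrey_const p s _.
have C0 : 0 <= C by apply: morrey_const_ge0; rewrite ?enorm_ge0 ?(ltW s0).
apply/ler_addgt0Pr => e e0.
(* [C * e'] pays for the gradient norm of the approximation and [2 * e'] for its values at [x] and
   [y]. *)
pose e' := e / (C + 2); have C2 : 0 < C + 2 by rewrite ltr_wpDl.
have e'0 : 0 < e' by exact: divr_gt0.
have [eta1 h1 H1] := approx_pointwise x e'0; have [eta2 h2 H2] := approx_pointwise y e'0.
have [_ au] := su.
have [|phi tphi h] := au (Num.min e' (Num.min eta1 eta2)); first by rewrite !lt_min e'0 h1 h2.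
have {}H1 : `|phi x - ubar x| <= e'.
  by apply: H1 => //; apply: lt_le_trans h _; rewrite lee_fin !ge_min lexx orbT.
have {}H2 : `|phi y - ubar y| <= e'.
  by apply: H2 => //; apply: lt_le_trans h _; rewrite lee_fin !ge_min lexx !orbT.
have hg : fine (normL Om p%:E (fun x => enorm (gradient phi x))) <= gam + e'.
  by apply: approx_gradient => //; apply: lt_le_trans h _; rewrite lee_fin ge_min lexx.
have m := le_trans (morrey_test oO bO n0 np tphi x y s0) (ler_wpM2l C0 hg).
have ee : e = C * e' + e' + e' by rewrite /e'; field; rewrite gt_eqF.
have := ler_distD (phi x) (ubar x) (ubar y); have := ler_distD (phi y) (phi x) (ubar y).
rewrite (distrC (ubar x) (phi x)) ee; move: m; rewrite mulrDr; lra.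
Qed.

End morrey_sobolev0.

(** * Clarkson's inequality and Mazur's lemma *)

Section clarkson.
Context {R : realType}.
Implicit Types (x y s r : R).

(** For [z = x] and [z = y] the ratio [z / (x + y)] lies in [[0, 1]], where a power [s >= 1] only
    decreases it; the two ratios add up to [1]. *)
Lemma powR_superadditive s x y : 1 <= s -> 0 <= x -> 0 <= y ->
  x `^ s + y `^ s <= (x + y) `^ s.
Proof.
move=> s1 x0 y0; have s0 : 0 < s by exact: lt_le_trans s1.
have [xy0|xy0] := eqVneq (x + y) 0.
  have x00 : x = 0 by apply/eqP; rewrite eq_le x0 andbT -xy0 lerDl.
  have y00 : y = 0 by move: xy0; rewrite x00 add0r.
  by rewrite x00 y00 addr0 powR0 ?gt_eqF// addr0.
have {}xy0 : 0 < x + y by rewrite lt_neqAle eq_sym xy0 addr_ge0.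
have H z : 0 <= z -> z <= x + y -> z `^ s <= (x + y) `^ s * (z / (x + y)).
  move=> z0 zxy; have {1}-> : z = (x + y) * (z / (x + y)) by rewrite mulrC divfK ?gt_eqF.
  have q0 : 0 <= z / (x + y) by rewrite divr_ge0// ltW.
  rewrite powRM ?(ltW xy0)// ler_wpM2l ?powR_ge0//.
  have q1 : z / (x + y) <= 1 by rewrite ler_pdivrMr// mul1r.
  have [->|qn0] := eqVneq (z / (x + y)) 0; first by rewrite powR0// gt_eqF.
  by apply: ge1r_powR => //; rewrite q1 andbT lt0r qn0.
apply: le_trans (lerD (H x x0 _) (H y y0 _)) _; rewrite ?lerDl ?lerDr//.
by rewrite -mulrDr -mulrDl divff ?gt_eqF// mulr1.
Qed.

Lemma powR_midpoint s x y : 1 <= s -> 0 <= x -> 0 <= y ->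
  ((x + y) / 2) `^ s <= (x `^ s + y `^ s) / 2.
Proof.
move=> s1 x0 y0.
have h01 : (0 <= 2^-1 :> R) && (2^-1 <= 1 :> R) by lra.
have hx : x \in (`[0, +oo[%classic : set R) by rewrite inE/= in_itv/= x0.
have hy : y \in (`[0, +oo[%classic : set R) by rewrite inE/= in_itv/= y0.
have := convex_powR s1 (Itv01 (andP h01).1 (andP h01).2) hx hy.
rewrite convRE [X in X `^ _ <= _ -> _]convRE /= /unstable.onem.
by rewrite (_ : 1 - 2^-1 = 2^-1 :> R); [rewrite -!mulrDr ![2^-1 * _]mulrC|lra].
Qed.

Lemma parallelogram_enorm n (a b : 'rV[R]_n) :
  enorm (a + b) ^+ 2 + enorm (a - b) ^+ 2 = 2 * (enorm a ^+ 2 + enorm b ^+ 2).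
Proof.
rewrite !sqr_enorm mulrDr !mulr_sumr -!big_split /=.
by apply: eq_bigr => i _; rewrite !mxE; ring.
Qed.

(** The parallelogram identity is the case [r = 2]. In general, the power [r / 2 >= 1] applied to
    the squared norms is superadditive, which handles the left side, and convex, which gives the
    right side. *)
Lemma clarkson_enorm n r (a b : 'rV[R]_n) : 2 <= r ->
  enorm (2^-1 *: (a + b)) `^ r + enorm (2^-1 *: (a - b)) `^ r <=
  (enorm a `^ r + enorm b `^ r) / 2.
Proof.
move=> r2; have s1 : 1 <= r / 2 by lra.
have E (c : 'rV[R]_n) : enorm c `^ r = (enorm c ^+ 2) `^ (r / 2).
  by rewrite -powR_mulrn ?enorm_ge0// -powRrM mulrCA mulfV// mulr1.
rewrite !E; apply: le_trans (powR_superadditive s1 (sqr_ge0 _) (sqr_ge0 _)) _.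
apply: le_trans (powR_midpoint s1 (sqr_ge0 _) (sqr_ge0 _)).
rewrite (_ : _ + _ = (enorm a ^+ 2 + enorm b ^+ 2) / 2)//.
rewrite !enormZ !exprMn -mulrDr parallelogram_enorm.
by rewrite ger0_norm ?invr_ge0//; field.
Qed.

End clarkson.

(** * Completeness of [L^r] for rapidly Cauchy sequences *)

Section riesz_fischer.
Context {R : realType} {n : nat} (Om : set 'rV[R]_n).
Local Notation mu := (lebesgue_measure_rV R n).
Hypotheses (mO : measurable Om) (fO : (mu Om < +oo)%E).
Variables (r : R) (f : nat -> 'rV[R]_n -> R) (d : nat -> R) (S : R).
Hypotheses (r1 : 1 <= r) (mf : forall k, measurable_fun Om (f k)).
Hypothesis fC : forall m k, (m <= k)%N ->
  (normL Om r%:E (f m \- f k)%R <= (d m)%:E)%E.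
Hypotheses (d0 : forall m, 0 <= d m) (dS : forall k, \sum_(0 <= i < k) d i <= S).

Let r0 : 0 < r := lt0_le1 r1.

(** The upper limit is measurable without any convergence, and it is the true limit wherever the
    increments are summable. *)
Let flim x := fine (limn_esup (fun k => (f k x)%:E)).

Let mflim : measurable_fun Om flim.
Proof.
apply: (@measurableT_comp _ _ _ _ _ _ (@fine R)) => //.
by apply: measurable_fun_limn_esup => k; apply/measurable_EFinP.
Qed.

(** On a set of finite measure Hoelder's inequality bounds the [L^1] norm of each increment by
    [C * d k], so the series of increments has a finite integral. *)
Let increment_lty :
  {ae mu, forall x, Om x -> (\sum_(0 <= k <oo) `|f k x - f k.+1 x|%:E < +oo)%E}.
Proof.
have mg k : measurable_fun Om (f k \- f k.+1)%R by exact: measurable_funB.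
have mg' k : measurable_fun Om (fun x => `|f k x - f k.+1 x|%:E).
  by apply/measurable_EFinP; apply: measurableT_comp => //; exact: mg.
pose C := fine (mu Om `^ (1^-1 - r^-1))%E.
have CE : (mu Om `^ (1^-1 - r^-1))%E = C%:E.
  by rewrite fineK// ge0_fin_numE ?poweR_ge0// poweR_lty.
have C0 : 0 <= C by rewrite -lee_fin -CE poweR_ge0.
have ik k : (\int[mu]_(x in Om) `|f k x - f k.+1 x|%:E <= (C * d k)%:E)%E.
  have := normL_hoelder mO ltr01 r1 (mg k); rewrite normL_int// invr1 poweRe1; last first.
    by apply: integral_ge0 => x _; rewrite lee_fin powR_ge0.
  under eq_integral do rewrite powRr1//.
  by move=> /le_trans; apply; rewrite -[X in (X - _)%R]invr1 CE muleC EFinM; apply: lee_wpmul2l; [exact: C0|exact: fC].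
have sum_fin : (\int[mu]_(x in Om) (\sum_(0 <= k <oo) `|f k x - f k.+1 x|%:E) < +oo)%E.
  rewrite integral_nneseries//.
  apply: (@le_lt_trans _ _ (\sum_(0 <= k <oo) (C * d k)%:E)%E).
    by apply: lee_nneseries => // k _ _; apply: integral_ge0.
  apply: (@le_lt_trans _ _ (C * S)%:E); last by rewrite ltry.
  apply: lime_le.
    by apply: is_cvg_nneseries => k _ _; rewrite lee_fin mulr_ge0.
  by apply: nearW => k; rewrite sumEFin lee_fin -mulr_sumr ler_wpM2l.
have : mu.-integrable Om (fun x => \sum_(0 <= k <oo) `|f k x - f k.+1 x|%:E)%E.
  apply/integrableP; split.
    by apply: ge0_emeasurable_sum => // k x _ _.
  by under eq_integral => x _ do rewrite gee0_abs ?nneseries_ge0//.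
move=> /(integrable_ae mO); apply: filterS => x h Ox.
by have := h Ox; rewrite ge0_fin_numE// nneseries_ge0.
Qed.

Let limn_einf_ge0 (u : (\bar R)^nat) : (forall k, 0 <= u k)%E -> (0 <= limn_einf u)%E.
Proof.
move=> u0; rewrite limn_einf_lim; apply: lime_ge; first exact: is_cvg_einfs.
by apply: nearW => k; apply: le_ereal_inf_tmp => _ [j _ <-].
Qed.

Let limn_einf_le (u : (\bar R)^nat) m (b : \bar R) :
  (forall k, (m <= k)%N -> (u k <= b)%E) -> (limn_einf u <= b)%E.
Proof.
move=> ub; rewrite limn_einf_lim; apply: lime_le; first exact: is_cvg_einfs.
near=> k; apply: le_trans (ub k _); last by near: k; exact: nbhs_infty_ge.
by apply: ereal_inf_lbound; exists k => /=.
Unshelve. all: by end_near. Qed.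

Let cvg_powR_pos (u : nat -> R) (l : R) : 0 < l -> u k @[k --> \oo] --> l ->
  u k `^ r @[k --> \oo] --> l `^ r.
Proof.
move=> l0 ul.
have E x : 0 < x -> x `^ r = expR (r * ln x) by move=> x0; rewrite /powR gt_eqF.
rewrite E//.
have : expR (r * ln (u k)) @[k --> \oo] --> expR (r * ln l).
  apply: (@cvg_comp _ _ _ (fun k => r * ln (u k)) expR); last exact: continuous_expR.
  apply: cvgMr; apply: (@cvg_comp _ _ _ u (@ln R) _ _ _ ul); exact: continuous_ln.
apply: cvg_trans; apply: near_eq_cvg; near=> k; rewrite E//.
by near: k; exact: (cvgr_gt l).
Unshelve. all: by end_near. Qed.

(** The summable bounds make the sequence itself, and not only a subsequence, converge almost
    everywhere. Fatou's lemma then transfers the bound [d m] from [f m - f k] to [f m - g]. *)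
Lemma riesz_fischer : exists g, measurable_fun Om g /\
  forall m, (normL Om r%:E (f m \- g)%R <= (d m)%:E)%E.
Proof.
have cvf : {ae mu, forall x, Om x -> f k x @[k --> \oo] --> flim x}.
  apply: filterS increment_lty => x h Ox; have {}h := h Ox.
  have ns : cvgn [normed series (fun k => f k.+1 x - f k x)].
    apply: nondecreasing_is_cvgn.
      by apply: nondecreasing_series => k _ _; rewrite normr_ge0.
    exists (fine (\sum_(0 <= k <oo) `|f k x - f k.+1 x|%:E)%E) => _ [k _ <-].
    rewrite -lee_fin fineK; last by rewrite ge0_fin_numE// nneseries_ge0.
    rewrite /series /= -sumEFin; under eq_bigr do rewrite distrC.
    by apply: nneseries_lim_ge => i _ _; rewrite lee_fin.
  have /cvg_ex[l Hl] := normed_cvg ns.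
  have cl : f k x @[k --> \oo] --> (f 0%N x + l).
    have -> : (fun k => f k x) = (fun k => f 0%N x + series (fun k => f k.+1 x - f k x) k).
      apply/funext => k; rewrite /series /= telescope_sumr//; lra.
    by apply: cvgD => //; exact: cvg_cst.
  have : (fun k => (f k x)%:E) @ \oo --> (f 0%N x + l)%:E by apply/cvg_EFin => //; exact: nearW.
  by move=> /cvg_limn_einf_sup[_]; rewrite /flim => ->.
exists flim; split => // m.
rewrite normL_int//.
suff H : (\int[mu]_(x in Om) (`|(f m \- flim)%R x| `^ r)%:E <= (d m `^ r)%:E)%E.
  have -> : (d m)%:E = ((d m `^ r)%:E `^ r^-1)%E.
    by rewrite poweR_EFin -powRrM mulfV ?gt_eqF// powRr1.
  apply: gt0_ler_poweR => //; first by rewrite invr_ge0 ltW.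
    exact: powR_integral_itv.
    by rewrite in_itv/= leey andbT lee_fin powR_ge0.
have mg k : measurable_fun Om (f m \- f k)%R by exact: measurable_funB.
have F := @fatou _ _ _ mu Om mO (fun k x => (`|(f m \- f k)%R x| `^ r)%:E)
  (fun k => measurable_powR_norm r (mg k)) (fun k x _ => powR_ge0 _ _).
apply: le_trans; last apply: le_trans F _.
- apply: ae_ge0_le_integral; [exact: mO| | | | |].
  + by move=> x _; rewrite lee_fin powR_ge0.
  + by apply: measurable_powR_norm; exact: measurable_funB.
  + by move=> x _; apply: limn_einf_ge0 => k; rewrite lee_fin powR_ge0.
  + rewrite (_ : (fun x => _) = (fun x => - limn_esup (-%E \o (fun k => (`|(f m \- f k)%R x| `^ r)%:E)))%E); last first.
      by apply/funext => x; rewrite limn_esupN oppeK.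
    apply: measurableT_comp => //; apply: measurable_fun_limn_esup => k.
    apply: (@measurableT_comp _ _ _ _ _ _ (-%E)) => //; exact: measurable_powR_norm.
  apply: filterS cvf => x h Ox; have {}h := h Ox.
  have [->|l0] := eqVneq ((f m \- flim)%R x) 0.
    rewrite normr0 powR0 ?gt_eqF//; apply: limn_einf_ge0 => k.
    by rewrite lee_fin powR_ge0.
  suff : (fun k => (`|(f m \- f k)%R x| `^ r)%:E) @ \oo --> (`|(f m \- flim)%R x| `^ r)%:E.
    by move=> /cvg_limn_einf_sup[-> _].
  apply/cvg_EFin; first exact: nearW.
  apply: cvg_powR_pos; first by rewrite normr_gt0.
  by apply: cvg_norm; apply: cvgB; [exact: cvg_cst|exact: h].
apply: (@limn_einf_le _ m) => k mk.
rewrite -normL_powR// -poweR_EFin; apply: gt0_ler_poweR.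
- exact: ltW.
- by rewrite in_itv/= leey andbT normL_ge0.
- by rewrite in_itv/= leey andbT lee_fin.
- exact: fC.
Qed.

End riesz_fischer.

Section gradient_limits.
Context {R : realType} {n : nat} (Om : set 'rV[R]_n).
Local Notation mu := (lebesgue_measure_rV R n).
Hypotheses (oO : open Om) (bO : bounded_set Om).
Implicit Types (u v w phi : 'rV[R]_n -> R) (G H : 'rV[R]_n -> 'rV[R]_n).
Variable r : R.
Hypothesis r1 : 1 <= r.

Let mO : measurable Om := measurable_open_rV oO.
Let fO : (mu Om < +oo)%E := domain_measure_lty oO bO.
Let r0 : 0 < r := lt0_le1 r1.

Lemma weak_gradientZ (a : R) u G : weak_gradient Om u G ->
  weak_gradient Om (fun x => a * u x) (fun x => a *: G x).
Proof.
move=> uG; have := weak_gradientD oO (a - 1) uG uG; congr weak_gradient.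
  by apply/funext => x; ring.
by apply/funext => x; rewrite -[X in _ + X]scale1r -scalerDl subrK.
Qed.

Lemma grad_normZ (a : R) u : sobolev Om r%:E u ->
  grad_norm Om r%:E (fun x => a * u x) = (`|a|%:E * grad_norm Om r%:E u)%E.
Proof.
move=> su; have [_ _ gu _] := sobolevE oO r1 su.
rewrite (grad_normE oO _ (weak_gradientZ a gu)) ?lte_fin//.
under eq_fun do rewrite enormZ; rewrite normLZ ?normr_id//.
exact: (weak_gradient_measurable oO gu).
Qed.

Lemma weak_gradientB u v G H : weak_gradient Om u G -> weak_gradient Om v H ->
  weak_gradient Om (u \- v) (fun x => G x - H x).
Proof.
move=> uG vH; have := weak_gradientD oO (-1) vH uG; congr weak_gradient.
  by apply/funext => x /=; ring.
by apply/funext => x; rewrite scaleN1r addrC.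
Qed.

Lemma Rintegral_normL_le f phi (M : R) : memL Om r%:E f -> measurable_fun Om phi ->
  (forall x, `|phi x| <= M) ->
  `|\int[mu]_(x in Om) (f x * phi x)| <=
    M * (fine (normL Om r%:E f) * fine (mu Om `^ (1 - r^-1))%E).
Proof.
move=> [mf Lf] mphi phiM.
have if_ : mu.-integrable Om (EFin \o f) by exact: (memL_integrable mO fO r1).
have M0 : 0 <= M by apply: le_trans (phiM 0).
have ifphi : mu.-integrable Om (EFin \o (fun x => f x * phi x)).
  apply: (@le_integrable _ _ _ mu Om mO _ (fun x => (M * f x)%:E)).
  - by apply/measurable_EFinP; exact: measurable_funM.
  - move=> x _ /=; rewrite lee_fin !normrM (ger0_norm M0) mulrC.
    by rewrite ler_wpM2r.
  - by under eq_fun do rewrite EFinM; exact: integrableZl.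
rewrite -lee_fin; apply: le_trans (_ : (\int[mu]_(x in Om) (M * `|f x|)%:E <= _)%E).
  rewrite EFin_normr_Rintegral//; apply: le_trans (le_abse_integral mu mO _) _.
    by have /integrableP[] := ifphi.
  apply: ge0_le_integral => //.
  - by apply: measurableT_comp => //; have /integrableP[] := ifphi.
  - by apply/measurable_EFinP; apply: measurable_funM => //; exact: measurableT_comp.
  - move=> x _ /=; rewrite lee_fin normrM mulrC; exact: ler_wpM2r.
under eq_integral do rewrite EFinM.
rewrite ge0_integralZl_EFin//; last by apply/measurable_EFinP; exact: measurableT_comp.
rewrite EFinM lee_wpmul2l// ?lee_fin// EFinM !fineK; last 2 first.
- by rewrite ge0_fin_numE ?poweR_ge0// poweR_lty.
- by rewrite ge0_fin_numE ?normL_ge0.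
have := normL_hoelder mO ltr01 r1 mf; rewrite invr1; apply: le_trans.
rewrite normL_int// invr1 poweRe1; last by apply: integral_ge0 => x _; rewrite lee_fin powR_ge0.
by under [leRHS]eq_integral do rewrite powRr1//.
Qed.

Section limit.
Variables (c : nat -> 'rV[R]_n -> R) (w : 'rV[R]_n -> R) (d : nat -> R) (S : R).
Hypotheses (sc : forall m, sobolev Om r%:E (c m)) (Lw : memL Om r%:E w).
Hypotheses (d0 : forall m, 0 <= d m) (dS : forall k, \sum_(0 <= i < k) d i <= S).
Hypothesis dc : d k @[k --> \oo] --> (0 : R).
Hypothesis gc : forall m k, (m <= k)%N -> (grad_norm Om r%:E (c m \- c k)%R <= (d m)%:E)%E.
Hypothesis cw : fine (normL Om r%:E (c m \- w)%R) @[m --> \oo] --> (0 : R).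

Let mc m : measurable_fun Om (c m). Proof. by have [] := sobolevE oO r1 (sc m). Qed.
Let gcm m : weak_gradient Om (c m) (grad Om (c m)).
Proof. by have [] := sobolevE oO r1 (sc m). Qed.
Let mgi m i : measurable_fun Om (fun x => grad Om (c m) x 0 i).
Proof. by have [_ lg _] := gcm m; have [] := lg i. Qed.
Let Lgi m i : memL Om r%:E (fun x => grad Om (c m) x 0 i).
Proof.
split => //; have [_ _ _] := sobolevE oO r1 (sc m); apply: le_lt_trans.
by apply: normL_coord_le.
Qed.
Let Lcw m : memL Om r%:E (c m \- w).
Proof.
split; first by apply: measurable_funB => //; exact: Lw.1.
have := normL_lin oO (-1) r1 Lw.1 (mc m).
under eq_fun do rewrite mulN1r addrC.
move=> /le_lt_trans; apply; apply: lin_lty; rewrite ?normL_ge0//; first exact: Lw.2.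
by have [] := sobolevE oO r1 (sc m).
Qed.

(** Riesz-Fischer applies to each coordinate of the gradients, and the integration by parts identity
    of [c m] passes to the limit. The factor [n] comes from adding up the coordinate bounds. *)
Lemma gradient_limit : exists2 G, weak_gradient Om w G &
  forall m, (normL Om r%:E (fun x => enorm (grad Om (c m) x - G x)) <= (n%:R * d m)%:E)%E.
Proof.
have Hi i : exists g, measurable_fun Om g /\
    forall m, (normL Om r%:E ((fun x => grad Om (c m) x 0 i) \- g)%R <= (d m)%:E)%E.
  apply: (riesz_fischer mO fO r1 (mgi^~ i) _ d0 dS) => m k mk.
  apply: le_trans (gc mk).
  have wg := weak_gradientB (gcm m) (gcm k).
  rewrite (grad_normE oO _ wg) ?lte_fin//.
  have := @normL_coord_le _ _ _ mO r%:E (fun x => grad Om (c m) x - grad Om (c k) x) i.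
  under eq_fun do rewrite !mxE; apply; rewrite ?lte_fin// => j.
  by under eq_fun do rewrite !mxE; exact: measurable_funB.
have [g gP] := choice Hi.
pose G x : 'rV[R]_n := \row_i g i x.
have GE i : (fun x => G x 0 i) = g i by apply/funext => x; rewrite mxE.
have Lg i : memL Om r%:E (g i).
  have [mg gm] := gP i; split => //.
  have mh : measurable_fun Om ((fun x => grad Om (c 0%N) x 0 i) \- g i) by exact: measurable_funB.
  have := normL_lin oO (-1) r1 mh (mgi 0%N i).
  rewrite (_ : (fun x => _ + _) = g i); last by apply/funext => x /=; ring.
  move=> /le_lt_trans; apply; apply: lin_lty; rewrite ?normL_ge0//.
    exact: le_lt_trans (gm 0%N) (ltry _).
  exact: (Lgi 0%N i).2.
exists G.
  split; first exact: memL_loc_integrable Lw.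
    by move=> i; rewrite GE; exact: memL_loc_integrable (Lg i).
  move=> phi i tphi; have tdphi := test_partial i tphi.
  have [M1 HM1] := test_bounded tdphi; have [M2 HM2] := test_bounded tphi.
  pose K := fine (mu Om `^ (1 - r^-1))%E.
  have K0 : 0 <= K by rewrite fine_ge0// poweR_ge0.
  have M20 : 0 <= M2 by apply: le_trans (HM2 0).
  have ie f psi : memL Om r%:E f -> test_function Om psi ->
      mu.-integrable Om (EFin \o (fun x => f x * psi x)).
    move=> Lf tpsi; apply: (loc_integrable_test oO) => //.
    exact: memL_loc_integrable Lf.
  have LD m : memL Om r%:E ((fun x => grad Om (c m) x 0 i) \- g i).
    have [mg gm] := gP i; split; first exact: measurable_funB.
    exact: le_lt_trans (gm m) (ltry _).
  pose X := \int[mu]_(x in Om) (w x * partial i phi x).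
  pose Y := \int[mu]_(x in Om) (g i x * phi x).
  (* [X + Y] is the defect of the identity for [w] and its candidate gradient. Subtracting the exact
     identity for [c m] turns it into two errors that vanish with [m]. *)
  have key m : `|X + Y| <= M1 * K * fine (normL Om r%:E (c m \- w)%R) + M2 * K * d m.
    pose A := \int[mu]_(x in Om) ((c m \- w)%R x * partial i phi x).
    pose B := \int[mu]_(x in Om) (((fun x => grad Om (c m) x 0 i) \- g i)%R x * phi x).
    have EA : A = \int[mu]_(x in Om) (c m x * partial i phi x) - X.
      rewrite /A; under eq_Rintegral do rewrite /= mulrBl.
      rewrite RintegralB//; [|exact: ie].
      by apply: ie => //; have [] := sc m.
    have EB : B = \int[mu]_(x in Om) (grad Om (c m) x 0 i * phi x) - Y.
      rewrite /B; under eq_Rintegral do rewrite /= mulrBl.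
      by rewrite RintegralB//; exact: ie.
    have E : X + Y = - A - B.
      have [_ _ wg] := gcm m; have := wg phi i tphi.
      by rewrite EA EB; lra.
    rewrite E; apply: le_trans (ler_normB _ _) _; rewrite normrN; apply: lerD.
      rewrite mulrAC -mulrA; apply: Rintegral_normL_le => //.
      exact: test_measurable tdphi.
    have := Rintegral_normL_le (LD m) (test_measurable tphi) HM2.
    rewrite -/B => /le_trans; apply.
    rewrite -mulrA ler_wpM2l// mulrC ler_wpM2l// -lee_fin fineK.
      exact: (gP i).2.
    by rewrite ge0_fin_numE ?normL_ge0//; exact: (LD m).2.
  have YE : \int[mu]_(x in Om) (G x 0 i * phi x) = Y by rewrite /Y -GE.
  rewrite YE; apply/eqP; rewrite -addr_eq0 -/X -normr_le0.
  have lim0 : M1 * K * fine (normL Om r%:E (c m \- w)%R) + M2 * K * d m @[m --> \oo] --> (0 : R).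
    rewrite [X in _ --> X](_ : _ = M1 * K * 0 + M2 * K * 0); last by rewrite !mulr0 addr0.
    by apply: cvgD; apply: cvgMr.
  rewrite -(cvg_lim _ lim0)//; apply: limr_ge; first by apply/cvg_ex; exists 0.
  by apply: nearW => m; exact: key.
move=> m; apply: le_trans (@normL_enorm_le_sum _ _ _ oO r (fun x => grad Om (c m) x - G x) r1 _) _.
  move=> i; under eq_fun do rewrite !mxE.
  by apply: measurable_funB => //; have [] := gP i.
apply: (@le_trans _ _ (\sum_(i < n) (d m)%:E)%E).
  apply: lee_sum => i _; under eq_fun do rewrite !mxE.
  exact: (gP i).2.
by rewrite sumEFin sumr_const card_ord mulr_natl.
Qed.

Lemma sobolev_limit : sobolev Om r%:E w /\
  forall e : R, 0 < e -> \forall m \near \oo, (sobolev_norm Om r%:E (w \- c m)%R < e%:E)%E.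
Proof.
have [G wG HG] := gradient_limit.
have mG i : measurable_fun Om (fun x => G x 0 i) by have [_ lG _] := wG; have [] := lG i.
split.
  apply: (sobolevI oO r1 Lw wG).
  have := @normL_enormD _ _ _ mO r (fun x => G x - grad Om (c 0%N) x) (grad Om (c 0%N)) r1.
  under eq_fun do rewrite subrK.
  move=> H; apply: le_lt_trans (H _ _) _ => //.
  - by move=> i; under eq_fun do rewrite !mxE; exact: measurable_funB.
  apply: lte_add_pinfty; last by have [] := sobolevE oO r1 (sc 0%N).
  apply: le_lt_trans (ltry (n%:R * d 0%N)); apply: le_trans (HG 0%N).
  by under eq_fun do rewrite -enormN opprB.
move=> e e0.
have lim0 : fine (normL Om r%:E (c m \- w)%R) + n%:R * d m @[m --> \oo] --> (0 : R).
  rewrite [X in _ --> X](_ : _ = 0 + n%:R * 0); last by rewrite mulr0 addr0.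
  by apply: cvgD => //; apply: cvgMr.
near=> m.
apply: (@le_lt_trans _ _ (fine (normL Om r%:E (c m \- w)%R) + n%:R * d m)%:E).
  rewrite /sobolev_norm EFinD; apply: leeD.
    rewrite fineK; last by rewrite ge0_fin_numE ?normL_ge0//; exact: (Lcw m).2.
    by rewrite -normLN; under eq_fun do rewrite /= opprB.
  rewrite (grad_normE oO _ (weak_gradientB wG (gcm m))) ?lte_fin//.
  apply: le_trans (HG m).
  by under eq_fun do rewrite -enormN opprB.
rewrite lte_fin; near: m; exact: (cvgr_lt 0).
Unshelve. all: by end_near. Qed.

End limit.
End gradient_limits.

(** * Strong approximation by midpoint-closed sets and weak convergence *)

Section mazur.
Context {R : realType} {n : nat} (Om : set 'rV[R]_n).
Local Notation mu := (lebesgue_measure_rV R n).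
Hypotheses (oO : open Om) (bO : bounded_set Om).
Implicit Types (u v w phi : 'rV[R]_n -> R) (G H : 'rV[R]_n -> 'rV[R]_n).
Variable r : R.
Hypothesis r2 : 2 <= r.

Let mO : measurable Om := measurable_open_rV oO.
Let fO : (mu Om < +oo)%E := domain_measure_lty oO bO.
Let r1 : 1 <= r. Proof. by apply: le_trans r2; rewrite ler1n. Qed.
Let r0 : 0 < r := lt0_le1 r1.
Let gn u := fine (grad_norm Om r%:E u).

Let gnE u : sobolev Om r%:E u -> grad_norm Om r%:E u = (gn u)%:E.
Proof.
by move=> su; have [_ _ _ Gu] := sobolevE oO r1 su; rewrite fineK// ge0_fin_numE ?normL_ge0.
Qed.

Let gn_ge0 u : 0 <= gn u. Proof. by rewrite fine_ge0 ?normL_ge0. Qed.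

Let gnpow u G : sobolev Om r%:E u -> weak_gradient Om u G ->
  ((gn u `^ r)%:E = \int[mu]_(x in Om) (enorm (G x) `^ r)%:E)%E.
Proof.
have r0' : (0 < r%:E)%E by rewrite lte_fin.
move=> su uG; rewrite -poweR_EFin -(gnE su) (grad_normE oO r0' uG) (normL_powR Om _ r0).
by apply: eq_integral => x _; rewrite ger0_norm ?enorm_ge0.
Qed.

Lemma sobolev_midpoint u v : sobolev Om r%:E u -> sobolev Om r%:E v ->
  sobolev Om r%:E (fun x => 2^-1 * (u x + v x)).
Proof.
move=> su sv; have := sobolev_lin oO (2^-1) r1 su (sobolev_lin oO (2^-1 - 1) r1 sv sv).
by congr sobolev; apply/funext => x; ring.
Qed.

Let ler_mean (a b c d : R) (A B C D : \bar R) : (a%:E = A -> b%:E = B -> c%:E = C -> d%:E = D ->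
  A + B <= 2^-1%:E * (C + D) -> (a + b)%:E <= ((c + d) / 2)%:E)%E.
Proof. by move=> <- <- <- <-; rewrite [in X in _ -> X]mulrC. Qed.

Let le_integral_mean (a b c d : 'rV[R]_n -> R) :
  (forall x, 0 <= a x) -> (forall x, 0 <= b x) -> (forall x, 0 <= c x) -> (forall x, 0 <= d x) ->
  measurable_fun Om (fun x => (a x)%:E) -> measurable_fun Om (fun x => (b x)%:E) ->
  measurable_fun Om (fun x => (c x)%:E) -> measurable_fun Om (fun x => (d x)%:E) ->
  (forall x, a x + b x <= (c x + d x) / 2) ->
  (\int[mu]_(x in Om) (a x)%:E + \int[mu]_(x in Om) (b x)%:E <=
   2^-1%:E * (\int[mu]_(x in Om) (c x)%:E + \int[mu]_(x in Om) (d x)%:E))%E.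
Proof.
move=> a0 b0 c0 d0 ma mb mc md abcd.
have ge f : (forall x, 0 <= f x) -> forall x, Om x -> (0 <= (f x : R)%:E)%E.
  by move=> f0 x _; rewrite lee_fin.
rewrite -(ge0_integralD mu mO (ge _ a0) ma (ge _ b0) mb).
rewrite -(ge0_integralD mu mO (ge _ c0) mc (ge _ d0) md).
have mS := emeasurable_funD mc md.
have S0 x : Om x -> (0 <= (c x)%:E + (d x)%:E)%E by move=> _; rewrite adde_ge0 ?lee_fin.
rewrite -(ge0_integralZl_EFin mu mO S0 mS) ?invr_ge0//.
apply: ge0_le_integral; [exact: mO| | | |].
- by move=> x _; rewrite adde_ge0 ?lee_fin.
- exact: emeasurable_funD.
- by apply: emeasurable_funM => //; exact: measurable_cst.
- move=> x _; rewrite -!EFinD -EFinM lee_fin mulrC; exact: abcd.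
Qed.

Lemma grad_norm_clarkson u v : sobolev Om r%:E u -> sobolev Om r%:E v ->
  gn (fun x => 2^-1 * (u x + v x)) `^ r + (gn (u \- v) / 2) `^ r <=
  (gn u `^ r + gn v `^ r) / 2.
Proof.
move=> su sv; have [_ _ gu _] := sobolevE oO r1 su; have [_ _ gv _] := sobolevE oO r1 sv.
have gm : weak_gradient Om (fun x => 2^-1 * (u x + v x))
    (fun x => 2^-1 *: (grad Om u x + grad Om v x)).
  have := weak_gradientZ oO 2^-1 (weak_gradientD oO 1 gu gv); congr weak_gradient.
    by apply/funext => x; rewrite mul1r.
  by apply/funext => x; rewrite scale1r.
have gd := weak_gradientZ oO 2^-1 (weak_gradientB oO gu gv).
have sd := sobolevB oO r1 su sv.
have sm := sobolev_midpoint su sv.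
have sd2 : sobolev Om r%:E (fun x => 2^-1 * (u \- v)%R x).
  have := sobolev_lin oO (2^-1 - 1) r1 sd sd.
  by congr sobolev; apply/funext => x /=; ring.
have -> : gn (u \- v) / 2 = gn (fun x => 2^-1 * (u \- v)%R x).
  apply/EFin_inj; rewrite -gnE// grad_normZ// gnE// ger0_norm ?invr_ge0//.
  by rewrite mulrC EFinM.
have mE w G : weak_gradient Om w G -> measurable_fun Om (fun x => (enorm (G x) `^ r)%:E).
  move=> wG; have := measurable_powR_norm r (weak_gradient_measurable oO wG).
  by congr measurable_fun; apply/funext => x; rewrite ger0_norm ?enorm_ge0.
rewrite -lee_fin.
apply: (ler_mean (gnpow sm gm) (gnpow sd2 gd) (gnpow su gu) (gnpow sv gv)).
apply: le_integral_mean => [x|x|x|x|||||x]; try exact: powR_ge0.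
- exact: mE gm.
- exact: mE gd.
- exact: mE gu.
- exact: mE gv.
- exact: clarkson_enorm.
Qed.

(** Here [p] and [q] stand for the energies ([r]-th powers of gradient norms) of two almost
    minimizers, [a] for that of their midpoint, [b] for that of half their difference, and [i] for
    the infimum over a set containing the midpoint. *)
Let halving (J dm dk i a b p q : R) : p <= J + dm -> q <= J + dk -> dk <= dm ->
  J - dm <= i -> i <= a -> a + b <= (p + q) / 2 -> b <= 2 * dm.
Proof. lra. Qed.

Section minimizing.
Variables (C : nat -> set ('rV[R]_n -> R)) (M : R).
Hypotheses (Cdec : forall m, C m.+1 `<=` C m) (C0 : forall m, C m !=set0).
Hypothesis Cmid : forall m u v, C m u -> C m v -> C m (fun x => 2^-1 * (u x + v x)).
Hypothesis Csob : forall m u, C m u -> sobolev Om r%:E u.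
Hypothesis CM : forall m u, C m u -> gn u <= M.

Let I m := inf [set gn u `^ r | u in C m].

Let Cle m k : (m <= k)%N -> C k `<=` C m.
Proof.
elim: k => [|k IH]; first by rewrite leqn0 => /eqP ->.
rewrite leq_eqVlt => /predU1P[-> //|]; rewrite ltnS => /IH; apply: subset_trans; exact: Cdec.
Qed.

Let I_has_inf m : has_inf [set gn u `^ r | u in C m].
Proof.
split; first by have [u Cu] := C0 m; exists (gn u `^ r), u.
by exists 0 => _ [u _ <-]; rewrite powR_ge0.
Qed.

Let I_lb m u : C m u -> I m <= gn u `^ r.
Proof. by move=> Cu; apply: ge_inf; [exact: (I_has_inf m).2|exists u]. Qed.

Let I_has_sup : has_sup (range I).
Proof.
split; first by exists (I 0%N), 0%N.
exists (M `^ r) => _ [m _ <-]; have [u Cu] := C0 m; apply: le_trans (I_lb Cu) _.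
apply: ge0_ler_powR; rewrite ?nnegrE ?gn_ge0//; first exact: ltW.
  exact: le_trans (CM Cu).
exact: (CM Cu).
Qed.

Let I_mono m k : (m <= k)%N -> I m <= I k.
Proof.
move=> mk; apply: lb_le_inf; first exact: (I_has_inf k).1.
by move=> _ [u /(Cle mk) Cu <-]; exact: I_lb.
Qed.

(** As the sets shrink, the infima [I m] of the energies increase to a finite [J]. The midpoint of
    two almost minimizers cannot have energy much below [J], so Clarkson's inequality leaves little
    room for their difference. *)
Lemma minimizing_cauchy : exists c : nat -> 'rV[R]_n -> R, (forall m, C m (c m)) /\
  forall m k, (m <= k)%N -> (grad_norm Om r%:E (c m \- c k)%R <= (2^-1 ^+ m)%:E)%E.
Proof.
pose J := sup (range I).
(* Clarkson's inequality bounds the energy of half the difference by [2 * del m], which is the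
   [r]-th power of [2^(-m) / 2]. *)
pose del m : R := (2^-1 ^+ m / 2) `^ r / 2.
have del0 m : 0 < del m by rewrite divr_gt0// powR_gt0// divr_gt0// exprn_gt0.
have delle m k : (m <= k)%N -> del k <= del m.
  move=> mk; rewrite /del ler_wpM2r// ge0_ler_powR ?nnegrE ?divr_ge0 ?exprn_ge0 ?(ltW r0)//.
  by rewrite ler_wpM2r ?invr_ge0// ler_wiXn2l ?invr_ge0// invf_le1// ler1n.
(* The index is at least [m], so that the function also lies in [C m], and far enough for the
   infimum to be within [del m] of [J]. *)
have H m : exists cK : ('rV[R]_n -> R) * nat,
    [/\ (m <= cK.2)%N, C cK.2 cK.1, gn cK.1 `^ r <= J + del m & J - del m <= I cK.2].
  have [_ [k _ <-] hk] := sup_adherent (del0 m) I_has_sup.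
  have mK := I_mono (leq_maxl k m).
  have [_ [u Cu <-] hu] := inf_adherent (del0 m) (I_has_inf (maxn k m)).
  exists (u, maxn k m); split => /=; [exact: leq_maxr|exact: Cu| |].
    apply: le_trans (ltW hu) _; rewrite lerD2r; apply: ub_le_sup; first exact: I_has_sup.2.
    by exists (maxn k m).
  by apply: le_trans mK; exact: ltW.
have [cK cKP] := choice H.
exists (fun m => (cK m).1); split.
  by move=> m; have [mK Cc _ _] := cKP m; exact: Cle mK _ Cc.
move=> m k mk; have [mm Cm em Im] := cKP m; have [kk Ck ek Ik] := cKP k.
have dmk := delle _ _ mk.
set u := (cK m).1; set v := (cK k).1.
(* The smaller of the two indices: its set contains both functions, hence their midpoint. *)
have [K [KI Ku Kv]] : exists K, [/\ J - del m <= I K, C K u & C K v].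
  have [le|/ltnW le] := leqP (cK m).2 (cK k).2.
    by exists (cK m).2; split => //; exact: Cle le _ Ck.
  exists (cK k).2; split => //; last exact: Cle le _ Cm.
  by apply: le_trans Ik; rewrite lerD2l lerN2.
have lo := I_lb (Cmid Ku Kv).
have := grad_norm_clarkson (Csob Ku) (Csob Kv).
rewrite gnE; last exact: sobolevB (Csob Ku) (Csob Kv).
move=> cl.
have : (gn (u \- v) / 2) `^ r <= (2^-1 ^+ m / 2) `^ r.
  have -> : (2^-1 ^+ m / 2) `^ r = 2 * del m by rewrite /del [RHS]mulrC divfK.
  exact: (halving em ek dmk KI lo cl).
move=> h; rewrite lee_fin; rewrite leNgt; apply/negP => lt.
move: h; apply/negP; rewrite -ltNge; apply: gt0_ltr_powR => //.
- by rewrite nnegrE divr_ge0// exprn_ge0.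
- by rewrite nnegrE divr_ge0.
- by rewrite ltr_pM2r.
Qed.

End minimizing.

(* The uniform bound [eps] identifies the strong limit of the minimizing sequence as [w]. *)
Lemma mazur (C : nat -> set ('rV[R]_n -> R)) (eps : nat -> R) (M : R) w :
  (forall m, C m.+1 `<=` C m) -> (forall m, C m !=set0) ->
  (forall m u v, C m u -> C m v -> C m (fun x => 2^-1 * (u x + v x))) ->
  (forall m u, C m u -> [/\ sobolev0 Om r u, (grad_norm Om r%:E u <= M%:E)%E &
     forall x, Om x -> `|u x - w x| <= eps m]) ->
  eps m @[m --> \oo] --> (0 : R) -> memL Om r%:E w ->
  sobolev0 Om r w /\ forall e : R, 0 < e ->
    exists2 u, C 0%N u & (sobolev_norm Om r%:E (w \- u)%R < e%:E)%E.
Proof.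
move=> Cdec C0 Cmid CP eps0 Lw.
have Cle m : C m `<=` C 0%N by elim: m => // m IH; apply: subset_trans IH; exact: Cdec.
have Csob m u : C m u -> sobolev Om r%:E u by move=> /CP[[]].
have CM m u : C m u -> gn u <= M.
  by move=> Cu; rewrite -lee_fin -gnE; [have [] := CP _ _ Cu|exact: Csob Cu].
have [c [Cc cc]] := minimizing_cauchy Cdec C0 Cmid Csob CM.
have sc m := Csob _ _ (Cc m).
have d0 m : 0 <= (2^-1 ^+ m : R) by rewrite exprn_ge0.
have dS k : \sum_(0 <= i < k) (2^-1 ^+ i) <= 2 :> R.
  have -> : \sum_(0 <= i < k) 2^-1 ^+ i = 2 - 2 * 2^-1 ^+ k :> R.
    by elim: k => [|k IH]; [rewrite big_geq// expr0; lra|rewrite big_nat_recr//= IH exprS; field].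
  by rewrite lerBlDr lerDl mulr_ge0.
have dc : (2^-1 ^+ m : R) @[m --> \oo] --> (0 : R).
  by apply: cvg_expr; rewrite ger0_norm ?invr_ge0// invf_lt1// ltr1n.
have cw : fine (normL Om r%:E (c m \- w)%R) @[m --> \oo] --> (0 : R).
  pose K := fine (mu Om `^ r^-1)%E.
  have KE : (mu Om `^ r^-1)%E = K%:E by rewrite fineK// ge0_fin_numE ?poweR_ge0// poweR_lty.
  have epsK : eps m * K @[m --> \oo] --> (0 : R).
    by rewrite -(mul0r K); apply: cvgMl.
  apply: (@squeeze_cvgr _ _ _ _ (fun=> 0) (fun m => `|eps m| * K)).
  - apply: nearW => m; rewrite fine_ge0 ?normL_ge0//= -lee_fin EFinM -KE.
    have mcw : measurable_fun Om (c m \- w).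
      by apply: measurable_funB; [have [] := sobolevE oO r1 (sc m)|exact: Lw.1].
    have bd : (normL Om r%:E (c m \- w)%R <= `|eps m|%:E * (mu Om `^ r^-1))%E.
      apply: normL_bounded => //; apply/nearW => x Ox /=; apply: le_trans (ler_norm _).
      by have [_ _ ->] := CP _ _ (Cc m).
    rewrite fineK// ge0_fin_numE ?normL_ge0//; apply: le_lt_trans bd _.
    by rewrite KE -EFinM ltry.
  - exact: cvg_cst.
  - rewrite -(mul0r K); apply: cvgMl; rewrite -[X in _ --> X](normr0 R); exact: cvg_norm.
have [sw near_w] := sobolev_limit oO bO r1 sc Lw d0 dS dc cc cw.
have approx (e : R) : 0 < e -> exists2 u, C 0%N u & (sobolev_norm Om r%:E (w \- u)%R < e%:E)%E.
  move=> e0; have [m _ Hm] := near_w e e0; exists (c m); first exact: Cle (Cc m).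
  by apply: Hm => /=.
split => //; apply: (sobolev_cvg_sobolev0 oO bO r1 sw) => e /approx[u Cu ue].
exists u; last exact: ue.
by have [] := CP _ _ Cu.
Qed.

(** [B m] gathers all competitors uniformly close to [w], and not only the [v k], in order to be
    closed under midpoints. Mazur's lemma on the [B m] places [w] in the space with its gradient
    bound; on their intersections with a half-space it yields the convergence of [l (v k)]. *)
Lemma weak_cvg_uniform (v : nat -> 'rV[R]_n -> R) w (M : R) :
  (\forall k \near \oo, sobolev0 Om r (v k) /\ (grad_norm Om r%:E (v k) <= M%:E)%E) ->
  (forall e : R, 0 < e -> \forall k \near \oo, forall x, Om x -> `|v k x - w x| <= e) ->
  memL Om r%:E w ->
  weak_cvg_sobolev0 Om r v w /\ (grad_norm Om r%:E w <= M%:E)%E.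
Proof.
move=> vP vw Lw.
pose eps m : R := m.+1%:R^-1.
have eps0 : eps m @[m --> \oo] --> (0 : R) by exact: cvg_harmonic.
pose B m : set ('rV[R]_n -> R) := [set u | [/\ sobolev0 Om r u,
  (grad_norm Om r%:E u <= M%:E)%E & forall x, Om x -> `|u x - w x| <= eps m]].
have Bdec m : B m.+1 `<=` B m.
  move=> u [su Gu uw]; split => // x Ox; apply: le_trans (uw x Ox) _.
  by rewrite lef_pV2 ?posrE// ler_nat.
have Bmid m u1 u2 : B m u1 -> B m u2 -> B m (fun x => 2^-1 * (u1 x + u2 x)).
  move=> [su1 Gu1 uw1] [su2 Gu2 uw2]; split.
  - have := sobolev0_lin oO bO 2^-1 r1 su1 (sobolev0Z oO bO 2^-1 r1 su2).
    by congr sobolev0; apply/funext => x; ring.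
  - have s3 := sobolev_midpoint su1.1 su2.1; rewrite gnE// lee_fin.
    have s12 := sobolev_lin oO 1 r1 su1.1 su2.1.
    have -> : (fun x => 2^-1 * (u1 x + u2 x)) = (fun x => 2^-1 * (1 * u1 x + u2 x)).
      by apply/funext => x; rewrite mul1r.
    rewrite -lee_fin -gnE; last first.
      by move: s3; congr sobolev; apply/funext => x; rewrite mul1r.
    rewrite grad_normZ// ger0_norm ?invr_ge0//.
    apply: (@le_trans _ _ (2^-1%:E * (M + M)%:E)%E).
      rewrite lee_wpmul2l ?lee_fin ?invr_ge0//; apply: le_trans (grad_norm_lin oO 1 r1 su1.1 su2.1) _.
      by rewrite normr1 mul1e EFinD; exact: (leeD Gu1 Gu2).
    by rewrite -EFinM lee_fin; lra.
  - move=> x Ox; have := uw1 x Ox; have := uw2 x Ox.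
    have -> : 2^-1 * (u1 x + u2 x) - w x = 2^-1 * ((u1 x - w x) + (u2 x - w x)) by field.
    rewrite normrM ger0_norm ?invr_ge0// => h2 h1.
    have := ler_normD (u1 x - w x) (u2 x - w x); lra.
have Bv m : \forall k \near \oo, B m (v k).
  near=> k; have [sv Gv] : sobolev0 Om r (v k) /\ (grad_norm Om r%:E (v k) <= M%:E)%E by near: k.
  split => //; near: k; apply: vw; by rewrite /eps invr_gt0.
have B0 m : B m !=set0.
  by have [N _ HN] := Bv m; exists (v N); apply: HN => /=.
have BP m u : B m u -> [/\ sobolev0 Om r u, (grad_norm Om r%:E u <= M%:E)%E &
  forall x, Om x -> `|u x - w x| <= eps m] by [].
have [sw approxw] := mazur Bdec B0 Bmid BP eps0 Lw.
split; last first.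
  (* The strong approximants of [w] lie in [B 0], so their bound [M] carries over. *)
  apply/lee_addgt0Pr => e /approxw[u [su Gu _] wu].
  have := grad_norm_lin oO 1 r1 (sobolevB oO r1 sw.1 su.1) su.1.
  rewrite (_ : (fun x => _ + _) = w); last by apply/funext => x /=; ring.
  rewrite normr1 mul1e addeC => /le_trans; apply; apply: leeD => //.
  by apply: ltW; apply: le_lt_trans wu; rewrite /sobolev_norm leeDr// normL_ge0.
split => //; first by near=> k; have [] : sobolev0 Om r (v k) /\ (grad_norm Om r%:E (v k) <= M%:E)%E by near: k.
move=> l [llin [K lK]].
have llB u1 u2 : sobolev0 Om r u1 -> sobolev0 Om r u2 -> l (u1 \- u2) = l u1 - l u2.
  move=> s1 s2; have := llin (-1) u2 u1 s2 s1; rewrite mulN1r addrC => <-.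
  by congr l; apply/funext => x /=; ring.
(* Otherwise the members of [B m] with [e <= s * (l u - l w)] form a decreasing sequence
   of midpoint-closed sets, and Mazur's lemma yields [u] among them close to [w]. *)
have empty (s e : R) : 0 < e -> exists m, forall u, B m u -> s * (l u - l w) < e.
  move=> e0; apply: contrapT => /forallNP H.
  pose C m := [set u | B m u /\ e <= s * (l u - l w)].
  have Cdec m : C m.+1 `<=` C m by move=> u [/Bdec].
  have C0 m : C m !=set0.
    by apply: contrapT => C0; apply: (H m) => u Bu; rewrite ltNge; apply/negP => h; apply: C0; exists u.
  have Cmid m u1 u2 : C m u1 -> C m u2 -> C m (fun x => 2^-1 * (u1 x + u2 x)).
    move=> [B1 e1] [B2 e2]; split; first exact: Bmid.
    have [s1 _ _] := B1; have [s2 _ _] := B2.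
    have -> : (fun x => 2^-1 * (u1 x + u2 x)) = (fun x => 2^-1 * u1 x + (2^-1 * u2 x)).
      by apply/funext => x; ring.
    rewrite (llin _ _ _ s1 (sobolev0Z oO bO 2^-1 r1 s2)).
    have -> : l (fun x => 2^-1 * u2 x) = 2^-1 * l u2.
      have := llin (2^-1 - 1) u2 u2 s2 s2.
      rewrite (_ : (fun x => _ + _) = (fun x => 2^-1 * u2 x)); last by apply/funext => x; ring.
      by move=> ->; ring.
    by lra.
  have [_ approxC] := mazur Cdec C0 Cmid (fun m u Cu => BP m u Cu.1) eps0 Lw.
  (* The added [1] makes [|s| |K| e / D] strictly smaller than [e], contrary to the lower bound [e]
     for members of [C 0]. *)
  pose D := `|s| * `|K| + 1.
  have D0 : 0 < D by rewrite ltr_wpDl// mulr_ge0.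
  have [u [[su _ _] eu] wu] := approxC _ (divr_gt0 e0 D0).
  have := lK _ (sobolev0B oO bO r1 sw su); rewrite llB// => h.
  have {}h : `|l w - l u| <= `|K| * (e / D).
    rewrite -lee_fin EFinM; apply: le_trans h _.
    apply: (@le_trans _ _ (`|K|%:E * sobolev_norm Om r%:E (w \- u)%R)%E).
      by rewrite lee_wpmul2r ?sobolev_norm_ge0// lee_fin ler_norm.
    by rewrite lee_wpmul2l ?lee_fin// ltW.
  have : s * (l u - l w) <= `|s| * (`|K| * (e / D)).
    apply: le_trans (ler_norm _) _; rewrite normrM distrC; exact: ler_wpM2l.
  rewrite mulrA => h2; have := le_trans eu h2.
  rewrite mulrCA -ler_pdivrMl// mulVf ?gt_eqF// ler_pdivlMr// mul1r /D.
  by rewrite gerDl ler10.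
apply/cvgrPdist_lt => e e0.
(* The two signs of [s] bound [l (v k) - l w] from above and from below. *)
have [m1 H1] := empty 1 e e0; have [m2 H2] := empty (-1) e e0.
near=> k.
have h1 : B m1 (v k) by near: k; exact: Bv.
have h2 : B m2 (v k) by near: k; exact: Bv.
rewrite ltr_norml; have := H1 _ h1; have := H2 _ h2; lra.
Unshelve. all: by end_near. Qed.

End mazur.

Lemma continuous_lip_enorm {R : realType} {n : nat} (f : 'rV[R]_n -> R) (L : R) : 0 <= L ->
  (forall x y, `|f x - f y| <= L * enorm (x - y)) -> continuous f.
Proof.
move=> L0 fL x; apply/(@cvgrPdist_le _ _ _ (nbhs x)) => e e0; near=> y.
have C0 : 0 < L * n%:R + 1 by rewrite ltr_wpDl// mulr_ge0.
apply: le_trans (fL x y) _; apply: (@le_trans _ _ ((L * n%:R + 1) * `|x - y|)).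
  apply: (@le_trans _ _ (L * (n%:R * `|x - y|))).
    by rewrite ler_wpM2l// ler_enorm_norm.
  by rewrite mulrA ler_wpM2r// lerDl.
rewrite -ler_pdivlMl//; near: y; apply: cvgr_dist_le; first exact: cvg_id.
by rewrite mulr_gt0// invr_gt0 ltr_wpDl// mulr_ge0.
Unshelve. all: by end_near. Qed.

Lemma cvg_powR_exponent {R : realType} {T : Type} {F : set_system T} {FF : Filter F}
    (t : T -> R) (b : R) : 0 < b ->
  t x @[x --> F] --> (0 : R) -> b `^ t x @[x --> F] --> (1 : R).
Proof.
move=> b0 t0.
have E x : b `^ x = expR (x * ln b) by rewrite /powR gt_eqF.
rewrite (_ : (fun x => _) = (fun x => expR (t x * ln b))); last exact/funext.
have t0' : t x * ln b @[x --> F] --> (0 : R) by rewrite -(mul0r (ln b)); apply: cvgMl.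
rewrite -(@expR0 R); apply: continuous_cvg t0'; exact: continuous_expR.
Qed.

(** * Distance to the boundary *)

Section distance_to_boundary.
Context {R : realType} {n : nat} (Om : set 'rV[R]_n).
Hypotheses (oO : open Om) (bO : bounded_set Om) (nO : Om !=set0) (n0 : (0 < n)%N).
Local Notation rho := (dist_boundary Om).

Lemma boundary_notin z : boundary Om z -> ~ Om z.
Proof. by move=> [_ +] Oz; apply; move: oO; rewrite openE; apply. Qed.

(** At the supremum [ts] of the parameters for which the segment is in [Om], the point is in the
    closure; were it interior, the segment would still be in [Om] slightly beyond [ts]. *)
Lemma exit_point x y : Om x -> ~ Om y ->
  exists2 z, boundary Om z & enorm (z - x) <= enorm (y - x).
Proof.
move=> Ox Oy; pose g (t : R) := x + t *: (y - x).
have cg : continuous g.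
  by move=> t; apply: cvgD; [exact: cvg_cst|apply: cvgZl; exact: cvg_id].
pose S := [set t : R | 0 <= t <= 1 /\ Om (g t)].
have S0 : S 0 by split; [rewrite lexx ler01|rewrite /g scale0r addr0].
have supS : has_sup S by split; [exists 0|exists 1 => t [/andP[]]].
pose ts := sup S.
have ts0 : 0 <= ts by apply: ub_le_sup => //; exact: supS.2.
have ts1 : ts <= 1 by apply: ge_sup; [exists 0|move=> t [/andP[]]].
exists (g ts).
  split.
    move=> B /cg /nbhs_ballP[e /= e0 eB].
    have [t St lt] := sup_adherent e0 supS.
    exists (g t); split; first by case: St.
    apply: eB; rewrite /ball/= ger0_norm ?subr_ge0.
      by rewrite ltrBlDl -ltrBlDr.
    by apply: ub_le_sup => //; exact: supS.2.
  move=> /interior_subset Og.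
  have ts_lt1 : ts < 1.
    rewrite lt_neqAle ts1 andbT; apply/eqP => E; apply: Oy.
    by move: Og; rewrite E /g scale1r addrC subrK.
  have /cg /nbhs_ballP[e /= e0 eB] := open_nbhs_nbhs (conj oO Og).
  pose m := Num.min (e / 2) (1 - ts).
  have m0 : 0 < m by rewrite lt_min divr_gt0//= subr_gt0.
  have St : S (ts + m).
    split; last first.
      apply: eB; rewrite /ball/= opprD addrA subrr add0r normrN gtr0_norm//.
      by apply: (@le_lt_trans _ _ (e / 2)); [rewrite ge_min lexx|rewrite gtr_pMr// invf_lt1// ltr1n].
    rewrite addr_ge0 ?(ltW m0)//=.
    by rewrite -lerBrDl ge_min lexx orbT.
  have := ub_le_sup supS.2 St; rewrite -/ts gerDl leNgt m0.
  by [].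
rewrite /g addrC addKr enormZ ger0_norm//.
by rewrite ler_piMl// enorm_ge0.
Qed.

Lemma boundary_neq0 : boundary Om !=set0.
Proof.
have [M M0 OM] := bounded_cbox_sub bO; have [x Ox] := nO.
(* This point lies outside [Om] because all coordinates in [Om] are at most [M], and the positive
   dimension provides a coordinate to look at. *)
have [|z Bz _] := @exit_point x (const_mx (M + 1)) Ox; last by exists z.
move=> /OM /(_ (Ordinal n0)); rewrite !mxE => /andP[_].
by rewrite gerDl ler10.
Qed.

Lemma dist_boundary_le x z : boundary Om z -> rho x <= enorm (x - z).
Proof.
move=> Bz; rewrite enorm_sub; apply: ge_inf; last by exists z.
by exists 0 => _ [y _ <-]; exact: enorm_ge0.
Qed.

Lemma le_dist_boundary x (c : R) :
  (forall z, boundary Om z -> c <= enorm (x - z)) -> c <= rho x.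
Proof.
move=> h; apply: lb_le_inf; first by have [z Bz] := boundary_neq0; exists (enorm (z - x)), z.
by move=> _ [z Bz <-]; rewrite enorm_sub; exact: h.
Qed.

Lemma dist_boundary_ge0 x : 0 <= rho x.
Proof. by apply: le_dist_boundary => z _; exact: enorm_ge0. Qed.

Lemma dist_boundary_lip x y : `|rho x - rho y| <= enorm (x - y).
Proof.
have H a b : rho a - rho b <= enorm (a - b).
  rewrite lerBlDr -lerBlDl; apply: le_dist_boundary => z Bz.
  rewrite lerBlDl; apply: le_trans (dist_boundary_le a Bz) _; exact: ler_enorm_trans.
by rewrite ler_norml lerNl opprB H andbT enorm_sub H.
Qed.

Lemma ball_dist_boundary x y : Om x -> enorm (y - x) < rho x -> Om y.
Proof.
move=> Ox xy; apply: contrapT => Oy; have [z Bz] := exit_point Ox Oy.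
rewrite enorm_sub => /(le_trans (dist_boundary_le x Bz)).
by rewrite leNgt xy.
Qed.

Lemma dist_boundary_gt0 x : Om x -> 0 < rho x.
Proof.
move=> Ox; have /nbhs_ballP[e /= e0 eO] := open_nbhs_nbhs (conj oO Ox).
apply: lt_le_trans e0 _; apply: le_dist_boundary => z /boundary_notin Oz.
rewrite leNgt; apply/negP => h; apply: Oz; apply: eO; rewrite -ball_normE /=.
by apply: le_lt_trans h; exact: ler_norm_enorm.
Qed.

Lemma dist_boundary_bounded : exists M, forall x, Om x -> rho x <= M.
Proof.
have [M M0 OM] := bounded_cbox_sub bO; have [z Bz] := boundary_neq0.
exists (n%:R * M + enorm z) => x Ox; apply: le_trans (dist_boundary_le x Bz) _.
apply: le_trans (ler_enormD _ _) _; rewrite enormN lerD2r.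
apply: le_trans (ler_enorm_norm _) _; rewrite ler_wpM2l//.
by apply/norm_leP; [exact: ltW|move=> i; have := OM _ Ox i; rewrite !mxE ler_norml].
Qed.

(** The number [||rho||_oo] as a real. The supremum is restricted to [Om] because [dist_boundary] is
    unsigned and grows without bound outside. *)
Definition inradius := sup [set rho x | x in Om].

Lemma inradius_has_sup : has_sup [set rho x | x in Om].
Proof.
split; first by have [x Ox] := nO; exists (rho x), x.
by have [M HM] := dist_boundary_bounded; exists M => _ [x Ox <-]; exact: HM.
Qed.

Lemma dist_boundary_inradius x : Om x -> rho x <= inradius.
Proof. by move=> Ox; apply: ub_le_sup; [exact: inradius_has_sup.2|exists x]. Qed.

Lemma inradius_gt0 : 0 < inradius.
Proof.
have [x Ox] := nO; apply: lt_le_trans (dist_boundary_gt0 Ox) _.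
exact: dist_boundary_inradius.
Qed.

Lemma cone_competitor (c : R) : 0 < c -> c < inradius ->
  exists phi x0, [/\ test_function Om phi, Om x0, c <= phi x0,
    forall x, 0 <= phi x <= phi x0 & forall x, enorm (gradient phi x) <= 1].
Proof.
(* One third of the gap for each loss: the choice of the centre [x0], the regularized distance at
   [x0], and the regularized positive part. *)
move=> c0 cR; have e0 : 0 < (inradius - c) / 3 by rewrite divr_gt0// subr_gt0.
have [_ [x0 Ox0 <-] hx] := sup_adherent e0 inradius_has_sup.
pose e := (inradius - c) / 3; rewrite -/inradius -/e in hx e0.
have er : e < rho x0 by rewrite /e in hx *; lra.
exists (cone x0 (rho x0) e e), x0; split.
- by apply: cone_test => // y; exact: ball_dist_boundary.
- by [].
- by apply: le_trans (cone_center_ge _ e e0 er); rewrite /e in hx *; lra.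
- by move=> x; rewrite cone_ge0 cone_le.
- by move=> x; exact: enorm_gradient_cone.
Qed.

End distance_to_boundary.

Section normL_infinity.
Context {R : realType} {n : nat} (Om : set 'rV[R]_n).
Local Notation mu := (lebesgue_measure_rV R n).
Hypotheses (oO : open Om) (bO : bounded_set Om) (nO : Om !=set0).
Implicit Types (f : 'rV[R]_n -> R).

Let mO : measurable Om := measurable_open_rV oO.
Let fO : (mu Om < +oo)%E := domain_measure_lty oO bO.

Let mu0 : (0 < mu setT)%E.
Proof. by apply: open_measure_gt0; [exact: openT|exists 0]. Qed.

Lemma normL_oo_leP f (M : R) : 0 <= M ->
  (normL Om +oo f <= M%:E)%E <-> {ae mu, forall x, Om x -> `|f x| <= M}.
Proof.
move=> M0; rewrite normLE unlock mu0; split.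
  move=> /ess_supP; apply: filterS => x /= + Ox.
  by rewrite /patch mem_set// lee_fin.
move=> H; apply/ess_supP; apply: filterS H => x /= H.
by rewrite /patch; case: ifPn => [/set_mem/H|_]; rewrite lee_fin// normr0.
Qed.

(** Nonempty open sets have positive measure, so an essential bound on a continuous function holds
    at every point. *)
Lemma normL_oo_ge f x (M : R) : {in Om, continuous f} -> Om x -> 
  (normL Om +oo f <= M%:E)%E -> `|f x| <= M.
Proof.
move=> cf Ox fM; have M0 : 0 <= M by rewrite -lee_fin; apply: le_trans fM; exact: normL_ge0.
have [N [mN N0 HN]] := (normL_oo_leP f M0).1 fM.
rewrite leNgt; apply/negP => lt.
have : nbhs x [set y | Om y /\ M < `|f y|].
  have cn := @cvg_norm _ _ _ (nbhs x) (nbhs_filter x) f (f x) (cf x (mem_set Ox)).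
  near=> y; split; first by near: y; exact: open_nbhs_nbhs.
  near: y; exact: (cvgr_gt _ cn).
rewrite nbhsE => -[B [oB Bx] BP].
have B0 : (0 < mu B)%E by apply: open_measure_gt0 => //; exists x.
have : (mu B <= mu N)%E.
  apply: le_measure; rewrite ?inE//; first exact: measurable_open_rV.
  move=> y /BP[Oy fy]; apply: HN => /= /(_ Oy); by rewrite leNgt fy.
by rewrite N0 leNgt B0.
Unshelve. all: by end_near. Qed.

Lemma normL_oo_sup f (M : R) : 0 <= M -> {in Om, continuous f} ->
  (forall x, Om x -> `|f x| <= M) -> (forall e, 0 < e -> exists2 x, Om x & M - e <= `|f x|) ->
  normL Om +oo f = M%:E.
Proof.
move=> M0 cf fM Mf; have le : (normL Om +oo f <= M%:E)%E.
  by apply/(normL_oo_leP _ M0); apply/nearW.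
have [c cE] : exists c, normL Om +oo f = c%:E.
  by exists (fine (normL Om +oo f)); rewrite fineK// ge0_fin_numE ?normL_ge0// (le_lt_trans le)// ltry.
rewrite cE; congr EFin; apply/eqP; rewrite eq_le; apply/andP; split.
  by rewrite -lee_fin -cE.
apply/ler_addgt0Pr => e /Mf[x Ox h]; rewrite -lerBlDr; apply: le_trans h _.
by apply: normL_oo_ge => //; rewrite cE.
Qed.

(** If [|f| > c] on a set of measure [a > 0], then [c a^(1/p) <= L o^(1/p)] for large [p], where [o]
    is the measure of [Om]. Both powers tend to [1], so [c <= L]; this is applied to
    [c = L + 1 / (k + 1)]. *)
Lemma normL_oo_limit f (L p0 : R) : 0 <= L -> measurable_fun Om f ->
  (forall p, p0 < p -> (normL Om p%:E f <= L%:E * mu Om `^ p^-1)%E) ->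
  (normL Om +oo f <= L%:E)%E.
Proof.
move=> L0 mf H; apply/(normL_oo_leP _ L0).
have Hk (k : nat) : {ae mu, forall x, Om x -> `|f x| <= L + k.+1%:R^-1}.
  pose c := L + k.+1%:R^-1; pose A := Om `&` [set x | c < `|f x|].
  have c0 : 0 < c by rewrite ltr_wpDl// invr_gt0.
  have mA : measurable A.
    have := @measurableT_comp _ _ _ _ _ _ (@Num.Def.normr R R) Om f (@normr_measurable _ _) mf.
    move=> /(_ mO `]c, +oo[%classic (measurable_itv _)).
    rewrite (_ : _ @^-1` _ = [set x | c < `|f x|])//.
    by apply/seteqP; split => x /=; rewrite in_itv/= andbT.
  have mfA : measurable_fun A f by apply: measurable_funS mf => // x [].
  exists A; split => //; last first.
    move=> x /= /not_implyP[Ox /negP]; rewrite -ltNge => h; split => //.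
  apply/eqP; rewrite eq_le measure_ge0 andbT leNgt; apply/negP => A0.
  have Aoo : (mu A < +oo)%E.
    by apply: le_lt_trans fO; apply: le_measure; rewrite ?inE//; exact: subIsetl.
  pose a := fine (mu A); have aE : mu A = a%:E by rewrite fineK// ge0_fin_numE.
  pose o := fine (mu Om); have oE : mu Om = o%:E by rewrite fineK// ge0_fin_numE.
  have a0 : 0 < a by rewrite -lte_fin -aE.
  have o0 : 0 < o by rewrite -lte_fin -oE; apply: open_measure_gt0.
  have key p : p0 < p -> 0 < p -> c * a `^ p^-1 <= L * o `^ p^-1.
    move=> pp p00; rewrite -lee_fin !EFinM -!poweR_EFin -aE -oE.
    apply: le_trans (H p pp); rewrite -(normL_cst mA p00 (ltW c0)).
    apply: (@le_trans _ _ (normL A p%:E f)).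
      apply: le_normL; [exact: mA|by rewrite lte_fin|exact: measurable_cst|exact: mfA|].
      by apply/nearW => x [_ /ltW]; rewrite (ger0_norm (ltW c0)).
    by apply: (normL_subset mA mO _ p00 mf) => x [].
  have lim b : 0 < b -> b `^ (m.+1%:R^-1) @[m --> \oo] --> (1 : R).
    by move=> b0; apply: cvg_powR_exponent => //; exact: cvg_harmonic.
  have : c <= L.
    rewrite -[c]mulr1 -[L]mulr1.
    have h1 : c * a `^ (m.+1%:R^-1) @[m --> \oo] --> c * 1 by apply: cvgMr; exact: lim.
    have h2 : L * o `^ (m.+1%:R^-1) @[m --> \oo] --> L * 1 by apply: cvgMr; exact: lim.
    apply: (@ler_cvg_to _ _ _ _ _ _ _ _ h1 h2).
    near=> m; apply: key; last by [].
    by apply: (@lt_trans _ _ m%:R); [near: m; exact: nbhs_infty_gtr|rewrite ltr_nat].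
  by rewrite gerDl leNgt invr_gt0 ltr0n.
have : {ae mu, forall x, forall k, Om x -> `|f x| <= L + k.+1%:R^-1} by apply/ae_foralln.
apply: filterS => x hx Ox; apply/ler_addgt0Pr => e e0.
have [k ke] : exists k : nat, k.+1%:R^-1 < e.
  exists (Num.bound e^-1); rewrite invf_plt ?posrE//.
  by apply: (lt_trans (archi_boundP _)); rewrite ?invr_ge0 ?(ltW e0)// ltr_nat.
by apply: le_trans (hx k Ox) _; rewrite lerD2l ltW.
Unshelve. all: by end_near. Qed.

End normL_infinity.

(** Compactness gives a cluster point, and an ultrafilter contains each neighbourhood of it or the
    complement; the complement is excluded by the cluster property. *)
Lemma ultra_cvg_compact {T : Type} {X : topologicalType} (U : set_system T) (f : T -> X)
    (K : set X) : UltraFilter U -> compact K -> (forall t, K (f t)) ->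
  exists2 l, K l & f t @[t --> U] --> l.
Proof.
move=> UU cK fK; have PU : ProperFilter U by exact: ultra_proper.
have fU : (f @ U) K by exact: filterE fK.
have [l [Kl cl]] := cK (f @ U) (fmap_proper_filter f PU) fU.
exists l => // B Bl; have [//|h] := in_ultra_setVsetC (f @^-1` B) UU.
have [y [/= By nBy]] := cl _ _ (h : (f @ U) (~` B)) Bl.
by case: By.
Qed.

(** * Extremal functions and their limits *)

Section extremal.
Context {R : realType} {n : nat} (Om : set 'rV[R]_n).
Local Notation mu := (lebesgue_measure_rV R n).
Hypotheses (oO : open Om) (bO : bounded_set Om) (nO : Om !=set0) (n0 : (0 < n)%N).

Let mO : measurable Om := measurable_open_rV oO.
Let fO : (mu Om < +oo)%E := domain_measure_lty oO bO.

Definition vol : R := fine (mu Om).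

Lemma volE : mu Om = vol%:E.
Proof. by rewrite /vol fineK// ge0_fin_numE. Qed.

Lemma vol_gt0 : 0 < vol.
Proof. by rewrite -lte_fin -volE; exact: open_measure_gt0. Qed.

Variable p : R.
Hypothesis np : n%:R < p.

Let p1 : 1 <= p. Proof. by apply: le_trans (ltW np); rewrite ler1n. Qed.
Let p0 : 0 < p := lt0_le1 p1.

(** The competitor is [phi / phi x0], whose gradient is at most [1 / phi x0] on a set of measure
    [vol]. *)
Lemma test_function_Lambda_le (phi : 'rV[R]_n -> R) (x0 : 'rV[R]_n) :
  test_function Om phi -> Om x0 -> 0 < phi x0 -> (forall x, 0 <= phi x <= phi x0) ->
  (forall x, enorm (gradient phi x) <= 1) ->
  (Lambda Om p <= (((phi x0)^-1 * vol `^ p^-1) `^ p)%:E)%E.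
Proof.
move=> tphi Ox0 m0 phim gphi; have im0 : 0 <= (phi x0)^-1 by rewrite invr_ge0 ltW.
pose v x := (phi x0)^-1 * phi x.
have sphi := sobolev0_test oO bO p1 tphi.
have sv : sobolev0 Om p v by exact: sobolev0Z.
have v1 : normL Om +oo v = 1%E.
  apply: (normL_oo_sup oO ler01).
  - by move=> x _; exact: (test_continuous (test_functionZ _ tphi)).
  - move=> x _; rewrite /v normrM !ger0_norm ?(andP (phim x)).1//.
    by rewrite ler_pdivrMl// mulr1; have /andP[] := phim x.
  - by move=> e e0; exists x0 => //; rewrite /v mulVf ?gt_eqF// normr1 gerBl ltW.
apply: (@le_trans _ _ (grad_norm Om p%:E v `^ p)%E).
  by apply: ereal_inf_lbound; exists v.
rewrite -poweR_EFin; apply: gt0_ler_poweR; first exact: ltW.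
- by rewrite in_itv/= leey andbT normL_ge0.
- by rewrite in_itv/= leey andbT lee_fin mulr_ge0// powR_ge0.
rewrite (grad_normZ oO p1 _ sphi.1) (test_grad_norm oO bO p1 tphi) ger0_norm// EFinM.
rewrite lee_wpmul2l// -poweR_EFin -volE.
have := @normL_bounded _ _ Om mO p (fun x => enorm (gradient phi x)) 1 p0 ler01.
rewrite mul1e; apply.
  exact: (weak_gradient_measurable oO (test_weak_gradient oO bO tphi)).
by apply/nearW => x _; rewrite ger0_norm ?enorm_ge0.
Qed.

Variable u : 'rV[R]_n -> R.
Hypothesis pu : positive_extremal Om p u.

Lemma extremal_continuous : {in Om, continuous u}.
Proof.
have [_ cu _ _ _] := pu; rewrite -continuous_open_subspace//.
apply: continuous_subspaceW cu; exact: subset_closure.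
Qed.

Lemma extremal_le1 x : Om x -> 0 < u x <= 1.
Proof.
move=> Ox; have [_ _ u0 u1 _] := pu; rewrite u0//=.
apply: le_trans (ler_norm _) _; apply: (normL_oo_ge oO extremal_continuous Ox).
by rewrite u1.
Qed.

Lemma extremal_max x0 : unique_max_point Om u x0 -> u x0 = 1.
Proof.
move=> [Ox0 ux0]; have [_ _ u0 u1 _] := pu; apply/eqP; rewrite eq_le.
have /andP[_ ->] /= := extremal_le1 Ox0.
rewrite -lee_fin -u1; apply: (normL_oo_leP Om u (ltW (u0 _ Ox0))).2.
apply/nearW => y Oy; rewrite gtr0_norm ?u0//.
by have [->//|yx] := eqVneq y x0; exact/ltW/ux0.
Qed.

(** Cones of height at least [c] give the estimate with any [c < inradius Om] in place of the
    inradius, after a [p]-th root; [c] is then pushed up to the inradius. *)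
Lemma extremal_grad_le :
  (grad_norm Om p%:E u <= (vol `^ p^-1 / inradius Om)%:E)%E.
Proof.
have [su _ _ _ uL] := pu; have R0 := inradius_gt0 oO bO nO n0.
have [_ _ _ Gu] := sobolevE oO p1 su.1.
pose g := fine (grad_norm Om p%:E u).
have gE : grad_norm Om p%:E u = g%:E by rewrite fineK// ge0_fin_numE ?normL_ge0.
have g0 : 0 <= g by rewrite fine_ge0// normL_ge0.
have key c : 0 < c -> c < inradius Om -> g * c <= vol `^ p^-1.
  move=> c0 cR; have [phi [x0 [tphi Ox0 cphi phim gphi]]] := cone_competitor oO bO nO n0 c0 cR.
  have m0 : 0 < phi x0 by exact: lt_le_trans cphi.
  have := test_function_Lambda_le tphi Ox0 m0 phim gphi.
  rewrite -uL gE poweR_EFin lee_fin => h.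
  have : g <= (phi x0)^-1 * vol `^ p^-1.
    rewrite leNgt; apply/negP => lt; move: h; apply/negP; rewrite -ltNge.
    apply: gt0_ltr_powR => //; rewrite nnegrE// mulr_ge0// ?powR_ge0// invr_ge0 ltW//.
  rewrite ler_pdivlMl// mulrC; apply: le_trans; rewrite ler_wpM2l//.
rewrite gE lee_fin ler_pdivlMr// leNgt; apply/negP => lt.
have g1 : 0 < g by rewrite lt_neqAle g0 andbT; apply/eqP => g00; move: lt; rewrite -g00 mul0r ltNge powR_ge0.
(* If the claim fails, this lies strictly between [vol^(1/p) / g] and the inradius, contradicting
   [key]. *)
pose c := (vol `^ p^-1 / g + inradius Om) / 2.
have vg : vol `^ p^-1 / g < inradius Om by rewrite ltr_pdivrMr// mulrC.
have vg0 : 0 <= vol `^ p^-1 / g by rewrite divr_ge0// powR_ge0.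
have := key c; rewrite {1}/c {1}/c => /(_ ltac:(lra) ltac:(lra)).
rewrite leNgt mulrC -ltr_pdivrMr// /c; lra.
Qed.

(** The powers of the volume recombine as [1/p + (1/q - 1/p) = 1/q], so the resulting bound does not
    depend on [p]. *)
Lemma extremal_grad_sub q : 1 <= q -> q <= p ->
  (grad_norm Om q%:E u <= (vol `^ q^-1 / inradius Om)%:E)%E.
Proof.
move=> q1 qp; have q0 : 0 < q := lt0_le1 q1; have R0 := inradius_gt0 oO bO nO n0.
have [su _ _ _ _] := pu; have [_ _ gu _] := sobolevE oO p1 su.1.
apply: le_trans (grad_norm_hoelder oO q0 qp gu) _.
apply: (@le_trans _ _ ((vol `^ p^-1 / inradius Om)%:E * (vol `^ (q^-1 - p^-1))%:E)%E).
  by rewrite volE poweR_EFin lee_wpmul2r ?lee_fin ?powR_ge0// extremal_grad_le.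
rewrite -EFinM lee_fin mulrAC -powRD; last by rewrite (gt_eqF vol_gt0) implybT.
by rewrite addrCA subrr addr0.
Qed.

Lemma extremal_morrey x y s : 0 < s ->
  `|patch (fun=> 0) Om u x - patch (fun=> 0) Om u y| <=
  morrey_const (n := n) p s (enorm (x - y)) * (vol `^ p^-1 / inradius Om).
Proof.
move=> s0; have [su _ _ _ _] := pu.
apply: le_trans (morrey_sobolev0 oO bO n0 np su extremal_continuous x y s0) _.
apply: ler_wpM2l.
  by apply: morrey_const_ge0; rewrite ?enorm_ge0 ?(ltW s0).
have [_ _ _ Gu] := sobolevE oO p1 su.1.
by rewrite -lee_fin fineK ?extremal_grad_le// ge0_fin_numE ?normL_ge0.
Qed.

End extremal.

Lemma continuous_enorm_sub {R : realType} {n : nat} (x : 'rV[R]_n) :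
  continuous (fun y : 'rV[R]_n => enorm (y - x)).
Proof.
apply: (continuous_lip_enorm ler01) => y z.
have := ler_enorm_trans z y x; have := ler_enorm_trans y z x.
by rewrite mul1r (enorm_sub z y) ler_distl; lra.
Qed.

(** * Limits along a filter of functions with Morrey bounds of exponent tending to infinity *)

Section morrey_limit.
Context {R : realType} {n : nat}.
Implicit Types (s d V : R).
Context {F : set_system nat} {PF : ProperFilter F}.
Variables (p : nat -> R) (f : nat -> 'rV[R]_n -> R) (w : 'rV[R]_n -> R) (V L : R).
Hypotheses (V0 : 0 < V) (L0 : 0 <= L) (n0 : (0 < n)%N).
Hypothesis np : \forall k \near F, n%:R < p k.
Hypothesis pinf : (p k)^-1 @[k --> F] --> (0 : R).
Hypothesis fM : \forall k \near F, forall x y s, 0 < s ->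
  `|f k x - f k y| <= morrey_const (n := n) (p k) s (enorm (x - y)) * (V `^ (p k)^-1 * L).

Lemma cvg_morrey_const s d : 0 < s ->
  morrey_const (n := n) (p k) s d * (V `^ (p k)^-1 * L) @[k --> F] --> (d + n%:R * s) * L.
Proof.
move=> s0; have np0 : n%:R / p k @[k --> F] --> (0 : R).
  by rewrite -(mulr0 n%:R); apply: cvgMr.
have h1 : s `^ (- (n%:R / p k)) @[k --> F] --> (1 : R).
  by apply: cvg_powR_exponent => //; rewrite -(oppr0 R); apply: cvgN.
have h2 : (1 - n%:R / p k)^-1 @[k --> F] --> (1 : R).
  have h : 1 - n%:R / p k @[k --> F] --> (1 : R).
    by rewrite -[X in _ --> X](subr0 (1 : R)); apply: cvgB => //; exact: cvg_cst.
  have h' := cvgV (oner_neq0 R) h; rewrite invr1 in h'; exact: h'.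
have h3 : V `^ (p k)^-1 @[k --> F] --> (1 : R) by exact: cvg_powR_exponent.
rewrite -[X in _ --> X](_ : (d + n%:R * s) * 1 * 1 * (1 * L) = _); last by ring.
apply: cvgM; last exact: cvgMl.
by apply: cvgM => //; exact: cvgMr.
Qed.

Lemma morrey_equicontinuous (e : R) : 0 < e -> exists2 del : R, 0 < del &
  \forall k \near F, forall x y, enorm (x - y) <= del -> `|f k x - f k y| <= e.
Proof.
(* At distance [s] with side [s] the limiting modulus is [(s + n s) L], which this choice puts below
   [e]; [L + 1] stands for [L] because [L] may be [0]. *)
move=> e0; pose s := e / ((1 + n%:R) * (L + 1)) / 2.
have C0 : 0 < (1 + n%:R) * (L + 1) :> R by apply: mulr_gt0; [rewrite addr_gt0 ?ltr0n|rewrite ltr_wpDl].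
have s0 : 0 < s by rewrite !divr_gt0.
exists s => //.
have lt : (s + n%:R * s) * L < e.
  apply: (@le_lt_trans _ _ (s * ((1 + n%:R) * (L + 1)))).
    rewrite mulrA (_ : s + n%:R * s = s * (1 + n%:R)); last by ring.
    by rewrite ler_wpM2l ?lerDl// mulr_ge0// ltW.
  by rewrite /s mulrAC divfK ?gt_eqF// gtr_pMr// invf_lt1// ltr1n.
near=> k => x y xy.
have fk : forall x y s, 0 < s ->
  `|f k x - f k y| <= morrey_const (n := n) (p k) s (enorm (x - y)) * (V `^ (p k)^-1 * L).
  by near: k.
have npk : n%:R < p k by near: k.
apply: le_trans (fk x y s s0) _; apply: ltW; apply: le_lt_trans (_ : _ <= morrey_const (n := n) (p k) s s * (V `^ (p k)^-1 * L)) _.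
  by rewrite ler_wpM2r ?mulr_ge0 ?powR_ge0// morrey_const_le.
near: k; exact: (cvgr_lt _ (cvg_morrey_const (d := s) s0)).
Unshelve. all: by end_near. Qed.

Hypothesis fw : forall x, f k x @[k --> F] --> w x.

(** The exponent tends to infinity with [s] fixed, then [s] tends to [0]. It serves twice: for the
    extremal functions along the ultrafilter, and for a constant sequence, to show that the sup norm
    of a gradient is a Lipschitz constant. *)
Lemma morrey_limit_lipschitz x y : `|w x - w y| <= L * enorm (x - y).
Proof.
have H s : 0 < s -> `|w x - w y| <= (enorm (x - y) + n%:R * s) * L.
  move=> s0; apply: (@ler_cvg_to _ F PF R (fun k => `|f k x - f k y|)
    (fun k => morrey_const (n := n) (p k) s (enorm (x - y)) * (V `^ (p k)^-1 * L))).
  - by apply: cvg_norm; apply: cvgB; exact: fw.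
  - exact: cvg_morrey_const.
  - by near=> k; have /(_ x y s s0) : forall x y s, 0 < s ->
      `|f k x - f k y| <= morrey_const (n := n) (p k) s (enorm (x - y)) * (V `^ (p k)^-1 * L) by near: k.
apply/ler_addgt0Pr => e e0.
have C0 : 0 < n%:R * L + 1 by rewrite ltr_wpDl// mulr_ge0.
apply: le_trans (H (e / (n%:R * L + 1)) (divr_gt0 e0 C0)) _.
rewrite mulrDl mulrC lerD2l mulrAC mulrCA ler_piMr ?(ltW e0)//.
by rewrite ler_pdivrMr// mul1r lerDl.
Unshelve. all: by end_near. Qed.

Variable K : set 'rV[R]_n.
Hypotheses (cK : compact K) (fK : forall k x, ~ K x -> f k x = 0).

Lemma morrey_limit_out x : ~ K x -> w x = 0.
Proof.
move=> Kx; have := fw (x := x).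
rewrite (_ : (fun k => f k x) = (fun=> 0)); last by apply/funext => k; exact: fK.
by move=> /(cvg_lim (@Rhausdorff R)) <-; rewrite lim_cst.
Qed.

(** The Arzela-Ascoli argument with compactness of [K] in near-covering form: the asymptotic modulus
    of the [f k], the pointwise convergence at a nearby point and the modulus of [w] contribute
    [e / 3] each. Off [K] all the functions vanish. *)
Lemma morrey_limit_uniform (e : R) : 0 < e ->
  \forall k \near F, forall x, `|f k x - w x| <= e.
Proof.
move=> e0; have e30 : 0 < e / 3 by rewrite divr_gt0.
have [del del0 Hdel] := morrey_equicontinuous e30.
have nc : near_covering K by exact/compact_near_coveringP.
have H := nc nat F (fun k x => `|f k x - w x| <= e) _ _.
have {}H : \forall k \near F, K `<=` [set x | `|f k x - w x| <= e].
  apply: H => x Kx.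
  have lipx : \forall x' \near x, enorm (x' - x) <= del /\ `|w x - w x'| <= e / 3.
    have cw := continuous_lip_enorm L0 morrey_limit_lipschitz.
    have ce : enorm (y - x) @[y --> x] --> (0 : R).
      have e00 : enorm (x - x) = 0 by rewrite subrr enorm0.
      by rewrite -e00; exact: (@continuous_enorm_sub R n x x).
    near=> x'; split.
      by near: x'; exact: (cvgr_le _ ce).
    by near: x'; apply: cvgr_dist_le => //; exact: cw.
  have conv : \forall k \near F, (forall x y, enorm (x - y) <= del -> `|f k x - f k y| <= e / 3)
      /\ `|w x - f k x| <= e / 3.
    apply: filterI => //; near=> k; near: k; apply: cvgr_dist_le => //; exact: fw.
  exists ([set x' | enorm (x' - x) <= del /\ `|w x - w x'| <= e / 3],
    [set k | (forall x y, enorm (x - y) <= del -> `|f k x - f k y| <= e / 3)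
      /\ `|w x - f k x| <= e / 3]) => //= -[x' k] [/= [dx wx] [fk fx]].
  have := fk x' x dx; move: wx fx.
  rewrite !ler_distl; lra.
apply: filterS H => k Hk x.
have [Kx|Kx] := pselect (K x); first exact: Hk.
by rewrite fK// morrey_limit_out// subrr normr0 ltW.
Unshelve. all: by end_near. Qed.

End morrey_limit.

Lemma restricted_uniform_cvg {R : realType} {n : nat} (A : set 'rV[R]_n)
    (f : nat -> 'rV[R]_n -> R) (w : 'rV[R]_n -> R) :
  (forall e : R, 0 < e -> \forall k \near \oo, forall x, A x -> `|f k x - w x| <= e) ->
  {uniform A, f k @[k --> \oo] --> w}.
Proof.
move=> H P /uniform_nbhs[E [/= entE EP]].
have [e /= e0 eE] := entE.
have := H (e / 2) (divr_gt0 e0 (ltr0Sn R 1)); apply: filterS => k Hk.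
apply: EP => x Ax; apply: eE; rewrite /= /ball /= distrC.
apply: le_lt_trans (Hk x Ax) _; by rewrite gtr_pMr// invf_lt1// ltr1n.
Qed.

(** Morrey's inequality at distance [s] with side [s] is a modulus of continuity for the zero
    extension, across the boundary too. *)
Lemma extremal_patch_continuous {R : realType} {n : nat} (Om : set 'rV[R]_n) (p : R)
    (u : 'rV[R]_n -> R) : open Om -> bounded_set Om -> Om !=set0 -> (0 < n)%N -> n%:R < p ->
  positive_extremal Om p u -> continuous (patch (fun=> 0) Om u).
Proof.
move=> oO bO nO n0 np pu x; apply/(@cvgrPdist_le _ _ _ (nbhs x)) => e e0.
pose C := vol Om `^ p^-1 / inradius Om.
have C0 : 0 <= C by rewrite divr_ge0 ?powR_ge0// ltW// inradius_gt0.
have C1 : 0 < C + 1 by rewrite ltr_wpDl.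
have [s s0 hs] := morrey_const_diag_small n0 np (divr_gt0 e0 C1).
near=> z.
have zx : enorm (x - z) <= s.
  rewrite enorm_sub; near: z.
  have h := @continuous_enorm_sub R n x x.
  by apply: (cvgr_le _ h); rewrite subrr enorm0.
apply: le_trans (extremal_morrey oO bO nO n0 np pu x z s0) _; rewrite -/C.
apply: (@le_trans _ _ (e / (C + 1) * C)).
  by rewrite ler_wpM2r//; apply: le_trans hs; exact: morrey_const_le.
by rewrite mulrAC ler_pdivrMr// ler_pM2l// lerDl.
Unshelve. all: by end_near. Qed.

(* The zero extension being continuous, [u] vanishes on the boundary. *)
Lemma patch_closure {R : realType} {n : nat} (Om : set 'rV[R]_n) (u : 'rV[R]_n -> R) :
  open Om -> {within closure Om, continuous u} -> continuous (patch (fun=> 0) Om u) ->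
  forall x, closure Om x -> u x = patch (fun=> 0) Om u x.
Proof.
move=> oO cu cb x clx; have [Ox|Ox] := pselect (Om x); first by rewrite /patch mem_set.
have PF : ProperFilter (within Om (nbhs x)).
  by apply: within_nbhs_proper.
have h1 : u y @[y --> within Om (nbhs x)] --> u x.
  move=> B uB; have h := (subspace_continuousP (closure Om) u).1 cu x clx B uB.
  apply: (@filterS _ (nbhs x) (nbhs_filter x) _ _ _ h) => y hy Oy.
  by apply: hy; exact: subset_closure.
have h2 : u y @[y --> within Om (nbhs x)] --> patch (fun=> 0) Om u x.
  move=> B uB; have h := cb x B uB.
  apply: (@filterS _ (nbhs x) (nbhs_filter x) _ _ _ h) => y /= hy Oy.
  by move: hy; rewrite /patch mem_set.
by apply: (cvg_unique _ h1 h2); exact: Rhausdorff.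
Qed.

Theorem theorem3p3 (R : realType) (N : nat) (Om : set 'rV[R]_N)
    (u : R -> 'rV[R]_N -> R) (x : R -> 'rV[R]_N)
    (hN : (2 <= N)%N)
    (hOm : smooth_bounded_domain Om)
    (hu : forall p : R, N%:R < p -> positive_extremal Om p (u p))
    (hx : forall p : R, N%:R < p -> unique_max_point Om (u p) (x p)) :
  exists (p_ : nat -> R) (xstar : 'rV[R]_N) (uoo : 'rV[R]_N -> R),
    [/\ (forall k, N%:R < p_ k), p_ k @[k --> \oo] --> +oo,
        Om xstar & sobolev0_oo Om uoo] /\
    [/\ (forall r : R, N%:R < r ->
           weak_cvg_sobolev0 Om r (fun k => u (p_ k)) uoo) /\
        {uniform closure Om, u (p_ k) @[k --> \oo] --> uoo},
        grad_norm Om +oo uoo = ((normL Om +oo (dist_boundary Om))^-1)%E,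
        {ae lebesgue_measure_rV R N, forall y, Om y ->
           (0 <= (uoo y)%:E <=
            (dist_boundary Om y)%:E / normL Om +oo (dist_boundary Om))%E},
        x (p_ k) @[k --> \oo] --> xstar &
        [/\ uoo xstar = 1, normL Om +oo uoo = 1%E &
            (dist_boundary Om xstar)%:E = normL Om +oo (dist_boundary Om)]].
Proof.
have [nO oO _ bO _] := hOm; have n0 : (0 < N)%N by exact: ltn_trans hN.
have mO := measurable_open_rV oO.
have R00 := inradius_gt0 oO bO nO n0; set R0 := inradius Om in R00.
pose L := R0^-1; have L0 : 0 < L by rewrite invr_gt0.
have V0 := vol_gt0 oO bO nO; set V := vol Om in V0.
have [M M0 OM] := bounded_cbox_sub bO; set K := cbox _ _ in OM.
have cK : compact K by exact: compact_cbox.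
(* Exponents indexed by [nat], all above [N]; the final sequence is picked among them. *)
pose q k : R := (k + N).+1%:R.
have Nq k : N%:R < q k by rewrite ltr_nat ltnS leq_addl.
have q0 k : 0 < q k by rewrite ltr0n.
pose f k := patch (fun=> 0) Om (u (q k)).
have fout k y : ~ Om y -> f k y = 0 by move=> Oy; rewrite /f /patch memNset.
have fin k y : Om y -> f k y = u (q k) y by move=> Oy; rewrite /f /patch mem_set.
have f01 k y : 0 <= f k y <= 1.
  have [Oy|Oy] := pselect (Om y); last by rewrite fout// lexx ler01.
  by rewrite fin//; have /andP[/ltW -> ->] := extremal_le1 oO (hu _ (Nq k)) Oy.
(* Limits along an ultrafilter exist pointwise; sequences are extracted only at the end. *)
have [U [UU Uoo]] := ultraFilterLemma (eventually_filter).
have PU : ProperFilter U by exact: ultra_proper.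
have fcvg y : exists l : R, f k y @[k --> U] --> l.
  have [|l _ fl] := @ultra_cvg_compact nat R U (fun k => f k y) `[0, 1] UU (@segment_compact R 0 1).
    by move=> k /=; rewrite in_itv/=; exact: f01.
  by exists l.
have [w fw] := choice fcvg.
(* The compact box [K] provides the limit point; nothing yet places [xstar] in the open set [Om]. *)
have xK k : K (x (q k)) by apply: OM; have [] := hx _ (Nq k).
have [xstar _ xs] := ultra_cvg_compact UU cK xK.
have qinf : (q k)^-1 @[k --> \oo] --> (0 : R).
  rewrite (_ : (fun k => _) = (fun k => harmonic (k + N)%N)); last by [].
  by rewrite cvg_shiftn; exact: cvg_harmonic.
have qinfU : (q k)^-1 @[k --> U] --> (0 : R) by move=> B /qinf; exact: Uoo.
have fM : \forall k \near U, forall y z s, 0 < s ->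
    `|f k y - f k z| <= morrey_const (n := N) (q k) s (enorm (y - z)) * (V `^ (q k)^-1 * L).
  by apply: nearW => k y z s s0; exact: (extremal_morrey oO bO nO n0 (Nq k) (hu _ (Nq k))).
have NqU : \forall k \near U, N%:R < q k by exact: nearW.
have wlip y z : `|w y - w z| <= L * enorm (y - z).
  exact: (morrey_limit_lipschitz V0 (ltW L0) qinfU fM fw).
have cw := continuous_lip_enorm (ltW L0) wlip.
have wout y : ~ Om y -> w y = 0.
  move=> Oy; have := fw y; rewrite (_ : (fun k => f k y) = (fun=> 0)).
    by move=> /(cvg_lim (@Rhausdorff R)) <-; rewrite lim_cst.
  by apply/funext => k; exact: fout.
have w01 y : 0 <= w y <= 1.
  apply/andP; split.
    by apply: (@ler_cvg_to _ U PU R (fun=> 0) (f^~ y)) => //; [exact: cvg_cst|apply: nearW => k; have /andP[] := f01 k y].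
  by apply: (@ler_cvg_to _ U PU R (f^~ y) (fun=> 1)) => //; [exact: cvg_cst|apply: nearW => k; have /andP[] := f01 k y].
have unifU (e : R) : 0 < e -> \forall k \near U, forall y, `|f k y - w y| <= e.
  apply: (morrey_limit_uniform V0 (ltW L0) n0 NqU qinfU fM fw cK) => k y Ky.
  by apply: fout => /OM.
have fx k : f k (x (q k)) = 1.
  have Oxk : Om (x (q k)) by have [] := hx _ (Nq k).
  by rewrite fin//; exact: (extremal_max oO (hu _ (Nq k)) (hx _ (Nq k))).
(* Uniform convergence is essential here, since [f k] takes the value [1] at the moving point
   [x (q k)]. *)
have wxs : w xstar = 1.
  apply/eqP; rewrite -subr_eq0 -normr_le0; apply/ler_addgt0Pr => e e0; rewrite add0r.
  have e20 : 0 < e / 2 by rewrite divr_gt0.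
  have wx : w (x (q k)) @[k --> U] --> w xstar by apply: (continuous_cvg _ _ xs); exact: cw.
  have wx' : \forall k \near U, `|w xstar - w (x (q k))| <= e / 2.
    by move/cvgrPdist_le/(_ _ e20): wx.
  have [k [k1 k2]] := filter_ex (filterI wx' (unifU _ e20)).
  by have := k2 (x (q k)); rewrite fx; move: k1; rewrite !ler_norml; lra.
(* [w] vanishes off [Om], while [w xstar = 1]. *)
have Oxs : Om xstar.
  by apply: contrapT => /wout; rewrite wxs => /eqP; rewrite oner_eq0.
(* [w] is [0] at every boundary point [z], so [w y <= L |y - z|]; then the infimum over [z] is
   taken. *)
have wrho y : w y <= dist_boundary Om y * L.
  rewrite -ler_pdivrMr// /L invrK; apply: le_dist_boundary => // z Bz.
  rewrite -ler_pdivlMr// -/L mulrC; apply: le_trans (wlip y z).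
  by rewrite (wout z) ?subr0 ?ler_norm//; exact: boundary_notin.
have rhoxs : dist_boundary Om xstar = R0.
  apply/eqP; rewrite eq_le dist_boundary_inradius//=.
  by have := wrho xstar; rewrite wxs /L ler_pdivlMr// mul1r.
(* Members of an ultrafilter are nonempty, so a single index meets all the requirements. The
   resulting [kap] need not be increasing: [m <= kap m] is enough for the exponents to diverge. *)
have H m : exists k, [/\ (m <= k)%N, forall y, `|f k y - w y| <= m.+1%:R^-1 &
    `|xstar - x (q k)| <= m.+1%:R^-1].
  have m0 : 0 < (m.+1%:R^-1 : R) by rewrite invr_gt0.
  have U1 : \forall k \near U, (m <= k)%N by apply: Uoo; exact: nbhs_infty_ge.
  have U2 : \forall k \near U, `|xstar - x (q k)| <= m.+1%:R^-1.
    by move/cvgrPdist_le/(_ _ m0): xs.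
  have [k [k1 [k2 k3]]] := filter_ex (filterI U1 (filterI U2 (unifU _ m0))).
  by exists k.
have [kap kapP] := choice H.
pose p_ m := q (kap m).
have pge m : m%:R <= p_ m.
  have [mk _ _] := kapP m; rewrite /p_ /q ler_nat; apply: (leq_trans mk).
  by apply: leqW; exact: leq_addr.
have har (e : R) : 0 < e -> \forall m \near \oo, m.+1%:R^-1 <= e.
  by move=> e0; have := @cvg_harmonic R; move=> /(cvgr_le 0); apply.
have unif (e : R) : 0 < e -> \forall m \near \oo, forall y, `|f (kap m) y - w y| <= e.
  move=> /har; apply: filterS => m me y; apply: le_trans me.
  by have [_ h _] := kapP m.
have mw : measurable_fun Om w.
  by apply: measurable_funTS; exact: continuous_measurable_rV.
have wbound y : Om y -> `|w y| <= 1.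
  by move=> _; have /andP[w0 w1] := w01 y; rewrite ger0_norm.
have N2 r : N%:R < r -> 2 <= r :> R.
  by move=> /ltW; apply: le_trans; rewrite ler_nat.
(* Once the exponents exceed [r], Hoelder's inequality bounds the gradients in [L^r] by a quantity
   depending on [r] only, as [weak_cvg_uniform] requires. *)
have weak r : N%:R < r -> weak_cvg_sobolev0 Om r (fun k => u (p_ k)) w /\
    (grad_norm Om r%:E w <= (V `^ r^-1 * L)%:E)%E.
  move=> Nr; have r2 := N2 r Nr; have r1 : 1 <= r by apply: le_trans r2; rewrite ler1n.
  have r0 : 0 < r by exact: lt0_le1.
  apply: (weak_cvg_uniform oO bO r2).
  - have : \forall m \near \oo, r <= m%:R by exact: nbhs_infty_ger.
    apply: filterS => m rm; have rp := le_trans rm (pge m); split.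
      by apply: (sobolev0_sub oO bO r1 rp); have [] := hu _ (Nq (kap m)).
    exact: (extremal_grad_sub oO bO nO n0 (Nq (kap m)) (hu _ (Nq (kap m))) r1 rp).
  - move=> e /unif; apply: filterS => m h y Oy; have := h y; by rewrite fin.
  - exact: (memL_bounded mO (domain_measure_lty oO bO) r0 mw wbound).
have rN1 : N%:R < N.+1%:R :> R by rewrite ltr_nat.
have [[_ [[_ [G wG _]] _] _] _] := weak _ rN1.
have gw := grad_weak_gradient wG.
have oo0 : (0 < +oo :> \bar R)%E by [].
have gradle : (grad_norm Om +oo w <= L%:E)%E.
  apply: (normL_oo_limit (p0 := N%:R) oO bO nO (ltW L0)).
    exact: (weak_gradient_measurable oO gw).
  move=> r Nr; have [_] := weak r Nr; rewrite mulrC EFinM -poweR_EFin volE//.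
have rhoE : normL Om +oo (dist_boundary Om) = R0%:E.
  apply: (normL_oo_sup oO (ltW R00)).
  - move=> y _; apply: (continuous_lip_enorm ler01) => a b; rewrite mul1r.
    exact: dist_boundary_lip.
  - move=> y Oy; rewrite ger0_norm ?dist_boundary_ge0//.
    exact: dist_boundary_inradius.
  - move=> e e0; exists xstar => //; rewrite rhoxs ger0_norm ?(ltW R00)//.
    by rewrite gerBl ltW.
have wE : normL Om +oo w = 1%E.
  apply: (normL_oo_sup oO ler01) => // e e0.
  by exists xstar => //; rewrite wxs normr1 gerBl ltW.
have gradge : (L%:E <= grad_norm Om +oo w)%E.
  pose l := fine (grad_norm Om +oo w).
  have lE : grad_norm Om +oo w = l%:E.
    by rewrite fineK// ge0_fin_numE ?normL_ge0//; apply: le_lt_trans gradle _; rewrite ltry.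
  have l0 : 0 <= l by rewrite fine_ge0// normL_ge0.
  (* The constant sequence [w] with the exponents [q k]: the bound [l] on the gradient becomes
     [V^(1/q) l] in [L^q], which is the hypothesis of [morrey_limit_lipschitz]. *)
  have gM : \forall k \near \oo, forall y z s, 0 < s ->
      `|w y - w z| <= morrey_const (n := N) (q k) s (enorm (y - z)) * (V `^ (q k)^-1 * l).
    apply: nearW => k y z s s0; have [[_ sw _] _] := weak _ (Nq k).
    have wpatch a : patch (fun=> 0) Om w a = w a.
      by rewrite /patch; case: ifPn => // /negP; rewrite inE => /wout ->.
    have := morrey_sobolev0 oO bO n0 (Nq k) sw (fun a _ => cw a) y z s0.
    rewrite /= !wpatch => /le_trans; apply; apply: ler_wpM2l.
      by apply: morrey_const_ge0; rewrite ?enorm_ge0 ?(ltW s0).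
    have q1 : 1 <= q k by rewrite ler1n.
    have [_ _ _ Gw] := sobolevE oO q1 sw.1.
    rewrite -lee_fin fineK; last by rewrite ge0_fin_numE ?normL_ge0.
    rewrite mulrC EFinM -poweR_EFin -(volE oO bO).
    apply: (normL_bounded mO (q0 k) l0); first exact: (weak_gradient_measurable oO gw).
    by apply/(normL_oo_leP _ _ l0); rewrite -lE.
  have wlip' y z : `|w y - w z| <= l * enorm (y - z).
    have wc a : (fun k : nat => (fun=> w) k a) @ \oo --> w a by exact: cvg_cst.
    exact: (morrey_limit_lipschitz (f := fun=> w) V0 l0 qinf gM wc).
  (* [w] falls from [1] at [xstar] to [0] on the boundary, so [1 / l] is at most the distance of
     [xstar] to the boundary, which is [R0]. *)
  have h z : boundary Om z -> 1 <= l * enorm (xstar - z).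
    move=> Bz; apply: le_trans (wlip' xstar z).
    by rewrite (wout z (boundary_notin oO Bz)) subr0 wxs normr1.
  have l1 : 0 < l.
    rewrite lt_neqAle l0 andbT; apply/eqP => l00.
    have [z Bz] := boundary_neq0 oO bO nO n0.
    by have := h z Bz; rewrite -l00 mul0r ler10.
  rewrite lE lee_fin /L -[l]invrK lef_pV2 ?posrE ?invr_gt0// -rhoxs.
  apply: le_dist_boundary => // z Bz.
  by rewrite -[leLHS]mulr1 ler_pdivrMl// h.
have gradE : grad_norm Om +oo w = L%:E by apply/eqP; rewrite eq_le gradle gradge.
exists p_, xstar, w; split; split => //.
- by move=> k; exact: Nq.
- apply/cvgryPge => A; have : \forall m \near \oo, A <= m%:R by exact: nbhs_infty_ger.
  by apply: filterS => m Am; exact: le_trans (pge m).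
- split.
    split; first by split => //; rewrite wE ltry.
    exists (grad Om w) => // i; have [_ lg _] := gw; split; first by have [] := lg i.
    apply: le_lt_trans (normL_coord_le mO i oo0 _) _; first by move=> j; have [] := lg j.
    by rewrite -/(grad_norm _ _ _) gradE ltry.
  (* Exponents [r <= N] are reached from a larger one by inclusion of the spaces. *)
  move=> r r1; have Nm : N%:R < Num.max r N.+1%:R by rewrite lt_max rN1 orbT.
  have [[_ sw _] _] := weak _ Nm.
  by apply: (sobolev0_sub oO bO r1 _ sw); rewrite le_max lexx.
- split; first by move=> r /weak[].
  (* On [closure Om] the function [u (p_ m)] coincides with its zero extension, for which the
     estimate holds everywhere. *)
  apply: restricted_uniform_cvg => e /unif; apply: filterS => m h y cy.
  have [_ cu _ _ _] := hu _ (Nq (kap m)).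
  have cf := extremal_patch_continuous oO bO nO n0 (Nq (kap m)) (hu _ (Nq (kap m))).
  by rewrite (patch_closure oO cu cf cy); exact: h.
- by rewrite gradE rhoE inver gt_eqF.
- apply/nearW => y Oy; rewrite lee_fin (andP (w01 y)).1/= rhoE inver gt_eqF//.
  by rewrite -EFinM lee_fin wrho.
- apply/cvgrPdist_le => e /har; apply: filterS => m me; apply: le_trans me.
  by have [_ _ h] := kapP m.
- by split => //; rewrite rhoE rhoxs.
Qed.
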